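(* Let $\chi:\mathbb{R}^{2d}\to\mathbb{R}^{2d}$ be a transformation satisfying B1 and B2, let $s>2d$, and let $T\in FIO(\chi,s)$. Then $T$ extends to a bounded operator on $M^p(\mathbb{R}^d)$ for every $1\le p\le\infty$, and in particular on $L^2(\mathbb{R}^d)=M^2(\mathbb{R}^d)$.
   Context: Notation: $\langle z\rangle=(1+|z|^2)^{1/2}$. For $z=(x,\eta)\in\mathbb{R}^{2d}$ the time-frequency shift is $\pi(z)f(t)=e^{2\pi i t\cdot\eta}f(t-x)$. The bracket $\langle f,g\rangle$ extends the inner product $\int f\overline{g}$ of $L^2(\mathbb{R}^d)$ to $\mathcal{S}'(\mathbb{R}^d)\times\mathcal{S}(\mathbb{R}^d)$. The short-time Fourier transform is $V_gf(z)=\langle f,\pi(z)g\rangle$. Modulation spaces: for a fixed $g\in\mathcal{S}(\mathbb{R}^d)\setminus\{0\}$ and $1\le p\le\infty$, $M^p(\mathbb{R}^d)$ is the space of $f\in\mathcal{S}'(\mathbb{R}^d)$ with $\|f\|_{M^p}=\|V_gf\|_{L^p(\mathbb{R}^{2d})}<\infty$; different $g$ give equivalent norms. Conditions on $\chi$. B1: $\chi:\mathbb{R}^{2d}\to\mathbb{R}^{2d}$ is smooth, invertible, and preserves the symplectic form, i.e. with $(x,\xi)=\chi(y,\eta)$ one has $dx\wedge d\xi=dy\wedge d\eta$. B2: for every multi-index $\alpha$ with $|\alpha|\ge1$ there is $C_\alpha$ with $|\partial_z^\alpha\chi(z)|\le C_\alpha$ for all $z\in\mathbb{R}^{2d}$.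 Parseval frames: for a lattice $\Lambda=A\mathbb{Z}^{2d}$, $A\in GL(2d,\mathbb{R})$, and $g\in L^2(\mathbb{R}^d)$, the system $\mathcal{G}(g,\Lambda)=\{\pi(\lambda)g:\lambda\in\Lambda\}$ is a Parseval frame if $f=\sum_{\lambda\in\Lambda}\langle f,\pi(\lambda)g\rangle\pi(\lambda)g$ for all $f\in L^2(\mathbb{R}^d)$, equivalently $\sum_{\lambda}|\langle f,\pi(\lambda)g\rangle|^2=\|f\|_2^2$. The class $FIO(\chi,s)$, $s\ge0$: fix a Parseval frame $\mathcal{G}(g,\Lambda)$ with $g\in\mathcal{S}(\mathbb{R}^d)\setminus\{0\}$. A continuous linear operator $T:\mathcal{S}(\mathbb{R}^d)\to\mathcal{S}'(\mathbb{R}^d)$ belongs to $FIO(\chi,s)$ if there is $C>0$ with $|\langle T\pi(\lambda)g,\pi(\mu)g\rangle|\le C\langle\mu-\chi(\lambda)\rangle^{-s}$ for all $\lambda,\mu\in\Lambda$. *)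

(* Defs.v *)
From HB Require Import structures.
From mathcomp Require Import all_boot all_order all_algebra finmap.
From mathcomp Require Import complex.
From mathcomp Require Import all_classical all_reals all_analysis.
From mathcomp Require Import ring lra.

Set Implicit Arguments.
Unset Strict Implicit.
Unset Printing Implicit Defensive.
Import Order.TTheory GRing.Theory Num.Theory.
Import numFieldNormedType.Exports.

Local Open Scope classical_set_scope.
Local Open Scope ring_scope.


(* 'rV[R]_n carries the product sigma-algebra, i.e. the one generated by the
   coordinates; it is the Borel sigma-algebra of R^n. *)
Definition coord (R : realType) n (i : 'I_n) (x : 'rV[R]_n) : R := x ord0 i.

Lemma coord_sigma0 (R : realType) n : g_sigma_preimage (@coord R n) set0.
Proof. exact: sigma_algebra0. Qed.

Lemma coord_sigmaC (R : realType) n A :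
  g_sigma_preimage (@coord R n) A -> g_sigma_preimage (@coord R n) (~` A).
Proof. exact: sigma_algebraC. Qed.

Lemma coord_sigmaU (R : realType) n (F : (set 'rV[R]_n)^nat) :
  (forall i, g_sigma_preimage (@coord R n) (F i)) ->
  g_sigma_preimage (@coord R n) (\bigcup_i F i).
Proof. exact: sigma_algebra_bigcup. Qed.

HB.instance Definition _ (R : realType) n :=
  @isMeasurable.Build default_measure_display 'rV[R]_n
    (g_sigma_preimage (@coord R n))
    (@coord_sigma0 R n) (@coord_sigmaC R n) (@coord_sigmaU R n).

Lemma measurable_coord (R : realType) n (i : 'I_n) :
  measurable_fun [set: 'rV[R]_n] (coord i).
Proof.
move=> _ Y mY; apply: sub_sigma_algebra.
by rewrite -bigcup_seq/=; exists i; [rewrite /= mem_index_enum|exists Y; rewrite ?setTI].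
Qed.

Lemma measurable_rV (R : realType) n d (T : measurableType d)
    (f : T -> 'rV[R]_n) :
  (forall i, measurable_fun setT (coord i \o f)) -> measurable_fun setT f.
Proof.
move=> mf _ A mA; rewrite setTI.
suff : preimage_set_system setT f (g_sigma_preimage (@coord R n)) `<=`
    measurable by apply; exists A => //; rewrite setTI.
rewrite -g_sigma_preimage_comp; apply: smallest_sub.
  exact: sigma_algebra_measurable.
rewrite -bigcup_seq => B [i _ [C mC <-]].
exact: mf.
Qed.

Definition cons_rV (R : realType) n (p : R * 'rV[R]_n) : 'rV[R]_n.+1 :=
  row_mx p.1%:M p.2 : 'rV_(1 + n).

Definition split_rV (R : realType) n (x : 'rV[R]_n.+1) : R * 'rV[R]_n :=
  (x ord0 ord0, rsubmx (x : 'rV_(1 + n))).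

Lemma split_rVK (R : realType) n : cancel (@split_rV R n) (@cons_rV R n).
Proof.
move=> x; apply/rowP => i; rewrite /cons_rV mxE.
case: splitP => j ij /=; rewrite !mxE.
  rewrite {}(ord1 j) eqxx mulr1n in ij *.
  by congr (x _ _); apply/val_inj; rewrite /= ij.
by congr (x _ _); apply/val_inj; rewrite /= ij.
Qed.

Lemma cons_rVK (R : realType) n : cancel (@cons_rV R n) (@split_rV R n).
Proof.
move=> [a y]; rewrite /split_rV /cons_rV row_mxKr/=; congr pair.
rewrite mxE; case: splitP => [j _|j /= j0]; last by move: j0; rewrite add1n.
by rewrite mxE (ord1 j) eqxx mulr1n.
Qed.

Lemma measurable_cons_rV (R : realType) n :
  measurable_fun setT (@cons_rV R n).
Proof.
apply: measurable_rV => i.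
have -> : coord i \o @cons_rV R n = fun p : R * 'rV[R]_n =>
    match fintype.split (i : 'I_(1 + n)) with inl _ => p.1 | inr j => coord j p.2 end.
  apply/funext => p /=; rewrite /coord /cons_rV mxE.
  by case: splitP => [j _|//]; rewrite mxE (ord1 j) eqxx mulr1n.
case: fintype.split => j; first exact: measurable_fst.
by apply: measurableT_comp; [exact: measurable_coord|exact: measurable_snd].
Qed.

Lemma measurable_split_rV (R : realType) n :
  measurable_fun setT (@split_rV R n).
Proof.
apply: measurable_fun_pair; first exact: measurable_coord.
apply: measurable_rV => i.
rewrite (_ : _ \o _ = coord (rshift 1 i : 'I_n.+1)); first exact: measurable_coord.
by apply/funext => x; rewrite /coord /= mxE.
Qed.


(* Restated because the canonical SigmaFiniteMeasure instance of
   product_measure1 is shadowed by the one for subprobabilities. *)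
Lemma product_sigma_finite d1 d2 (T1 : measurableType d1)
    (T2 : measurableType d2) (R : realType)
    (m1 : {sigma_finite_measure set T1 -> \bar R})
    (m2 : {sigma_finite_measure set T2 -> \bar R}) :
  sigma_finite setT (m1 \x m2)%E.
Proof.
have /sigma_finiteP[F [TF ndF Foo]] := sigma_finiteT m1.
have /sigma_finiteP[G [TG ndG Goo]] := sigma_finiteT m2.
exists (fun n => F n `*` G n).
  rewrite -setXTT TF TG predeqE => -[x y]; split.
    move=> [/= [n _ Fnx] [k _ Gky]]; exists (maxn n k) => //; split.
    - by move: x Fnx; exact/subsetPset/ndF/leq_maxl.
    - by move: y Gky; exact/subsetPset/ndG/leq_maxr.
  by move=> [n _ []/= ? ?]; split; exists n.
move=> k; have [? ?] := Foo k; have [? ?] := Goo k.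
split; first exact: measurableX.
by rewrite product_measure1E// lte_mul_pinfty// ge0_fin_numE.
Qed.

Section lebS.
Context (R : realType) (n : nat).
Variable mu : {sigma_finite_measure set 'rV[R]_n -> \bar R}.
Local Open Scope ereal_scope.

Definition lebS : set 'rV[R]_n.+1 -> \bar R :=
  pushforward ((@lebesgue_measure R) \x mu) (@cons_rV R n).

Let mpre (A : set 'rV[R]_n.+1) :
  measurable A -> measurable ((@cons_rV R n) @^-1` A).
Proof. by move=> mA; rewrite -[X in measurable X]setTI; exact: measurable_cons_rV. Qed.

Let lebS0 : lebS set0 = 0.
Proof. by rewrite /lebS /pushforward preimage_set0 measure0. Qed.

Let lebS_ge0 A : 0 <= lebS A.
Proof. by rewrite /lebS /pushforward. Qed.

Let lebS_sigma_additive : semi_sigma_additive lebS.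
Proof.
move=> F mF tF mUF; rewrite /lebS /pushforward preimage_bigcup.
apply: measure_semi_sigma_additive.
- by move=> k; exact: mpre.
- apply/trivIsetP => /= i j _ _ ij; rewrite -preimage_setI.
  by move/trivIsetP : tF => /(_ _ _ _ _ ij) ->//; rewrite preimage_set0.
- by rewrite -preimage_bigcup; exact: mpre.
Qed.

HB.instance Definition _ := isMeasure.Build _ _ _
  lebS lebS0 lebS_ge0 lebS_sigma_additive.

Let lebS_sigma_finite : sigma_finite setT lebS.
Proof.
have [F FT mF] := product_sigma_finite (@lebesgue_measure R) mu.
exists (fun k => (@split_rV R n) @^-1` F k).
  by rewrite -preimage_bigcup -FT preimage_setT.
move=> k; have [mFk Fk] := mF k; split.
  by rewrite -[X in measurable X]setTI; exact: measurable_split_rV.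
rewrite /lebS /pushforward -comp_preimage (_ : _ \o _ = id) ?preimage_id//.
by apply/funext => p; exact: cons_rVK.
Qed.

HB.instance Definition _ := @Measure_isSigmaFinite.Build _ _ _
  lebS lebS_sigma_finite.
End lebS.

(* Lebesgue measure on R^n: R^(n+1) is identified with R * R^n by cons_rV. *)
Fixpoint leb (R : realType) (n : nat) :
    {sigma_finite_measure set 'rV[R]_n -> \bar R} :=
  match n with
  | 0 => \d_(0 : 'rV[R]_0)
  | m.+1 => lebS (leb R m)
  end.

Definition dotp (R : realType) n (x y : 'rV[R]_n) : R := (x *m y^T) 0 0.

(* The norm `|x| of 'rV[R]_n is the max norm; this is the Euclidean one. *)
Definition enorm (R : realType) n (x : 'rV[R]_n) : R := Num.sqrt (dotp x x).

Definition jap (R : realType) n (x : 'rV[R]_n) : R :=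
  Num.sqrt (1 + enorm x ^+ 2).

(* Multi-indices are lists of coordinate directions, |alpha| = size s: since
   smooth below asks all these iterated derivatives to be differentiable, the
   order of the directions is immaterial. *)
Definition partial (R : realType) n (W : normedModType R)
    (s : seq 'I_n) (f : 'rV[R]_n -> W) : 'rV[R]_n -> W :=
  foldr (fun i (h : 'rV[R]_n -> W) => 'D_'e_i h) f s.

Definition smooth (R : realType) n (W : normedModType R)
    (f : 'rV[R]_n -> W) : Prop :=
  forall s x, differentiable (partial s f) x.

Lemma dotpE (R : realType) n (x y : 'rV[R]_n) :
  dotp x y = \sum_i x 0 i * y 0 i.
Proof. by rewrite /dotp mxE; apply: eq_bigr => i _; rewrite mxE. Qed.

Lemma dotp_ge0 (R : realType) n (x : 'rV[R]_n) : 0 <= dotp x x.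
Proof. by rewrite dotpE; apply: sumr_ge0 => i _; rewrite -expr2 sqr_ge0. Qed.

Lemma sqr_enorm (R : realType) n (x : 'rV[R]_n) : enorm x ^+ 2 = dotp x x.
Proof. by rewrite sqr_sqrtr// dotp_ge0. Qed.

Lemma sqr_jap (R : realType) n (x : 'rV[R]_n) : jap x ^+ 2 = 1 + dotp x x.
Proof. by rewrite sqr_sqrtr sqr_enorm// addr_ge0// dotp_ge0. Qed.

Lemma jap_ge0 (R : realType) n (x : 'rV[R]_n) : 0 <= jap x.
Proof. exact: sqrtr_ge0. Qed.

Lemma jap_shift (R : realType) n (x y : 'rV[R]_n) :
  jap y <= 2 * jap x * jap (y - x).
Proof.
rewrite -ler_sqr ?nnegrE ?mulr_ge0 ?jap_ge0//.
rewrite !exprMn !sqr_jap.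
have H : dotp y y <= 2 * dotp x x + 2 * dotp (y - x) (y - x).
  rewrite !dotpE !mulr_sumr -big_split/=; apply: ler_sum => i _.
  by rewrite !mxE; have := sqr_ge0 (y 0 i - 2 * x 0 i); nra.
have := dotp_ge0 x; have := dotp_ge0 (y - x); nra.
Qed.

(* Auxiliary, for the closure proofs only: an inductive form of the decay
   conditions on the derivatives of order <= k; see decaysP. *)
Fixpoint decays (R : realType) n (N k : nat) (f : 'rV[R]_n -> R) : Prop :=
  [/\ forall x, differentiable f x,
      exists C, forall x, jap x ^+ N * `|f x| <= C &
      match k with
      | 0 => True
      | k'.+1 => forall i, decays N k' ('D_'e_i f)
      end].

Lemma decaysS (R : realType) n N k (f : 'rV[R]_n -> R) :
  decays N k.+1 f -> decays N k f.
Proof.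
elim: k f => [|k IH] f [df bf Df]; split=> // i; exact/IH/Df.
Qed.

Lemma decaysP (R : realType) n N (f : 'rV[R]_n -> R) :
  (forall k, decays N k f) <->
  smooth f /\ forall s, exists C, forall x, jap x ^+ N * `|partial s f x| <= C.
Proof.
split=> [H|[sf bf] k].
  suff K s : (forall x, differentiable (partial s f) x) /\
      exists C, forall x, jap x ^+ N * `|partial s f x| <= C.
    by split=> [s|s]; [exact: (K s).1|exact: (K s).2].
  suff : decays N 0 (partial s f) by case.
  have : forall k, decays N k (partial s f).
    elim: s => [//|i s IH] k; by have [_ _] := IH k.+1; exact.
  exact.
suff : forall s, decays N k (partial s f) by move/(_ [::]).
elim: k => [|k IH] s; split=> // i.
exact: (IH (i :: s)).
Qed.

Lemma decaysD (R : realType) n N k (f g : 'rV[R]_n -> R) :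
  decays N k f -> decays N k g -> decays N k (f \+ g).
Proof.
elim: k f g => [|k IH] f g [df [A bf] Df] [dg [B bg] Dg]; split.
1,4: by move=> x; exact: differentiableD.
1,3: exists (A + B) => x; apply: le_trans (lerD (bf x) (bg x));
  by rewrite -mulrDr ler_wpM2l ?ler_normD// exprn_ge0// jap_ge0.
- by [].
- move=> i; rewrite (_ : 'D_ _ _ = 'D_'e_i f \+ 'D_'e_i g).
    exact: (IH _ _ (Df i) (Dg i)).
  by apply/funext => x; rewrite deriveD//; exact: diff_derivable.
Qed.

Lemma decaysM (R : realType) n N k (h f : 'rV[R]_n -> R) :
  decays 0 k h -> decays N k f -> decays N k (h \* f).
Proof.
elim: k h f => [|k IH] h f hh ff; have [dh [A bh] Dh] := hh;
  have [df [B bf] Df] := ff; split.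
1,4: by move=> x; exact: differentiableM.
1,3: exists (A * B) => x; rewrite normrM mulrCA; apply: ler_pM => //;
  by [rewrite mulr_ge0// exprn_ge0// jap_ge0|have := bh x; rewrite mul1r].
- by [].
- move=> i; rewrite (_ : 'D_ _ _ =
    (h \* 'D_'e_i f) \+ ('D_'e_i h \* f)).
    apply: decaysD; apply: IH; by [exact: Dh|exact: Df|exact: decaysS].
  apply/funext => x; rewrite deriveM; [|exact: diff_derivable..].
  by rewrite /= [f x *: _]mulrC.
Qed.

Lemma decays_cst (R : realType) n k (c : R) : decays 0 k (fun _ : 'rV[R]_n => c).
Proof.
elim: k c => [|k IH] c; split=> //; try by exists `|c| => x; rewrite mul1r.
by move=> i; rewrite (_ : 'D_ _ _ = cst 0) ?derive_cst//; [exact: IH|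
  apply/funext => x; rewrite derive_cst].
Qed.

Lemma decays_shift (R : realType) n N k (f : 'rV[R]_n -> R) (a : 'rV[R]_n) :
  decays N k f -> decays N k (fun x => f (x - a)).
Proof.
have dsub x : differentiable (fun y : 'rV[R]_n => y - a) x.
  exact: differentiableB.
elim: k f => [|k IH] f [df [C bf] Df]; split.
1,4: by move=> x; apply: (@differentiable_comp _ _ _ _ (fun y => y - a) f).
1,3: exists ((2 * jap a) ^+ N * C) => x;
  apply: le_trans (ler_wpM2l _ (bf (x - a))); rewrite ?exprn_ge0 ?mulr_ge0 ?jap_ge0//;
  rewrite mulrA ler_wpM2r// -exprMn lerXn2r ?nnegrE ?mulr_ge0 ?jap_ge0//;
  exact: jap_shift.
- by [].
- move=> i; rewrite (_ : 'D_ _ _ = fun x => 'D_'e_i f (x - a)).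
    exact: (IH _ (Df i)).
  apply/funext => x; rewrite /derive.
  by under eq_fun do rewrite /= -addrA.
Qed.

Lemma decays_trig (R : realType) n k (eta : 'rV[R]_n) (c : R) :
  decays 0 k (fun t => c * cos (2 * pi * dotp t eta)) /\
  decays 0 k (fun t => c * sin (2 * pi * dotp t eta)).
Proof.
pose l : 'rV[R]_n -> R := fun t => 2 * pi * dotp t eta.
have dl x : differentiable l x.
  rewrite (_ : l = \sum_(j < n) (fun t : 'rV[R]_n => (2 * pi * eta 0 j) *: t 0 j)).
    apply: (@differentiable_sum _ _ _ n (fun j (t : 'rV[R]_n) => (2 * pi * eta 0 j) *: t 0 j)) => j.
    apply: (@differentiableZ _ _ _ (fun t : 'rV[R]_n => t 0 j)).
    exact: differentiable_coord.
  apply/funext => t; rewrite /l dotpE mulr_sumr fct_sumE; apply: eq_bigr => j _.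
  by rewrite /= /GRing.scale/=; ring.
have Dl x i : 'd l x 'e_i = 2 * pi * eta 0 i.
  rewrite -deriveE// /derive; apply: lim_near_cst => //; near=> h.
  rewrite /l /= -mulrBr !dotpE -sumrB (bigD1 i)//= big1 => [|j ji].
    rewrite !mxE !eqxx /GRing.scale /=.
    have h0 : h != 0 by near: h; exact: nbhs_dnbhs_neq.
    by field.
  by rewrite !mxE eqxx /= (negPf ji) /GRing.scale /=; ring.
have dcos x : differentiable (cos \o l) x.
  by apply: differentiable_comp => //; apply/derivable1_diffP.
have dsin x : differentiable (sin \o l) x.
  by apply: differentiable_comp => //; apply/derivable1_diffP.
have Dc x i : 'D_'e_i (cos \o l) x = - (2 * pi * eta 0 i) * sin (l x).
  rewrite deriveE// diff_comp//; last by apply/derivable1_diffP.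
  rewrite /= Dl diff1E; last by apply/derivable1_diffP.
  rewrite derive1E derive_val /GRing.scale/=; ring.
have Ds x i : 'D_'e_i (sin \o l) x = (2 * pi * eta 0 i) * cos (l x).
  rewrite deriveE// diff_comp//; last by apply/derivable1_diffP.
  rewrite /= Dl diff1E; last by apply/derivable1_diffP.
  rewrite derive1E derive_val /GRing.scale/=; ring.
elim: k c => [|k IH] c; split; split.
1,4,7,10: by move=> x; apply: (@differentiableZ _ _ _ (_ \o l) c x).
1,3,5,7: exists `|c| => x; rewrite mul1r normrM ler_piMr//;
  by rewrite ?cos_max ?sin_max.
1,2: by [].
- move=> i; have [_ +] := IH (- (2 * pi * eta 0 i) * c).
  congr decays; apply/funext => x.
  rewrite (_ : (fun t => _) = c \*: (cos \o l))// deriveZ; last exact: diff_derivable.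
  by rewrite Dc /GRing.scale/= /l; ring.
- move=> i; have [+ _] := IH ((2 * pi * eta 0 i) * c).
  congr decays; apply/funext => x.
  rewrite (_ : (fun t => _) = c \*: (sin \o l))// deriveZ; last exact: diff_derivable.
  by rewrite Ds /GRing.scale/= /l; ring.
Unshelve. all: by end_near. Qed.

Definition cabs (R : realType) (z : R[i]) : R := Normc.normc z.

Definition cpartial (R : realType) n (s : seq 'I_n) (f : 'rV[R]_n -> R[i]) :
    'rV[R]_n -> R[i] :=
  fun x => Complex (partial s (fun y => complex.Re (f y)) x)
                   (partial s (fun y => complex.Im (f y)) x).

Definition csmooth (R : realType) n (f : 'rV[R]_n -> R[i]) : Prop :=
  smooth (fun x => complex.Re (f x)) /\ smooth (fun x => complex.Im (f x)).

Definition is_schwartz (R : realType) n (f : 'rV[R]_n -> R[i]) : Prop :=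
  csmooth f /\ forall N s, exists C : R,
    forall x, jap x ^+ N * cabs (cpartial s f x) <= C.

Lemma cabs_ge0 (R : realType) (z : R[i]) : 0 <= cabs z.
Proof. by case: z => a b; exact: sqrtr_ge0. Qed.

Lemma cabsD (R : realType) (z w : R[i]) : cabs (z + w) <= cabs z + cabs w.
Proof. exact: (@ler_normD _ (Rcomplex R)). Qed.

Lemma cabs_Re (R : realType) (a b : R) : `|a| <= cabs (Complex a b).
Proof. by rewrite /cabs /= -sqrtr_sqr ler_wsqrtr// lerDl sqr_ge0. Qed.

Lemma cabs_Im (R : realType) (a b : R) : `|b| <= cabs (Complex a b).
Proof. by rewrite /cabs /= -sqrtr_sqr ler_wsqrtr// lerDr sqr_ge0. Qed.

Lemma cabs_le (R : realType) (a b : R) : cabs (Complex a b) <= `|a| + `|b|.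
Proof.
rewrite /cabs /= -(ger0_norm (addr_ge0 (normr_ge0 a) (normr_ge0 b))).
rewrite -sqrtr_sqr ler_wsqrtr// sqrrD !real_normK ?num_real//.
by rewrite addrAC lerDl mulrn_wge0// mulr_ge0.
Qed.

Lemma is_schwartzP (R : realType) n (f : 'rV[R]_n -> R[i]) :
  is_schwartz f <-> forall N k, decays N k (fun x => complex.Re (f x)) /\
                                decays N k (fun x => complex.Im (f x)).
Proof.
split=> [[[sr si] bf] N|H].
  have Hr : forall k, decays N k (fun x => complex.Re (f x)).
    apply/decaysP; split=> // s; have [C HC] := bf N s; exists C => x.
    apply: le_trans (HC x); rewrite ler_wpM2l ?exprn_ge0 ?jap_ge0//.
    exact: cabs_Re.
  have Hi : forall k, decays N k (fun x => complex.Im (f x)).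
    apply/decaysP; split=> // s; have [C HC] := bf N s; exists C => x.
    apply: le_trans (HC x); rewrite ler_wpM2l ?exprn_ge0 ?jap_ge0//.
    exact: cabs_Im.
  by [].
have Hr N := (decaysP N (fun x => complex.Re (f x))).1 (fun k => (H N k).1).
have Hi N := (decaysP N (fun x => complex.Im (f x))).1 (fun k => (H N k).2).
split; first by split; [exact: (Hr 0%N).1|exact: (Hi 0%N).1].
move=> N s; have [A HA] := (Hr N).2 s; have [B HB] := (Hi N).2 s.
exists (A + B) => x; apply: le_trans (lerD (HA x) (HB x)).
by rewrite -mulrDr ler_wpM2l ?exprn_ge0 ?jap_ge0//; exact: cabs_le.
Qed.

Definition schwartz_pred (R : realType) n : {pred 'rV[R]_n -> R[i]} :=
  fun f => `[< is_schwartz f >].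

Lemma schwartz_submod_closed (R : realType) n :
  submod_closed (@schwartz_pred R n).
Proof.
have cM a N k (h : 'rV[R]_n -> R) : decays N k h -> decays N k (fun x => a * h x).
  by move=> dh; exact: (@decaysM _ _ _ _ (fun=> a) h (@decays_cst R n k a) dh).
split=> [|a f g /asboolP/is_schwartzP hf /asboolP/is_schwartzP hg];
    apply/asboolP/is_schwartzP => N k.
  have d0 : decays N k (fun _ : 'rV[R]_n => (0 : R)).
    elim: k => [|k IH]; split=> //; try by exists 0 => x; rewrite normr0 mulr0.
    move=> i; rewrite (_ : 'D_ _ _ = fun=> 0)//.
    by apply/funext => x; rewrite derive_cst.
  by [].
have [fr fi] := hf N k; have [gr gi] := hg N k.
have ReE x : complex.Re ((a *: f + g) x) =
    complex.Re a * complex.Re (f x) + (- complex.Im a * complex.Im (f x)) + complex.Re (g x).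
  by rewrite /= !fctE /GRing.scale /=; case: (f x) (g x) {hf hg fr fi gr gi} => [? ?] [? ?]; case: (a) => [? ?] /=; rewrite mulNr.
have ImE x : complex.Im ((a *: f + g) x) =
    complex.Re a * complex.Im (f x) + complex.Im a * complex.Re (f x) + complex.Im (g x).
  by rewrite /= !fctE /GRing.scale /=; case: (f x) (g x) {hf hg fr fi gr gi} => [? ?] [? ?]; case: (a) => [? ?] /=.
split.
  have := decaysD (decaysD (cM (complex.Re a) _ _ _ fr)
    (cM (- complex.Im a) _ _ _ fi)) gr.
  by congr decays; apply/funext => x; rewrite ReE.
have := decaysD (decaysD (cM (complex.Re a) _ _ _ fi)
  (cM (complex.Im a) _ _ _ fr)) gi.
by congr decays; apply/funext => x; rewrite ImE.
Qed.

HB.instance Definition _ (R : realType) n :=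
  GRing.isSubmodClosed.Build R[i] ('rV[R]_n -> R[i]) (@schwartz_pred R n)
    (@schwartz_submod_closed R n).

Record schwartz (R : realType) (n : nat) := Schwartz {
  schwartz_fun :> 'rV[R]_n -> R[i];
  schwartz_funP : schwartz_fun \in @schwartz_pred R n }.

HB.instance Definition _ R n := [isSub for @schwartz_fun R n].
HB.instance Definition _ R n := [Choice of schwartz R n by <:].
HB.instance Definition _ R n :=
  [SubChoice_isSubLmodule of schwartz R n by <:].

(* pi(z) g (t) = e^(2 pi i t.eta) g(t - x) for z = (x, eta). *)
Definition tfshift_fun (R : realType) d (z : 'rV[R]_(d + d))
    (g : 'rV[R]_d -> R[i]) (t : 'rV[R]_d) : R[i] :=
  let theta := 2 * pi * dotp t (rsubmx z) in
  Complex (cos theta) (sin theta) * g (t - lsubmx z).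

Lemma tfshift_schwartz (R : realType) d (z : 'rV[R]_(d + d))
  (g : schwartz R d) : tfshift_fun z g \in @schwartz_pred R d.
Proof.
have /asboolP/is_schwartzP hg := schwartz_funP g.
apply/asboolP/is_schwartzP => N k.
have [gr gi] := hg N k.
have {}gr := decays_shift (lsubmx z) gr; have {}gi := decays_shift (lsubmx z) gi.
have [dc _] := decays_trig k (rsubmx z) 1.
have [_ ds] := decays_trig k (rsubmx z) 1.
have [_ dm] := decays_trig k (rsubmx z) (-1).
split.
  have := decaysD (decaysM dc gr) (decaysM dm gi).
  congr decays; apply/funext => x; rewrite /tfshift_fun/=.
  by case: (g _) => a b /=; ring.
have := decaysD (decaysM dc gi) (decaysM ds gr).
congr decays; apply/funext => x; rewrite /tfshift_fun/=.
by case: (g _) => a b /=; ring.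
Qed.

Definition tfshift (R : realType) d (z : 'rV[R]_(d + d)) (g : schwartz R d) :
  schwartz R d := Schwartz (tfshift_schwartz z g).

(* These seminorms generate the topology of the Schwartz space. *)
Definition seminorm (R : realType) n (N : nat) (f : schwartz R n) : \bar R :=
  ereal_sup [set y | exists x s,
    (size s <= N)%N /\ y = (jap x ^+ N * cabs (cpartial s f x))%:E].

(* S' is realised as the space of continuous antilinear functionals on S, so
   that u phi is the sesquilinear bracket <u, phi> extending the L^2 inner
   product; this is phi |-> v(conj phi) for v in the usual S'. Continuity is
   continuity of a (semi)linear map between spaces topologised by seminorms. *)
Definition is_tempered (R : realType) n (u : schwartz R n -> R[i]) : Prop :=
  (forall (a : R[i]) (f g : schwartz R n),
     u (a *: f + g) = conjc a * u f + u g) /\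
  exists (N : nat) (C : R), 0 <= C /\
    forall f, ((cabs (u f))%:E <= C%:E * seminorm N f)%E.

Definition tempered_pred (R : realType) n : {pred schwartz R n -> R[i]} :=
  fun u => `[< is_tempered u >].

Lemma seminorm_ge0 (R : realType) n N (f : schwartz R n) :
  (0 <= seminorm N f)%E.
Proof.
apply: le_trans (ereal_sup_ubound _); last by exists 0, [::].
by rewrite lee_fin mulr_ge0 ?cabs_ge0// exprn_ge0// jap_ge0.
Qed.

Lemma seminorm_le (R : realType) n N M (f : schwartz R n) :
  (N <= M)%N -> (seminorm N f <= seminorm M f)%E.
Proof.
move=> NM; apply: ub_ereal_sup => _ [x [s [sN ->]]].
apply: le_trans (ereal_sup_ubound _); last first.
  by exists x, s; split; first exact: leq_trans NM.
rewrite lee_fin ler_wpM2r ?cabs_ge0// ler_weXn2l//.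
rewrite -[1]sqrtr1 ler_wsqrtr// lerDl sqr_ge0//.
Qed.

Lemma tempered_submod_closed (R : realType) n :
  submod_closed (@tempered_pred R n).
Proof.
split=> [|a u v /asboolP[ul [N [A [A0 uA]]]] /asboolP[vl [M [B [B0 vB]]]]];
    apply/asboolP.
  have z h : (0 : schwartz R n -> R[i]) h = 0 by [].
  split=> [a f g|]; first by rewrite !z mulr0 addr0.
  exists 0%N, 0; split=> // f; by rewrite mul0e z /cabs Normc.normc0.
split=> [b f g|].
  by rewrite !fctE /GRing.scale/= ul vl; ring.
exists (maxn N M), (cabs a * A + B); split.
  by rewrite addr_ge0// mulr_ge0// cabs_ge0.
move=> f; rewrite !fctE.
apply: (@le_trans _ _ ((cabs a)%:E * (cabs (u f))%:E + (cabs (v f))%:E)%E).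
  rewrite -EFinM -EFinD lee_fin (le_trans (cabsD _ _))// lerD2r.
  by rewrite /cabs Normc.normcM.
rewrite EFinD ge0_muleDl ?lee_fin// ?mulr_ge0 ?cabs_ge0//.
apply: leeD.
  rewrite EFinM -muleA; apply: lee_wpmul2l; first by rewrite lee_fin cabs_ge0.
  apply: le_trans (uA f) _; apply: lee_wpmul2l; first by rewrite lee_fin.
  by apply: seminorm_le; rewrite leq_maxl.
apply: le_trans (vB f) _; apply: lee_wpmul2l; first by rewrite lee_fin.
by apply: seminorm_le; rewrite leq_maxr.
Qed.

HB.instance Definition _ (R : realType) n :=
  GRing.isSubmodClosed.Build R[i] (schwartz R n -> R[i]) (@tempered_pred R n)
    (@tempered_submod_closed R n).

Record tempered (R : realType) (n : nat) := Tempered {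
  tempered_fun :> schwartz R n -> R[i];
  tempered_funP : tempered_fun \in @tempered_pred R n }.

HB.instance Definition _ R n := [isSub for @tempered_fun R n].
HB.instance Definition _ R n := [Choice of tempered R n by <:].
HB.instance Definition _ R n :=
  [SubChoice_isSubLmodule of tempered R n by <:].

(* Continuity of a linear T : S -> S', S' having the topology generated by the
   seminorms u |-> |u phi|. *)
Definition continuous_op (R : realType) n
    (T : schwartz R n -> tempered R n) : Prop :=
  forall phi, exists (N : nat) (C : R),
    forall f, ((cabs (T f phi))%:E <= C%:E * seminorm N f)%E.

Definition cmeasurable (R : realType) n (f : 'rV[R]_n -> R[i]) : Prop :=
  measurable_fun setT (fun x => complex.Re (f x)) /\
  measurable_fun setT (fun x => complex.Im (f x)).

Definition cintegral (R : realType) n (f : 'rV[R]_n -> R[i]) : R[i] :=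
  Complex (\int[leb R n]_x complex.Re (f x)) (\int[leb R n]_x complex.Im (f x)).

Definition Lpnorm (R : realType) n (p : \bar R) (f : 'rV[R]_n -> R[i]) :
    \bar R :=
  Lnorm (leb R n) p (fun x => (cabs (f x))%:E).

Definition L2 (R : realType) n (f : 'rV[R]_n -> R[i]) : Prop :=
  cmeasurable f /\ (Lpnorm 2%:E f < +oo)%E.

Definition inner (R : realType) n (f h : 'rV[R]_n -> R[i]) : R[i] :=
  cintegral (fun t => f t * conjc (h t)).

(* u is the tempered distribution given by the function f. *)
Definition represents (R : realType) n (f : 'rV[R]_n -> R[i])
    (u : tempered R n) : Prop :=
  forall phi : schwartz R n, u phi = inner f phi.

Definition stft (R : realType) d (g : schwartz R d) (u : tempered R d)
    (z : 'rV[R]_(d + d)) : R[i] :=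
  u (tfshift z g).

Definition modnorm (R : realType) d (w : schwartz R d) (p : \bar R)
    (u : tempered R d) : \bar R :=
  Lpnorm p (stft w u).

Definition modspace (R : realType) d (w : schwartz R d) (p : \bar R) :
    set (tempered R d) :=
  [set u | modnorm w p u < +oo]%E.

Definition L2space (R : realType) d : set (tempered R d) :=
  [set u | exists2 f, L2 f & represents f u].

(* The functions f below all agree almost everywhere. *)
Definition L2norm (R : realType) d (u : tempered R d) : \bar R :=
  ereal_inf [set Lpnorm 2%:E f | f in [set f | L2 f /\ represents f u]].

(* T extends to a bounded linear operator on the normed space (X, N) of
   tempered distributions. Tx is a total function whose values off X are
   irrelevant; u ranges over the distribution given by the function f. *)
Definition extends_boundedly (R : realType) d
    (T : schwartz R d -> tempered R d)
    (X : set (tempered R d)) (N : tempered R d -> \bar R) : Prop :=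
  exists Tx : tempered R d -> tempered R d,
    [/\ forall u, X u -> X (Tx u),
        forall (a : R[i]) u v, X u -> X v -> Tx (a *: u + v) = a *: Tx u + Tx v,
        exists C : R, forall u, X u -> (N (Tx u) <= C%:E * N u)%E &
        forall (f : schwartz R d) u, represents f u -> Tx u = T f].

(* Equal spaces with equivalent norms. *)
Definition same_normed_space (R : realType) d
    (X : set (tempered R d)) (N : tempered R d -> \bar R)
    (Y : set (tempered R d)) (M : tempered R d -> \bar R) : Prop :=
  X = Y /\ exists c C : R, [/\ 0 < c, 0 < C &
    forall u, X u -> (c%:E * N u <= M u /\ M u <= C%:E * N u)%E].

Definition lattice_pt (R : realType) m (A : 'M[R]_m) (k : 'cV[int]_m) :
    'rV[R]_m :=
  (A *m map_mx intr k)^T.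

(* The frame operator of {pi(lambda) g : lambda in A Z^(2d)}, restricted to the
   finitely many lattice points A k, k in F. *)
Definition frame_sum (R : realType) d (g : 'rV[R]_d -> R[i])
    (A : 'M[R]_(d + d)) (F : {fset 'cV[int]_(d + d)}) (f : 'rV[R]_d -> R[i]) :
    'rV[R]_d -> R[i] :=
  fun t => \sum_(k <- F)
    inner f (tfshift_fun (lattice_pt A k) g) * tfshift_fun (lattice_pt A k) g t.

(* f = sum over the lattice of <f, pi(lambda) g> pi(lambda) g, with
   unconditional convergence in L^2. *)
Definition parseval_frame (R : realType) d (g : 'rV[R]_d -> R[i])
    (A : 'M[R]_(d + d)) : Prop :=
  forall f, L2 f -> forall eps : R, 0 < eps ->
  exists F0 : {fset 'cV[int]_(d + d)},
    forall F : {fset 'cV[int]_(d + d)}, (F0 `<=` F)%fset ->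
    (Lpnorm 2%:E (fun t => (f t - frame_sum g A F f t)%R) < eps%:E)%E.

(* sum_j dx_j /\ dxi_j, on R^(2d) = R^d x R^d. *)
Definition sympl (R : realType) d (u v : 'rV[R]_(d + d)) : R :=
  dotp (lsubmx u) (rsubmx v) - dotp (rsubmx u) (lsubmx v).

Definition condB1 (R : realType) d
    (chi : 'rV[R]_(d + d) -> 'rV[R]_(d + d)) : Prop :=
  [/\ smooth chi, bijective chi &
      forall z u v, sympl ('d chi z u) ('d chi z v) = sympl u v].

Definition condB2 (R : realType) d
    (chi : 'rV[R]_(d + d) -> 'rV[R]_(d + d)) : Prop :=
  forall s : seq 'I_(d + d), (0 < size s)%N ->
  exists C : R, forall z, enorm (partial s chi z) <= C.

Definition FIO (R : realType) d (g : schwartz R d) (A : 'M[R]_(d + d))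
    (chi : 'rV[R]_(d + d) -> 'rV[R]_(d + d)) (s : R)
    (T : schwartz R d -> tempered R d) : Prop :=
  [/\ linear T, continuous_op T & exists2 C : R, 0 < C &
  forall k l : 'cV[int]_(d + d),
    let lam := lattice_pt A k in let mu := lattice_pt A l in
    cabs (T (tfshift lam g) (tfshift mu g)) <= C * jap (mu - chi lam) `^ (- s)].

(* Main.v *)
(** Write e_k = pi(lambda_k) g for the atoms of the frame. A tempered u is
    determined by its coefficients u(e_k): for Schwartz f the partial sums of
    the frame expansion converge to f in every seminorm, since they are
    bounded in stronger seminorms and converge in L^2, whence
    u = sum_k u(e_k) e_k weakly. By Moyal's identity this also gives the
    reproducing formula u = const * int V_w u(z) pi(z) w dz. As
    |<e_k, pi(z) w>| decays rapidly in z - lambda_k, Schur's test shows that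
    |V_w u|_{L^p} and |u(e_k)|_{l^p} are equivalent, for every window w. On
    coefficients T acts by the matrix <T e_k, e_l>, dominated by
    C <lambda_l - chi(lambda_k)>^{-s}; its column sums are bounded since
    s > 2d, its row sums because moreover chi^{-1} is Lipschitz at large scale:
    the symplectic condition bounds the inverse of d chi uniformly, so the
    inverse function theorem holds at a uniform scale. A second application of
    Schur's test bounds the matrix on l^p. Finally M^2 = L^2 follows from
    Bessel's inequality and the Riesz-Fischer theorem for the frame. *)

From HB Require Import structures.
Require Import Defs.
From mathcomp Require Import all_boot all_order all_algebra finmap.
From mathcomp Require Import complex.
From mathcomp Require Import all_classical all_reals all_analysis.
From mathcomp Require Import measurable_realfun ess_sup_inf.
From mathcomp Require Import zify ring lra.

Set Implicit Arguments.
Unset Strict Implicit.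
Unset Printing Implicit Defensive.
Import Order.TTheory GRing.Theory Num.Theory.
Import numFieldNormedType.Exports.

Local Open Scope classical_set_scope.
Local Open Scope ring_scope.

(** * Complex-valued integrals *)

(** Schwartz functions are not dense in M^p for [p = +oo], so the operator cannot be extended by
    density. The extension is given by a formula instead: take the coefficients u(e_k), apply the
    matrix, resynthesise weakly. Each step makes sense as soon as the coefficients are bounded,
    which holds on every M^p, so one map serves all p; it agrees with T on Schwartz functions
    because T is continuous and their frame expansions converge in S. Sequences are integrated
    against counting measure, so that a single Schur test covers the passages from functions to
    sequences, from sequences to functions, and between sequences.

    No explicit transform is ever computed. With h^ the Fourier transform of h, the identity int
    h^(eta) phi(eps eta) d eta = int h(eps s) phi^(s) ds gives, as eps tends to 0, phi(0) int h^ =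
    h(0) int phi^. So int h^ is a fixed multiple of h(0); this yields inversion, Parseval and Moyal
    up to a constant, and a nonzero constant is all that the reproducing formula asks for. *)

Section ComplexModulus.
Context {R : realType}.
Implicit Types (z w : R[i]) (a b : R).

Lemma cReD z w : complex.Re (z + w) = complex.Re z + complex.Re w.
Proof. by case: z w => [? ?] [? ?]. Qed.

Lemma cImD z w : complex.Im (z + w) = complex.Im z + complex.Im w.
Proof. by case: z w => [? ?] [? ?]. Qed.

Lemma cReN z : complex.Re (- z) = - complex.Re z.
Proof. by case: z. Qed.

Lemma cImN z : complex.Im (- z) = - complex.Im z.
Proof. by case: z. Qed.

Lemma cReM z w :
  complex.Re (z * w) = complex.Re z * complex.Re w - complex.Im z * complex.Im w.
Proof. by case: z w => [? ?] [? ?]. Qed.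

Lemma cImM z w :
  complex.Im (z * w) = complex.Re z * complex.Im w + complex.Im z * complex.Re w.
Proof. by case: z w => [? ?] [? ?]. Qed.

Lemma cReJ z : complex.Re (conjc z) = complex.Re z.
Proof. by case: z. Qed.

Lemma cImJ z : complex.Im (conjc z) = - complex.Im z.
Proof. by case: z. Qed.

Lemma complex_ext z w :
  complex.Re z = complex.Re w -> complex.Im z = complex.Im w -> z = w.
Proof. by case: z w => [? ?] [? ?] /= -> ->. Qed.

Lemma cRe_sum (I : Type) (r : seq I) (F : I -> R[i]) :
  complex.Re (\sum_(i <- r) F i) = \sum_(i <- r) complex.Re (F i).
Proof. by elim/big_ind2 : _ => // *; rewrite cReD; congr (_ + _). Qed.

Lemma cIm_sum (I : Type) (r : seq I) (F : I -> R[i]) :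
  complex.Im (\sum_(i <- r) F i) = \sum_(i <- r) complex.Im (F i).
Proof. by elim/big_ind2 : _ => // *; rewrite cImD; congr (_ + _). Qed.

Lemma sqr_cabs z : cabs z ^+ 2 = complex.Re z ^+ 2 + complex.Im z ^+ 2.
Proof. by case: z => a b; rewrite /cabs /= sqr_sqrtr// addr_ge0// sqr_ge0. Qed.

Lemma cabsM z w : cabs (z * w) = cabs z * cabs w.
Proof. exact: Normc.normcM. Qed.

Lemma cabs0 : cabs (0 : R[i]) = 0.
Proof. exact: Normc.normc0. Qed.

Lemma cabsJ z : cabs (conjc z) = cabs z.
Proof. by case: z => a b; rewrite /cabs /= sqrrN. Qed.

Lemma cabsN z : cabs (- z) = cabs z.
Proof. by case: z => a b; rewrite /cabs /= !sqrrN. Qed.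

Lemma cabs_real a : cabs (Complex a 0) = `|a|.
Proof. by rewrite /cabs /= expr0n addr0 sqrtr_sqr. Qed.

Lemma cabs_eq0 z : cabs z = 0 -> z = 0.
Proof. exact: Normc.eq0_normc. Qed.

Lemma cabsBC z w : cabs (z - w) = cabs (w - z).
Proof. by rewrite -opprB cabsN. Qed.

Lemma cabsB z w : cabs (z - w) <= cabs z + cabs w.
Proof. by rewrite -(cabsN w); exact: cabsD. Qed.

Lemma cabs_sum (I : Type) (r : seq I) (F : I -> R[i]) :
  cabs (\sum_(i <- r) F i) <= \sum_(i <- r) cabs (F i).
Proof.
elim/big_ind2 : _ => [|x a y b xa yb|//]; first by rewrite cabs0.
exact: le_trans (cabsD _ _) (lerD xa yb).
Qed.

Lemma norm_Re z : `|complex.Re z| <= cabs z.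
Proof. by case: z => a b; exact: cabs_Re. Qed.

Lemma norm_Im z : `|complex.Im z| <= cabs z.
Proof. by case: z => a b; exact: cabs_Im. Qed.

Lemma cabs_ReIm z : cabs z <= `|complex.Re z| + `|complex.Im z|.
Proof. by case: z => a b; exact: cabs_le. Qed.

Lemma mulJ z : conjc z * z = Complex (cabs z ^+ 2) 0.
Proof.
apply: complex_ext; rewrite ?cReM ?cImM cReJ cImJ /= ?sqr_cabs; ring.
Qed.

Lemma conjJ z : conjc (conjc z) = z.
Proof. by case: z => a b /=; rewrite opprK. Qed.

Lemma conjM z w : conjc (z * w) = conjc z * conjc w.
Proof. by apply: complex_ext; rewrite !(cReJ, cImJ, cReM, cImM); ring. Qed.

Lemma conjD z w : conjc (z + w) = conjc z + conjc w.
Proof. by apply: complex_ext; rewrite !(cReJ, cImJ, cReD, cImD); ring. Qed.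

Lemma conj_sum (I : Type) (r : seq I) (F : I -> R[i]) :
  conjc (\sum_(i <- r) F i) = \sum_(i <- r) conjc (F i).
Proof.
by apply: complex_ext; rewrite !(cReJ, cImJ, cRe_sum, cIm_sum) -?sumrN;
  apply: eq_bigr => i _; rewrite ?cReJ ?cImJ.
Qed.

End ComplexModulus.

Section ComplexIntegral.
Context d (T : measurableType d) (R : realType).
Variable mu : {measure set T -> \bar R}.
Implicit Types (f g : T -> R[i]) (h : T -> R).

Definition cmeas f : Prop :=
  measurable_fun setT (fun x => complex.Re (f x)) /\
  measurable_fun setT (fun x => complex.Im (f x)).

(** For [mu = leb R n] this is convertible to [cintegral]. An arbitrary measure is allowed because
    series are treated later as integrals against counting measure. *)
Definition cint f : R[i] :=
  Complex (\int[mu]_x complex.Re (f x)) (\int[mu]_x complex.Im (f x)).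

Definition cintegrable f : Prop :=
  cmeas f /\ mu.-integrable setT (fun x => (cabs (f x))%:E).

Lemma cmeas_cst c : cmeas (fun=> c).
Proof. by split; exact: measurable_cst. Qed.

Lemma cmeasD f g : cmeas f -> cmeas g -> cmeas (fun x => f x + g x).
Proof.
move=> [fr fi] [gr gi]; split.
  by under eq_fun do rewrite cReD; exact: measurable_funD.
by under eq_fun do rewrite cImD; exact: measurable_funD.
Qed.

Lemma cmeasM f g : cmeas f -> cmeas g -> cmeas (fun x => f x * g x).
Proof.
move=> [fr fi] [gr gi]; split.
  by under eq_fun do rewrite cReM; apply: measurable_funB; exact: measurable_funM.
by under eq_fun do rewrite cImM; apply: measurable_funD; exact: measurable_funM.
Qed.

Lemma cmeasJ f : cmeas f -> cmeas (fun x => conjc (f x)).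
Proof.
move=> [fr fi]; split; first by under eq_fun do rewrite cReJ.
by under eq_fun do rewrite cImJ; exact: measurable_funN.
Qed.

Lemma cmeas_sum (I : Type) (r : seq I) (F : I -> T -> R[i]) :
  (forall i, cmeas (F i)) -> cmeas (fun x => \sum_(i <- r) F i x).
Proof.
move=> mF; elim: r => [|i r IH].
  by under eq_fun do rewrite big_nil; exact: cmeas_cst.
by under eq_fun do rewrite big_cons; exact: cmeasD.
Qed.

Lemma cmeas_cabs f : cmeas f -> measurable_fun setT (fun x => cabs (f x)).
Proof.
move=> [fr fi].
rewrite (_ : (fun x => cabs (f x)) = fun x =>
  Num.sqrt (complex.Re (f x) ^+ 2 + complex.Im (f x) ^+ 2)).
  have ms : measurable_fun [set: R] (@Num.sqrt R).
    by apply: continuous_measurable_fun; exact: sqrt_continuous.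
  apply: (measurableT_comp ms).
  by apply: measurable_funD; exact: measurable_funX.
by apply/funext => x; rewrite -sqr_cabs sqrtr_sqr ger0_norm// cabs_ge0.
Qed.

Lemma cintegrable_le f h : cmeas f -> mu.-integrable setT (EFin \o h) ->
  (forall x, cabs (f x) <= h x) -> cintegrable f.
Proof.
move=> mf ih fh; split=> //; apply: le_integrable ih => //.
  exact/measurable_EFinP/cmeas_cabs.
move=> x _ /=; rewrite lee_fin ger0_norm ?cabs_ge0//.
exact: le_trans (fh x) (ler_norm _).
Qed.

Lemma cintegrable_Re f : cintegrable f ->
  mu.-integrable setT (fun x => (complex.Re (f x))%:E).
Proof.
move=> [[fr fi] jf]; apply: le_integrable jf => //; first exact/measurable_EFinP.
by move=> x _ /=; rewrite lee_fin (ger0_norm (cabs_ge0 _)) norm_Re.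
Qed.

Lemma cintegrable_Im f : cintegrable f ->
  mu.-integrable setT (fun x => (complex.Im (f x))%:E).
Proof.
move=> [[fr fi] jf]; apply: le_integrable jf => //; first exact/measurable_EFinP.
by move=> x _ /=; rewrite lee_fin (ger0_norm (cabs_ge0 _)) norm_Im.
Qed.

Lemma cintegrableP f : cintegrable f <->
  cmeas f /\ (\int[mu]_x (cabs (f x))%:E < +oo)%E.
Proof.
split=> [[mf jf]|[mf jf]]; split=> //.
  have /integrableP[_] := jf; congr (_ < _)%E; apply: eq_integral => x _ /=.
  by rewrite ger0_norm ?cabs_ge0.
apply/integrableP; split; first exact/measurable_EFinP/cmeas_cabs.
move: jf; congr (_ < _)%E; apply: eq_integral => x _ /=.
by rewrite ger0_norm ?cabs_ge0.
Qed.

Lemma cintegrableD f g : cintegrable f -> cintegrable g ->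
  cintegrable (fun x => f x + g x).
Proof.
move=> [mf jf] [mg jg].
apply: (@cintegrable_le _ (fun x => cabs (f x) + cabs (g x))).
- exact: cmeasD.
- exact: integrableD jf jg.
- by move=> x; exact: cabsD.
Qed.

Lemma cintegrableZ c f : cintegrable f -> cintegrable (fun x => c * f x).
Proof.
move=> [mf jf]; apply: (@cintegrable_le _ (fun x => cabs c * cabs (f x))).
- exact: (cmeasM (cmeas_cst c)).
- exact: (integrableZl _ _ jf).
- by move=> x; rewrite cabsM.
Qed.

Lemma cintegrableJ f : cintegrable f -> cintegrable (fun x => conjc (f x)).
Proof.
by move=> [mf jf]; split; [exact: cmeasJ|under eq_fun do rewrite cabsJ].
Qed.

Lemma cintegrable_sum (I : Type) (r : seq I) (F : I -> T -> R[i]) :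
  (forall i, cintegrable (F i)) -> cintegrable (fun x => \sum_(i <- r) F i x).
Proof.
move=> mF; elim: r => [|i r IH].
  under eq_fun do rewrite big_nil.
  by split; [exact: cmeas_cst|under eq_fun do rewrite cabs0; exact: integrable0].
by under eq_fun do rewrite big_cons; exact: cintegrableD.
Qed.

Lemma eq_cint f g : (forall x, f x = g x) -> cint f = cint g.
Proof. by move=> /funext ->. Qed.

Lemma cint0 : cint (fun=> 0) = 0.
Proof.
by apply: complex_ext => /=; rewrite /Rintegral (eq_integral (cst 0%E)) ?integral0.
Qed.

Lemma cintD f g : cintegrable f -> cintegrable g ->
  cint (fun x => f x + g x) = cint f + cint g.
Proof.
move=> jf jg; apply: complex_ext => /=.
  under eq_Rintegral do rewrite cReD.
  by rewrite RintegralD//; exact: cintegrable_Re.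
under eq_Rintegral do rewrite cImD.
by rewrite RintegralD//; exact: cintegrable_Im.
Qed.

Lemma cintZ c f : cintegrable f -> cint (fun x => c * f x) = c * cint f.
Proof.
move=> jf; have fr := cintegrable_Re jf; have fi := cintegrable_Im jf.
apply: complex_ext; rewrite ?cReM ?cImM /=.
  under eq_Rintegral do rewrite cReM.
  by rewrite RintegralB ?RintegralZl//; exact: (integrableZl _ _ fr) || exact: (integrableZl _ _ fi).
under eq_Rintegral do rewrite cImM.
by rewrite RintegralD ?RintegralZl//; exact: (integrableZl _ _ fr) || exact: (integrableZl _ _ fi).
Qed.

Lemma cintJ f : cintegrable f -> cint (fun x => conjc (f x)) = conjc (cint f).
Proof.
move=> jf; apply: complex_ext; rewrite ?cReJ ?cImJ /=.
  by under eq_Rintegral do rewrite cReJ.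
under eq_Rintegral do rewrite cImJ -mulN1r.
by rewrite RintegralZl ?mulN1r//; exact: cintegrable_Im.
Qed.

Lemma cint_sum (I : Type) (r : seq I) (F : I -> T -> R[i]) :
  (forall i, cintegrable (F i)) ->
  cint (fun x => \sum_(i <- r) F i x) = \sum_(i <- r) cint (F i).
Proof.
move=> mF; elim: r => [|i r IH].
  by under eq_cint do rewrite big_nil; rewrite cint0 big_nil.
under eq_cint do rewrite big_cons; rewrite cintD// ?IH ?big_cons//.
exact: cintegrable_sum.
Qed.

(* Multiplying by the conjugate of the integral reduces the claim to the
   inequality [Re w <= |w|] under the integral. *)
Lemma cabs_cint f : cintegrable f -> cabs (cint f) <= \int[mu]_x cabs (f x).
Proof.
move=> jf; set I := cint f; have [mf jaf] := jf.
have [I0|I0] := eqVneq (cabs I) 0.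
  by rewrite I0; apply: Rintegral_ge0 => x _; exact: cabs_ge0.
have cI : 0 < cabs I by rewrite lt0r I0 cabs_ge0.
rewrite -(ler_pM2l cI) -expr2.
have -> : cabs I ^+ 2 = complex.Re (cint (fun x => conjc I * f x)).
  by rewrite cintZ// mulJ.
rewrite -RintegralZl//; apply: le_Rintegral => //.
- exact: (cintegrable_Re (cintegrableZ _ jf)).
- exact: (integrableZl _ _ jaf).
move=> x _; apply: le_trans (ler_norm _) _.
by apply: le_trans (norm_Re _) _; rewrite cabsM cabsJ.
Qed.

Lemma cabs_cintE f : cintegrable f ->
  ((cabs (cint f))%:E <= \int[mu]_x (cabs (f x))%:E)%E.
Proof.
move=> jf; have [mf jaf] := jf.
apply: (@le_trans _ _ (\int[mu]_x cabs (f x))%:E).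
  by rewrite lee_fin cabs_cint.
by rewrite /Rintegral fineK//; exact: integrable_fin_num.
Qed.

Lemma Rintegral_dct (G : nat -> T -> R) (k h : T -> R) :
  (forall n, measurable_fun setT (G n)) -> measurable_fun setT k ->
  mu.-integrable setT (EFin \o h) ->
  (forall n x, `|G n x| <= h x) -> (forall x, G ^~ x @ \oo --> k x) ->
  (fun n => \int[mu]_x G n x) @ \oo --> \int[mu]_x k x.
Proof.
move=> mG mk ih Gh Gk.
have [| | | | |jk _ cv] := @dominated_convergence _ T R mu setT measurableT
  (fun n x => (G n x)%:E) (fun x => (k x)%:E) (EFin \o h).
- by move=> n; exact/measurable_EFinP.
- exact/measurable_EFinP.
- by apply: aeW => x _; apply: cvg_EFin (Gk x); exact: nearW.
- exact: ih.
- by apply: aeW => x n _; rewrite lee_fin; exact: Gh.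
by apply: fine_cvg; rewrite fineK//; exact: integrable_fin_num.
Qed.

Lemma cint_dct (F : nat -> T -> R[i]) f h :
  (forall n, cmeas (F n)) -> cmeas f -> mu.-integrable setT (EFin \o h) ->
  (forall n x, cabs (F n x) <= h x) ->
  (forall x, (fun n => complex.Re (F n x)) @ \oo --> complex.Re (f x)) ->
  (forall x, (fun n => complex.Im (F n x)) @ \oo --> complex.Im (f x)) ->
  (fun n => complex.Re (cint (F n))) @ \oo --> complex.Re (cint f) /\
  (fun n => complex.Im (cint (F n))) @ \oo --> complex.Im (cint f).
Proof.
move=> mF mf ih Fh cr ci; split; apply: (Rintegral_dct _ _ ih) => //.
- by move=> n; exact: (mF n).1.
- exact: mf.1.
- by move=> n x; exact: le_trans (norm_Re _) (Fh n x).
- by move=> n; exact: (mF n).2.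
- exact: mf.2.
- by move=> n x; exact: le_trans (norm_Im _) (Fh n x).
Qed.

End ComplexIntegral.

Section ComplexFubini.
Context d1 d2 (T1 : measurableType d1) (T2 : measurableType d2) (R : realType).
Variable m1 : {sigma_finite_measure set T1 -> \bar R}.
Variable m2 : {sigma_finite_measure set T2 -> \bar R}.
Variable f : T1 * T2 -> R[i].
Hypothesis mf : cmeas f.
Hypothesis jf : (\int[m1]_x \int[m2]_y (cabs (f (x, y)))%:E < +oo)%E.

(** Meant for [k] the real and the imaginary part of [f]: both are dominated by the modulus, so
    absolute integrability of [f] makes Fubini applicable to them. *)
Let key (k : T1 * T2 -> R) : measurable_fun setT k ->
  (forall z, `|k z| <= cabs (f z)) ->
  [/\ measurable_fun setT (fun x => \int[m2]_y k (x, y)),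
      measurable_fun setT (fun y => \int[m1]_x k (x, y)) &
  \int[m1]_x \int[m2]_y k (x, y) = \int[m2]_y \int[m1]_x k (x, y)].
Proof.
move=> mk kf.
have ik : (m1 \x m2)%E.-integrable setT (EFin \o k).
  apply/integrable12ltyP; first exact/measurable_EFinP.
  apply: le_lt_trans jf; apply: ge0_le_integral => //.
  - by move=> x _; exact: integral_ge0.
  - apply: (measurable_fun_fubini_tonelli_F (fun z => `|(k z)%:E|%E)) => //.
    by apply: measurableT_comp => //; exact/measurable_EFinP.
  - apply: (measurable_fun_fubini_tonelli_F (fun z => (cabs (f z))%:E)).
      exact/measurable_EFinP/cmeas_cabs.
    by move=> z; rewrite lee_fin cabs_ge0.
  move=> x _; apply: ge0_le_integral => //.
  - apply/measurable_EFinP; apply: (measurableT_comp (@normr_measurable R setT)).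
    by apply: measurableT_comp => //; exact: measurable_pair1.
  - apply/measurable_EFinP.
    apply: (@measurableT_comp _ _ _ _ _ _ (fun z => cabs (f z))) => //; exact: cmeas_cabs.
  - by move=> y _; rewrite lee_fin kf.
have aeF := ae_integrable1 ik.
split.
- apply: (measurableT_comp (@fine_measurable R setT measurableT)).
  exact: (measurable_fubini_F ik).
- apply: (measurableT_comp (@fine_measurable R setT measurableT)).
  exact: (measurable_fubini_G ik).
have := Fubini ik.
rewrite /Rintegral => E.
(* [Rintegral] takes [fine] of each inner integral, which is faithful only where that integral is
   finite. This holds almost everywhere, which suffices under the outer integral. *)
have finF : {ae m1, forall x, (\int[m2]_y (k (x, y))%:E \is a fin_num)%E}.
  by apply: filterS (ae_integrable1 ik) => x /integrable_fin_num; exact.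
have finG : {ae m2, forall y, (\int[m1]_x (k (x, y))%:E \is a fin_num)%E}.
  by apply: filterS (ae_integrable2 ik) => x /integrable_fin_num; exact.
congr fine.
transitivity (\int[m1]_x \int[m2]_y (k (x, y))%:E)%E.
  apply: ae_eq_integral => //.
  - exact/measurable_EFinP/(measurableT_comp (@fine_measurable R setT measurableT))/(measurable_fubini_F ik).
  - exact: (measurable_fubini_F ik).
  - by apply: filterS finF => x fx _; rewrite fineK.
rewrite E; apply: ae_eq_integral => //.
- exact: (measurable_fubini_G ik).
- exact/measurable_EFinP/(measurableT_comp (@fine_measurable R setT measurableT))/(measurable_fubini_G ik).
- by apply: filterS finG => x fx _; rewrite fineK.
Qed.

Lemma cmeas_fubini1 : cmeas (fun x => cint m2 (fun y => f (x, y))).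
Proof.
split.
  by have [] := key mf.1 (fun z => norm_Re _).
by have [] := key mf.2 (fun z => norm_Im _).
Qed.

Lemma cint_fubini :
  cint m1 (fun x => cint m2 (fun y => f (x, y))) =
  cint m2 (fun y => cint m1 (fun x => f (x, y))).
Proof.
apply: complex_ext => /=.
  by have [] := key mf.1 (fun z => norm_Re _).
by have [] := key mf.2 (fun z => norm_Im _).
Qed.

End ComplexFubini.

(** * Lebesgue measure on row vectors *)

Section RowVectors.
Context {R : realType}.

Lemma measurable_addrV n d (T : measurableType d) (f g : T -> 'rV[R]_n) :
  measurable_fun setT f -> measurable_fun setT g ->
  measurable_fun setT (fun x => f x + g x).
Proof.
move=> mf mg; apply: measurable_rV => i.
rewrite (_ : _ \o _ = fun x => Defs.coord i (f x) + Defs.coord i (g x)).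
  by apply: measurable_funD; apply: measurableT_comp => //; exact: measurable_coord.
by apply/funext => x; rewrite /Defs.coord /= mxE.
Qed.

Lemma measurable_scalerV n d (T : measurableType d) (c : R) (f : T -> 'rV[R]_n) :
  measurable_fun setT f -> measurable_fun setT (fun x => c *: f x).
Proof.
move=> mf; apply: measurable_rV => i.
rewrite (_ : _ \o _ = fun x => c * Defs.coord i (f x)).
  by apply: measurable_funM => //; apply: measurableT_comp => //; exact: measurable_coord.
by apply/funext => x; rewrite /Defs.coord /= mxE.
Qed.

Lemma measurable_subrV n d (T : measurableType d) (f g : T -> 'rV[R]_n) :
  measurable_fun setT f -> measurable_fun setT g ->
  measurable_fun setT (fun x => f x - g x).
Proof.
move=> mf mg; under eq_fun do rewrite -scaleN1r.
by apply: measurable_addrV => //; exact: measurable_scalerV.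
Qed.

Lemma measurable_row_mx m n d (T : measurableType d) (f : T -> 'rV[R]_m)
    (g : T -> 'rV[R]_n) :
  measurable_fun setT f -> measurable_fun setT g ->
  measurable_fun setT (fun x => row_mx (f x) (g x)).
Proof.
move=> mf mg; apply: measurable_rV => i.
have := splitP i; case: _ / => [j|j] ij.
  rewrite (_ : _ \o _ = Defs.coord j \o f).
    by apply: measurableT_comp => //; exact: measurable_coord.
  apply/funext => x; rewrite /Defs.coord /= (_ : i = lshift n j) ?row_mxEl//.
  exact/val_inj.
rewrite (_ : _ \o _ = Defs.coord j \o g).
  by apply: measurableT_comp => //; exact: measurable_coord.
apply/funext => x; rewrite /Defs.coord /= (_ : i = rshift m j) ?row_mxEr//.
exact/val_inj.
Qed.

Lemma measurable_lsubmx m n : measurable_fun setT (@lsubmx R 1 m n).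
Proof.
apply: measurable_rV => i.
rewrite (_ : _ \o _ = Defs.coord (lshift n i)); first exact: measurable_coord.
by apply/funext => x; rewrite /Defs.coord /= mxE.
Qed.

Lemma measurable_rsubmx m n : measurable_fun setT (@rsubmx R 1 m n).
Proof.
apply: measurable_rV => i.
rewrite (_ : _ \o _ = Defs.coord (rshift m i)); first exact: measurable_coord.
by apply/funext => x; rewrite /Defs.coord /= mxE.
Qed.

Lemma measurable_dotp n d (T : measurableType d) (f g : T -> 'rV[R]_n) :
  measurable_fun setT f -> measurable_fun setT g ->
  measurable_fun setT (fun x => dotp (f x) (g x)).
Proof.
move=> mf mg; under eq_fun do rewrite dotpE.
apply: (@measurable_sum _ _ _ _ _ _ (fun i x => f x 0 i * g x 0 i)) => i.
by apply: measurable_funM; apply: (measurableT_comp (@measurable_coord R n i)).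
Qed.

Definition cell n (N : nat) (k : 'rV[int]_n) : set 'rV[R]_n :=
  [set x | forall i, Num.floor (N.+1%:R * x 0 i) = k 0 i].

Lemma measurable_cell n N (k : 'rV[int]_n) : measurable (cell N k).
Proof.
rewrite (_ : cell N k = \bigcap_(i in [set: 'I_n])
   ((@Defs.coord R n i) @^-1` [set t | Num.floor (N.+1%:R * t) = k 0 i])).
  apply: fin_bigcap_measurable => // i _.
  rewrite -[X in measurable X]setTI; apply: measurable_coord => //.
  rewrite (_ : [set t | _] = `[(k 0 i)%:~R / N.+1%:R, (k 0 i + 1)%:~R / N.+1%:R[%classic)//.
  apply/seteqP; split => t /=; rewrite in_itv /= ler_pdivrMr// ltr_pdivlMr// mulrC => h.
    by rewrite -h floor_le_tmp floorD1_gt.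
  exact/floor_def.
apply/seteqP; split => x h i; first by move=> _; exact: h.
exact: h.
Qed.

(** An open set is the union of the grid cells it contains, over all meshes [1 / N.+1]: countably
    many sets, each cut out by conditions on coordinates. This reconciles the sigma-algebra
    generated by the coordinates with the topology. *)
Lemma open_rV_measurable n (U : set 'rV[R]_n) : open U -> measurable U.
Proof.
move=> oU.
rewrite (_ : U = \bigcup_N \bigcup_(k in [set k : 'rV[int]_n | cell N k `<=` U]) cell N k).
  apply: bigcupT_measurable => N.
  rewrite bigcup_mkcond; apply: countable_bigcupT_measurable => [|k].
    exact: countableP.
  by case: ifP => _; [exact: measurable_cell|exact: measurable0].
apply/seteqP; split => [x Ux|x [N _ [k kU xk]]]; last exact: kU.
have /nbhs_ballP[e /= e0 xe] : nbhs x U by exact: open_nbhs_nbhs.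
(* Then [1 / N.+1 < e], so the cell through [x] lies in the ball of radius [e]. *)
pose N := Num.trunc e^-1.
exists N => //.
exists (\row_i Num.floor (N.+1%:R * x 0 i)); last by move=> i; rewrite mxE.
move=> y /= cy; apply: xe; split=> // i j; rewrite (ord1 i) /ball /=.
have := cy j; rewrite mxE => fe.
have N0 : 0 < N.+1%:R :> R by [].
have : `|N.+1%:R * x 0 j - N.+1%:R * y 0 j| < 1.
  have := floor_itv (N.+1%:R * x 0 j); have := floor_itv (N.+1%:R * y 0 j).
  rewrite fe !intrD => /andP[? ?] /andP[? ?].
  by rewrite ltr_norml; lra.
rewrite -mulrBr normrM gtr0_norm// -ltr_pdivlMl// mulr1 => /lt_trans; apply.
rewrite invf_plt ?posrE//; exact: truncnS_gt.
Qed.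

Lemma continuous_rV_measurable n (f : 'rV[R]_n -> R) :
  continuous f -> measurable_fun setT f.
Proof.
move=> /continuousP cf; apply: (measurability _ (RGenOpens.measurableE R)).
move=> _ [_ [a [b ->] <-]]; rewrite setTI.
by apply: open_rV_measurable; apply: cf; exact: interval_open.
Qed.

End RowVectors.

Section LebesgueMeasure.
Context {R : realType}.
Local Open Scope ereal_scope.

Lemma measurable_affine (c a : R) : measurable_fun setT (fun x : measurableTypeR R => (c * x + a)%R : measurableTypeR R).
Proof. by apply: measurable_funD => //; exact: measurable_funM. Qed.

(** The image of Lebesgue measure under [c * x + a], multiplied by [c], gives half-open intervals
    their length, so by uniqueness it is Lebesgue measure. *)
Lemma lebesgue_affine (c a : R) (A : set R) : (0 < c)%R -> measurable A ->
  lebesgue_measure ((fun x : measurableTypeR R => (c * x + a)%R : measurableTypeR R) @^-1` A) =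
  (c^-1)%:E * lebesgue_measure A.
Proof.
move=> c0 mA; have cge0 := ltW c0.
pose nu := measure_function_pushforward__canonical__measure_function_Measure
  (@lebesgue_measure R) (measurable_affine c a).
pose mu := measure_function_mscale__canonical__measure_function_Measure
  (NngNum cge0) nu.
have -> : lebesgue_measure A = mu A; last first.
  rewrite /mu /mscale /= /pushforward /= muleA -EFinM mulVf ?mul1e//.
  by rewrite gt_eqF.
apply: lebesgue_measure_unique mA => _ [[u v] _ <-] /=.
rewrite /mu /mscale /= /pushforward /=.
rewrite (_ : _ @^-1` _ = `]((u - a) / c)%R, ((v - a) / c)%R]%classic); last first.
  apply/seteqP; split => x /=; rewrite !in_itv/= ltr_pdivrMr// ler_pdivlMr//;
    by rewrite ltrBlDr lerBrDr mulrC.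
rewrite !lebesgue_measure_itv /= !lte_fin ltr_pM2r ?invr_gt0// ltrD2r.
case: ifP => _; last by rewrite mule0.
by rewrite -!EFinB -EFinM; congr EFin; field; rewrite gt_eqF.
Qed.

Lemma ge0_lebesgue_affine (c a : R) (F : R -> \bar R) : (0 < c)%R ->
  measurable_fun setT F -> (forall x, 0 <= F x) ->
  \int[lebesgue_measure]_x F (c * x + a)%R =
  (c^-1)%:E * \int[lebesgue_measure]_x F x.
Proof.
move=> c0 mF F0; have cge0 : (0 <= c^-1)%R by rewrite invr_ge0 ltW.
pose mu := measure_function_mscale__canonical__measure_function_Measure
  (NngNum cge0) (@lebesgue_measure R).
transitivity (\int[mu]_x F x); last exact: ge0_integral_mscale.
transitivity (\int[pushforward lebesgue_measure (fun x : measurableTypeR R => (c * x + a)%R : measurableTypeR R)]_x F x).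
  by rewrite (ge0_integral_pushforward (measurable_affine c a)).
apply: eq_measure_integral => [|mf A mA _]; first exact: measurable_affine.
exact: (lebesgue_affine a c0 mA).
Qed.

(* The Borel structure underlying [lebesgue_measure] and the canonical one of
   [R] have different displays. *)
Lemma measurable_cons_leb n :
  measurable_fun [set: measurableTypeR R * 'rV[R]_n] (@cons_rV R n).
Proof. exact: measurable_cons_rV. Qed.

Lemma integral_lebS n (F : 'rV[R]_n.+1 -> \bar R) :
  measurable_fun setT F -> (forall x, 0 <= F x) ->
  \int[leb R n.+1]_x F x =
  \int[lebesgue_measure]_t \int[leb R n]_y F (cons_rV (t, y)).
Proof.
move=> mF F0.
transitivity (\int[(@lebesgue_measure R) \x leb R n]_p F (cons_rV p)).
  change (\int[pushforward ((@lebesgue_measure R) \x leb R n) (@cons_rV R n)]_x F x =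
    \int[(@lebesgue_measure R) \x leb R n]_p F (cons_rV p)).
  exact: (ge0_integral_pushforward (@measurable_cons_leb n) _ measurableT mF).
rewrite fubini_tonelli1 //=.
by apply: measurableT_comp => //; exact: measurable_cons_leb.
Qed.

Lemma measurable_int_cons n (F : 'rV[R]_n.+1 -> \bar R) :
  measurable_fun setT F -> (forall x, 0 <= F x) ->
  measurable_fun setT (fun t => \int[leb R n]_y F (cons_rV (t, y))).
Proof.
move=> mF F0.
apply: (@measurable_fun_fubini_tonelli_F _ _ _ _ R (leb R n)
  (fun p => F (cons_rV p))) => //.
by apply: measurableT_comp => //; exact: measurable_cons_rV.
Qed.

Lemma cons_rVZD n (c : R) (t : R) (y : 'rV[R]_n) (b : 'rV[R]_n.+1) :
  (c *: cons_rV (t, y) + b)%R =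
  cons_rV (c * t + (split_rV b).1, c *: y + (split_rV b).2)%R.
Proof.
rewrite -[in LHS](split_rVK b) /cons_rV /=.
by apply/rowP => i; rewrite !mxE; case: splitP => j _; rewrite !mxE ?(ord1 j) ?eqxx ?mulr1n.
Qed.

Lemma ge0_leb_affine n (c : R) (b : 'rV[R]_n) (F : 'rV[R]_n -> \bar R) :
  (0 < c)%R -> measurable_fun setT F -> (forall x, 0 <= F x) ->
  \int[leb R n]_x F (c *: x + b)%R = ((c^-1) ^+ n)%:E * \int[leb R n]_x F x.
Proof.
move=> c0; elim: n b F => [|n IH] b F mF F0.
  rewrite expr0 mul1e; apply: eq_integral => x _; congr F.
  by apply/rowP => -[].
rewrite integral_lebS; last 2 first.
- apply: measurableT_comp => //; apply: measurable_addrV => //.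
  exact: measurable_scalerV.
- by [].
under eq_integral => t _ do under eq_integral do rewrite cons_rVZD.
have mc t : measurable_fun setT (fun y => F (cons_rV (t, y))).
  apply: measurableT_comp => //; apply: measurableT_comp; first exact: measurable_cons_rV.
  exact: measurable_pair1.
under eq_integral => t _ do
  rewrite (IH _ (fun y => F (cons_rV ((c * t + (split_rV b).1)%R, y))))//.
rewrite ge0_integralZl//; last 3 first.
- apply: (measurableT_comp (measurable_int_cons mF F0)).
  exact: measurable_affine.
- by move=> t _; exact: integral_ge0.
- by rewrite lee_fin exprn_ge0// invr_ge0 ltW.
rewrite (ge0_lebesgue_affine _ c0 (measurable_int_cons mF F0)); last first.
  by move=> t; exact: integral_ge0.
by rewrite -integral_lebS// muleA -EFinM exprSr.
Qed.

Lemma ge0_leb_shift n (b : 'rV[R]_n) (F : 'rV[R]_n -> \bar R) :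
  measurable_fun setT F -> (forall x, 0 <= F x) ->
  \int[leb R n]_x F (x + b)%R = \int[leb R n]_x F x.
Proof.
move=> mF F0; under eq_integral do rewrite -[X in (X + b)%R]scale1r.
by rewrite ge0_leb_affine// invr1 expr1n mul1e.
Qed.

Lemma cons_rV_row_mx m n (t : R) (x : 'rV[R]_m) (y : 'rV[R]_n) :
  cons_rV (t, row_mx x y) = row_mx (cons_rV (t, x)) y.
Proof.
apply/rowP => i; rewrite /cons_rV !mxE /=.
case: splitP => j ij0; have ij : nat_of_ord i = _ := ij0;
  case: splitP => k ik0; have ik : nat_of_ord i = _ := ik0; rewrite !mxE.
- case: splitP => l kl0; have kl : nat_of_ord k = _ := kl0; first by rewrite !mxE !ord1.
  by exfalso; have := ltn_ord j; lia.
- by exfalso; have := ltn_ord j; lia.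
- case: splitP => l jl; case: splitP => p kp0; have kp : nat_of_ord k = _ := kp0.
  + by exfalso; have := ltn_ord p; lia.
  + by congr (x _ _); apply/val_inj => /=; lia.
  + by exfalso; have := ltn_ord p; lia.
  + by exfalso; have := ltn_ord k; lia.
- case: splitP => l jl; first by exfalso; have := ltn_ord l; lia.
  by congr (y _ _); apply/val_inj => /=; lia.
Qed.

(** [leb] is built one coordinate at a time, so splitting off a block of [m] coordinates is
    Tonelli's theorem iterated by induction on [m]; [cons_rV_row_mx] re-associates the
    coordinates. *)
Lemma ge0_leb_split m n (F : 'rV[R]_(m + n) -> \bar R) :
  measurable_fun setT F -> (forall x, 0 <= F x) ->
  \int[leb R (m + n)]_z F z = \int[leb R m]_x \int[leb R n]_y F (row_mx x y).
Proof.
elim: m F => [|m IH] F mF F0.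
  transitivity (\int[leb R n]_y F (row_mx (0 : 'rV_0) y)); last first.
    have E (x : 'rV[R]_0) : x = 0%R by apply/rowP => -[].
    rewrite [RHS](eq_integral (cst (\int[leb R n]_y F (row_mx (0 : 'rV_0) y))));
      last by move=> x _; rewrite (E x).
    by rewrite /= integral_dirac //= diracT mul1e.
  by apply: eq_integral => y _; congr F; apply/rowP => i; rewrite mxE;
    case: splitP => [[]//|j ij]; congr (y _ _); exact: val_inj.
have mint : measurable_fun setT (fun x : 'rV[R]_m.+1 => \int[leb R n]_y F (row_mx x y)).
  apply: (@measurable_fun_fubini_tonelli_F _ _ _ _ R (leb R n)
    (fun p => F (row_mx p.1 p.2))) => //.
  by apply: measurableT_comp => //; apply: measurable_row_mx;
    [exact: measurable_fst|exact: measurable_snd].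
rewrite [RHS]integral_lebS//; last by move=> x; exact: integral_ge0.
rewrite (@integral_lebS (m + n) F)//; apply: eq_integral => t _.
rewrite (IH (fun z => F (cons_rV (t, z))))//.
  apply: eq_integral => x _; apply: eq_integral => y _; congr F.
  exact: cons_rV_row_mx.
apply: measurableT_comp => //; apply: measurableT_comp; first exact: measurable_cons_rV.
exact: measurable_pair1.
Qed.

End LebesgueMeasure.

(** * Japanese bracket, integrability and lattice sums *)

Section JapaneseBracket.
Context {R : realType}.
Implicit Types s : R.

Lemma jap_ge1 n (x : 'rV[R]_n) : 1 <= jap x.
Proof. by rewrite /jap -[leLHS]sqrtr1 ler_wsqrtr// lerDl sqr_ge0. Qed.

Lemma jap_gt0 n (x : 'rV[R]_n) : 0 < jap x.
Proof. exact: lt_le_trans (jap_ge1 x). Qed.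

Lemma coord_le_jap n (x : 'rV[R]_n) i : `|x 0 i| <= jap x.
Proof.
rewrite -ler_sqr ?nnegrE ?jap_ge0// sqr_jap real_normK ?num_real// dotpE.
rewrite (bigD1 i)//= -expr2 addrCA lerDl addr_ge0// sumr_ge0// => j _.
by rewrite -expr2 sqr_ge0.
Qed.

Lemma jap_le_sum n (x : 'rV[R]_n) : jap x <= 1 + \sum_i `|x 0 i|.
Proof.
have S0 : 0 <= \sum_i `|x 0 i| by exact: sumr_ge0.
rewrite -ler_sqr ?nnegrE ?jap_ge0// ?addr_ge0// sqr_jap dotpE.
rewrite sqrrD expr1n mul1r -addrA lerD2l.
apply: (@le_trans _ _ ((\sum_i `|x 0 i|) ^+ 2)); last by rewrite lerDr mulrn_wge0.
rewrite expr2 mulr_suml; apply: ler_sum => i _.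
rewrite -expr2 -real_normK ?num_real// expr2 ler_wpM2l//.
by rewrite (bigD1 i)//= lerDl sumr_ge0.
Qed.

Lemma japN n (x : 'rV[R]_n) : jap (- x) = jap x.
Proof.
rewrite /jap !sqr_enorm !dotpE; congr (Num.sqrt (1 + _)).
by apply: eq_bigr => i _; rewrite !mxE mulrNN.
Qed.

Lemma japBC n (x y : 'rV[R]_n) : jap (x - y) = jap (y - x).
Proof. by rewrite -opprB japN. Qed.

(** A crude constant from the entries of [B]. Applied to the inverse of the lattice matrix, it
    compares brackets at lattice points with brackets at integer points. *)
Lemma jap_mulmx m n (B : 'M[R]_(m, n)) :
  exists2 K, 0 < K & forall y : 'rV_m, jap (y *m B) <= K * jap y.
Proof.
have S0 : 0 <= \sum_j \sum_i `|B i j|.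
  by apply: sumr_ge0 => j _; exact: sumr_ge0.
exists (1 + \sum_j \sum_i `|B i j|) => [|y]; first by rewrite ltr_wpDr.
apply: le_trans (jap_le_sum _) _; rewrite mulrDl mul1r; apply: lerD.
  exact: jap_ge1.
rewrite mulr_suml; apply: ler_sum => j _; rewrite mxE mulr_suml.
apply: le_trans (ler_norm_sum _ _ _) _; apply: ler_sum => i _.
by rewrite normrM mulrC ler_wpM2l// coord_le_jap.
Qed.

Lemma powRN_le s (a b : R) : 0 <= s -> 0 < a -> a <= b -> b `^ (- s) <= a `^ (- s).
Proof.
move=> s0 a0 ab; rewrite !powRN lef_pV2 ?posrE ?powR_gt0//.
  by apply: ge0_ler_powR => //; rewrite nnegrE ltW//; exact: lt_le_trans ab.
exact: lt_le_trans ab.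
Qed.

(** Moves a constant inside the power, so that [powRN_le] reduces estimates between negative powers
    of brackets to estimates between the brackets. *)
Lemma powRN_scale s (c x : R) : 0 < c -> 0 <= x ->
  c `^ s * x `^ (- s) = (c^-1 * x) `^ (- s).
Proof.
move=> c0 x0.
have E : (c^-1) `^ (- s) = c `^ s.
  by rewrite -(powR_inv1 (ltW c0)) -powRrM mulN1r opprK.
by rewrite powRM ?E// invr_ge0 ltW.
Qed.

Lemma jap_row_mx m n (x : 'rV[R]_m) (y : 'rV[R]_n) :
  jap (row_mx x y) <= jap x * jap y.
Proof.
rewrite -ler_sqr ?nnegrE ?mulr_ge0 ?jap_ge0// exprMn !sqr_jap.
rewrite {1}/dotp tr_row_mx mul_row_col mxE -!/(dotp _ _).
by have := dotp_ge0 x; have := dotp_ge0 y; nra.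
Qed.

Lemma measurable_jap n d (T : measurableType d) (f : T -> 'rV[R]_n) :
  measurable_fun setT f -> measurable_fun setT (fun x => jap (f x)).
Proof.
move=> mf; rewrite /jap; under eq_fun do rewrite sqr_enorm.
have ms : measurable_fun [set: R] (@Num.sqrt R).
  by apply: continuous_measurable_fun; exact: sqrt_continuous.
apply: (measurableT_comp ms); apply: measurable_funD => //.
exact: measurable_dotp.
Qed.

Lemma measurable_japN n d (T : measurableType d) (f : T -> 'rV[R]_n) s :
  measurable_fun setT f -> measurable_fun setT (fun x => jap (f x) `^ s).
Proof.
move=> mf; rewrite (_ : (fun x => _) = (@powR R ^~ s) \o (fun x => jap (f x)))//.
apply: measurableT_comp; [exact: measurable_powR|exact: measurable_jap].
Qed.

End JapaneseBracket.

Section Cubes.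
Context {R : realType}.
Local Open Scope ereal_scope.

Definition cube n (a : 'rV[R]_n) (r : R) : set 'rV[R]_n :=
  [set x | forall i, (a 0 i <= x 0 i < a 0 i + r)%R].

Lemma measurable_cube n (a : 'rV[R]_n) r : measurable (cube a r).
Proof.
rewrite (_ : cube a r = \bigcap_(i in [set: 'I_n])
   ((@Defs.coord R n i) @^-1` `[a 0%R i, (a 0 i + r)%R[%classic)).
  apply: fin_bigcap_measurable => // i _.
  by rewrite -[X in measurable X]setTI; apply: measurable_coord => //.
apply/seteqP; split => x h i; first by move=> _ /=; rewrite in_itv/=; exact: h.
by have := h i Logic.I; rewrite /= in_itv.
Qed.

Lemma leb_cube n (a : 'rV[R]_n) r : (0 <= r)%R -> leb R n (cube a r) = (r ^+ n)%:E.
Proof.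
move=> r0; elim: n a => [|n IH] a.
  rewrite expr0 /= diracE mem_set//= => -[]//.
change (((@lebesgue_measure R) \x leb R n) (@cons_rV R n @^-1` cube a r) = (r ^+ n.+1)%:E).
rewrite (_ : _ @^-1` _ = `[a 0%R ord0, (a 0%R ord0 + r)%R[%classic `*` cube (split_rV a).2 r).
  rewrite product_measure1E//=; last exact: measurable_cube.
  rewrite IH lebesgue_measure_itv /= lte_fin ltrDl.
  case: ltgtP r0 => // [r0 _|<- _]; last by rewrite mul0e exprS mul0r.
  by rewrite -EFinB -EFinM addrAC subrr add0r exprS.
apply/seteqP; split => -[t y] /=; rewrite in_itv /cube /=.
  move=> h; split.
    by have := h ord0; rewrite /cons_rV mxE; case: splitP => // j _; rewrite mxE (ord1 j) eqxx.
  move=> i; have := h (rshift 1 i : 'I_n.+1).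
  by rewrite /cons_rV (@row_mxEr _ 1 1 n) mxE.
move=> [h0 h1] i; rewrite /cons_rV mxE; case: splitP => j ij.
  rewrite mxE (ord1 j) eqxx mulr1n; move: h0; rewrite (_ : i = ord0)//.
  by apply/val_inj; rewrite /= ij (ord1 j).
have := h1 j; rewrite mxE.
by have -> : i = rshift 1 j :> 'I_n.+1 by exact/val_inj.
Qed.

Lemma integral_cube n (a : 'rV[R]_n) r : (0 <= r)%R ->
  \int[leb R n]_x (\1_(cube a r) x)%:E = (r ^+ n)%:E.
Proof.
move=> r0; rewrite integral_indic//; last exact: measurable_cube.
by rewrite setIT; exact: leb_cube.
Qed.

Lemma nneseries_le_bound (a : nat -> \bar R) (B : \bar R) :
  (forall k, 0 <= a k) -> (forall N, \sum_(0 <= k < N) a k <= B) ->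
  \sum_(0 <= k <oo) a k <= B.
Proof.
move=> a0 aB; apply: lime_le; first exact: is_cvg_nneseries.
exact: nearW.
Qed.

Lemma geometric_partial_le (q : R) N : (0 <= q < 1)%R ->
  (\sum_(0 <= k < N) q ^+ k <= (1 - q)^-1)%R.
Proof.
move=> /andP[q0 q1]; have q10 : (0 < 1 - q)%R by rewrite subr_gt0.
rewrite -[leRHS]mul1r ler_pdivlMr// big_mkord mulrC -opprB mulNr -subrX1 opprB.
by rewrite lerBlDr lerDl exprn_ge0.
Qed.

(* Dyadic shells: on [2^j <= <x> < 2^(j+1)] the integrand is at most [2^(-js)],
   and the shell lies in a cube of side [2^(j+2)]. *)
Lemma integral_jap_lty n (s : R) : (n%:R < s)%R ->
  \int[leb R n]_x (jap x `^ (- s))%:E < +oo.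
Proof.
move=> ns; have s0 : (0 < s)%R by exact: le_lt_trans ns.
pose Q j := cube (const_mx (- (2 ^+ j.+1))%R : 'rV[R]_n) (2 ^+ j.+2)%R.
(* The term of index [j] integrates to the volume [(2 ^+ j.+2) ^+ n] times [2^(-js)], that is
   [4 ^+ n * q ^+ j]; [q < 1] is where [n < s] enters. *)
pose q : R := (2 `^ (n%:R - s))%R.
have q1 : (0 <= q < 1)%R.
  rewrite powR_ge0 /= /q -opprB powRN invf_lt1 ?powR_gt0//.
  have e0 : (0 < s - n%:R)%R by rewrite subr_gt0.
  by have := @gt0_ltr_powR R _ e0 1%R 2%R; rewrite powR1; apply; rewrite ?nnegrE ?ltr1n.
pose F j x := ((2 ^+ j) `^ (- s) * \1_(Q j) x)%R.
have F0 j x : (0 <= F j x)%R by rewrite mulr_ge0// powR_ge0.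
have mF j : measurable_fun setT (fun x => (F j x)%:E).
  apply/measurable_EFinP; apply: measurable_funM => //.
  by apply: measurable_indic; exact: measurable_cube.
have le1 x : (jap x `^ (- s))%:E <= \sum_(0 <= j <oo) (F j x)%:E.
  have ex : exists j, (jap x < 2 ^+ j.+1)%R.
    exists (Num.trunc (jap x)); apply: lt_le_trans (truncnS_gt _) _.
    by rewrite -natrX ler_nat ltnW// ltn_expl.
  case: (ex_minnP ex) => j jx jmin.
  apply: (@le_trans _ _ (F j x)%:E); last first.
    apply: le_trans (nneseries_lim_ge j.+1 _); last by move=> k _ _; rewrite lee_fin.
    by rewrite big_nat_recr//= leeDr// sume_ge0// => k _; rewrite lee_fin.
  rewrite lee_fin /F indicE mem_set ?mulr1.
    apply: powRN_le (ltW s0) _ _; first by rewrite exprn_gt0.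
    case: j jx jmin => [|j] jx jmin; first by rewrite expr0 jap_ge1.
    by rewrite leNgt; apply/negP => /jmin; rewrite ltnn.
  move=> i; rewrite mxE.
  have := coord_le_jap x i; move: jx; rewrite ler_norml !exprS => jx /andP[h1 h2].
  by apply/andP; split; lra.
apply: (@le_lt_trans _ _ (\int[leb R n]_x \sum_(0 <= j <oo) (F j x)%:E)).
  apply: ge0_le_integral => //.
  - by move=> x _; rewrite lee_fin powR_ge0.
  - by apply/measurable_EFinP; apply: measurable_japN; exact: measurable_id.
  - by apply: ge0_emeasurable_sum => // j x _ _; rewrite lee_fin.
rewrite integral_nneseries//; last by move=> j x _; rewrite lee_fin.
apply: (@le_lt_trans _ _ (4 ^+ n * (1 - q)^-1)%:E); last by rewrite ltry.
apply: nneseries_le_bound => [j|N].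
  by apply: integral_ge0 => x _; rewrite lee_fin.
have E j : \int[leb R n]_x (F j x)%:E = (4 ^+ n * q ^+ j)%:E.
  rewrite /F; under eq_integral do rewrite EFinM.
  rewrite ge0_integralZl//; last first.
    by apply/measurable_EFinP; apply: measurable_indic; exact: measurable_cube.
  rewrite integral_cube ?exprn_ge0// -EFinM; congr EFin.
  have E1 : ((2 ^+ j) `^ (- s) = (2 `^ (- s)) ^+ j :> R)%R.
    by rewrite -(powR_mulrn j)// -powRrM mulrC powRrM powR_mulrn ?powR_ge0.
  have E2 : (q = 2 ^+ n * 2 `^ (- s))%R.
    by rewrite /q powRD ?powR_mulrn// pnatr_eq0 implybT.
  have E3 : (2 ^+ j.+2 ^+ n = 4 ^+ n * (2 ^+ n) ^+ j :> R)%R.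
    rewrite (_ : 4 = 2 ^+ 2)%R; last by ring.
    by rewrite -!exprM -exprD; congr (_ ^+ _)%R; ring.
  by rewrite E1 E2 E3 exprMn; ring.
under eq_bigr do rewrite E.
rewrite sumEFin lee_fin -mulr_sumr ler_wpM2l// ?exprn_ge0//.
exact: geometric_partial_le.
Qed.

End Cubes.

Section LebesgueMore.
Context {R : realType}.
Local Open Scope ereal_scope.

Lemma integrable_japN n (s : R) : (n%:R < s)%R ->
  (leb R n).-integrable setT (EFin \o (fun x => jap x `^ (- s))%R).
Proof.
move=> ns; apply/integrableP; split.
  by apply/measurable_EFinP; apply: measurable_japN; exact: measurable_id.
apply: le_lt_trans (integral_jap_lty ns); apply: ge0_le_integral => //.
- apply/measurable_EFinP; apply: measurableT_comp => //.
  by apply: measurable_japN; exact: measurable_id.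
- by apply/measurable_EFinP; apply: measurable_japN; exact: measurable_id.
- by move=> x _; rewrite /= ger0_norm ?powR_ge0.
Qed.

Lemma integral_jap_shift n (s : R) (v : 'rV[R]_n) :
  \int[leb R n]_x (jap (x - v) `^ (- s))%:E = \int[leb R n]_x (jap x `^ (- s))%:E.
Proof.
apply: (@ge0_leb_shift R n (- v)%R (fun x => (jap x `^ (- s))%:E)).
  by apply/measurable_EFinP; apply: measurable_japN; exact: measurable_id.
by move=> x; rewrite lee_fin powR_ge0.
Qed.

(** Half-open unit cubes with distinct integer corners are disjoint: the coordinatewise floor of [y]
    recovers the corner. *)
Lemma cubes_disjoint m (b : nat -> 'cV[int]_m) (y : 'rV[R]_m) N : injective b ->
  (\sum_(0 <= k < N) \1_(cube ((map_mx intr (b k))^T) 1) y <= 1 :> R)%R.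
Proof.
move=> injb.
have fl k : cube ((map_mx intr (b k))^T : 'rV[R]_m) 1 y ->
    b k = (\row_i Num.floor (y 0%R i))^T.
  move=> h; apply/colP => i; rewrite !mxE; apply/esym/floor_def.
  by have := h i; rewrite !mxE intrD.
have [[k0 [k0N yk0]]|none] := pselect (exists k, (k < N)%N /\
    cube ((map_mx intr (b k))^T : 'rV[R]_m) 1 y).
  rewrite big_mkord (bigD1 (Ordinal k0N))//= big1 ?addr0 ?indicE ?lern1 ?leq_b1//.
  move=> k kk0; rewrite indicE memNset// => /fl; rewrite -(fl _ yk0) => /injb kk.
  by move/eqP : kk0; apply; exact/val_inj.
rewrite big_mkord big1// => k _; rewrite indicE memNset// => yk.
by apply: none; exists k.
Qed.

(** Comparison with an integral. In integer coordinates each summand is, up to a constant, at most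
    the integral of the same power over the unit cube at its point; the cubes are disjoint, and
    translation invariance makes the bound independent of [z]. *)
Lemma lattice_sum m (A : 'M[R]_m) (b : nat -> 'cV[int]_m) (s : R) :
  injective b -> A \in unitmx -> (m%:R < s)%R ->
  exists2 C : R, (0 < C)%R & forall z N,
    (\sum_(0 <= k < N) jap (lattice_pt A (b k) - z) `^ (- s) <= C)%R.
Proof.
move=> injb uA ms; have s0 : (0 < s)%R by exact: le_lt_trans ms.
have [K K0 HK] := jap_mulmx (invmx A^T).
pose I : R := fine (\int[leb R m]_x (jap x `^ (- s))%:E).
have I0 : (0 <= I)%R.
  by apply: fine_ge0; apply: integral_ge0 => x _; rewrite lee_fin powR_ge0.
have IE : \int[leb R m]_x (jap x `^ (- s))%:E = I%:E.
  by rewrite fineK//; exact: (integrable_fin_num _ (integrable_japN ms)).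
(* For [y] in the unit cube at [r k] the bracket of [y - r k] is at most [1 + m]; the factor 2 is
   that of Peetre's inequality [jap_shift]. *)
pose D : R := (2 * (1 + m%:R))%R.
have D0 : (0 < D)%R by rewrite mulr_gt0// ltr_wpDr.
exists (K `^ s * (D `^ s * I) + 1)%R.
  by rewrite ltr_wpDl// ?mulr_ge0 ?powR_ge0.
move=> z N; apply: (@le_trans _ _ (K `^ s * (D `^ s * I))%R); last by rewrite lerDl.
pose r k : 'rV[R]_m := ((map_mx intr (b k))^T)%R.
pose v := (z *m invmx A^T)%R.
have le1 k : (jap (lattice_pt A (b k) - z) `^ (- s) <= K `^ s * jap (r k - v) `^ (- s))%R.
  have -> : (K `^ s * jap (r k - v) `^ (- s) = (K^-1 * jap (r k - v)) `^ (- s))%R.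
    by rewrite powRN_scale// jap_ge0.
  apply: powRN_le (ltW s0) _ _; first by rewrite mulr_gt0 ?jap_gt0 ?invr_gt0.
  rewrite ler_pdivrMl//; apply: le_trans (HK _); rewrite mulmxBl.
  rewrite /lattice_pt trmx_mul -mulmxA mulmxV ?unitmx_tr// mulmx1//.
apply: (@le_trans _ _ (\sum_(0 <= k < N) K `^ s * jap (r k - v) `^ (- s))%R).
  exact: ler_sum.
rewrite -mulr_sumr ler_wpM2l ?powR_ge0// -lee_fin -sumEFin.
have le2 k : (jap (r k - v) `^ (- s))%:E <=
    \int[leb R m]_y (D `^ s * jap (y - v) `^ (- s) * \1_(cube (r k) 1) y)%:E.
  have -> : (jap (r k - v) `^ (- s))%:E =
      \int[leb R m]_y ((jap (r k - v) `^ (- s))%:E * (\1_(cube (r k) 1) y)%:E).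
    rewrite ge0_integralZl//; last 2 first.
    - by apply/measurable_EFinP; apply: measurable_indic; exact: measurable_cube.
    - by rewrite lee_fin powR_ge0.
    by rewrite integral_cube// expr1n mule1.
  apply: ge0_le_integral => //.
  - by move=> y _; rewrite mule_ge0// lee_fin ?powR_ge0.
  - apply: emeasurable_funM => //.
    by apply/measurable_EFinP; apply: measurable_indic; exact: measurable_cube.
  - apply/measurable_EFinP; apply: measurable_funM.
      apply: measurable_funM => //; apply: measurable_japN.
      by apply: measurable_subrV => //; exact: measurable_id.
    by apply: measurable_indic; exact: measurable_cube.
  move=> y _; rewrite -EFinM lee_fin indicE.
  have [yr|_] := boolP (y \in _); last by rewrite !mulr0.
  rewrite !mulr1; move: yr; rewrite inE => yr.
  have -> : (D `^ s * jap (y - v) `^ (- s) = (D^-1 * jap (y - v)) `^ (- s))%R.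
    by rewrite powRN_scale// jap_ge0.
  apply: powRN_le (ltW s0) _ _; first by rewrite mulr_gt0 ?jap_gt0 ?invr_gt0.
  rewrite ler_pdivrMl//; apply: le_trans (jap_shift (r k - v) (y - v)) _.
  rewrite opprB addrA subrK mulrAC ler_wpM2r ?jap_ge0// /D ler_wpM2l//.
  apply: le_trans (jap_le_sum _) _; rewrite lerD2l.
  have -> : m%:R = (\sum_(i < m) 1)%R :> R by rewrite sumr_const card_ord.
  apply: ler_sum => i _.
  by have := yr i; rewrite !mxE => /andP[h1 h2]; rewrite ler_norml; lra.
apply: (@le_trans _ _ (\sum_(0 <= k < N)
    \int[leb R m]_y (D `^ s * jap (y - v) `^ (- s) * \1_(cube (r k) 1) y)%:E)).
  by apply: lee_sum => k _; exact: le2.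
rewrite -ge0_integral_sum//; last 2 first.
- move=> k; apply/measurable_EFinP; apply: measurable_funM.
    apply: measurable_funM => //; apply: measurable_japN.
    by apply: measurable_subrV => //; exact: measurable_id.
  by apply: measurable_indic; exact: measurable_cube.
- by move=> k y _; rewrite lee_fin !mulr_ge0 ?powR_ge0.
rewrite EFinM -IE -(integral_jap_shift s v) -ge0_integralZl//; last 3 first.
- apply/measurable_EFinP; apply: measurable_japN.
  by apply: measurable_subrV => //; exact: measurable_id.
- by move=> y _; rewrite lee_fin powR_ge0.
- by rewrite lee_fin powR_ge0.
apply: ge0_le_integral => //.
- by move=> y _; apply: sume_ge0 => k _; rewrite lee_fin !mulr_ge0 ?powR_ge0.
- apply: emeasurable_sum => k; apply/measurable_EFinP; apply: measurable_funM.
    apply: measurable_funM => //; apply: measurable_japN.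
    by apply: measurable_subrV => //; exact: measurable_id.
  by apply: measurable_indic; exact: measurable_cube.
- apply: emeasurable_funM => //; apply/measurable_EFinP; apply: measurable_japN.
  by apply: measurable_subrV => //; exact: measurable_id.
move=> y _; rewrite sumEFin -EFinM lee_fin -mulr_sumr ler_piMr//.
  by rewrite mulr_ge0 ?powR_ge0.
exact: cubes_disjoint.
Qed.

(** Otherwise [f] would exceed [f x0 / 2] on a cube of positive volume. *)
Lemma integral_eq0_continuous n (f : 'rV[R]_n -> R) x0 :
  (forall x, 0 <= f x)%R -> measurable_fun setT f -> {for x0, continuous f} ->
  \int[leb R n]_x (f x)%:E = 0 -> f x0 = 0%R.
Proof.
move=> f0 mf cf If; apply/eqP; apply: contraT => fx0.
have fx0_gt0 : (0 < f x0)%R by rewrite lt0r fx0 f0.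
have : \forall x \near x0, (f x0 / 2 < f x)%R.
  have cf' : f x @[x --> x0] --> f x0 := cf.
  by apply: (cvgr_gt _ cf'); rewrite ltr_pdivrMr// mulr_natr mulr2n ltrDl.
move=> /nbhs_ballP[e /= e0 xe].
have e2 : (0 < e / 2)%R by rewrite divr_gt0.
have : (f x0 / 2 * (e / 2) ^+ n)%:E <= \int[leb R n]_x (f x)%:E.
  have -> : (f x0 / 2 * (e / 2) ^+ n)%:E =
      \int[leb R n]_y ((f x0 / 2)%:E * (\1_(cube x0 (e / 2)) y)%:E).
    rewrite ge0_integralZl//; last 2 first.
    - by apply/measurable_EFinP; apply: measurable_indic; exact: measurable_cube.
    - by rewrite lee_fin divr_ge0.
    by rewrite integral_cube// ltW.
  apply: ge0_le_integral => //.
  - by move=> y _; rewrite mule_ge0// lee_fin divr_ge0.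
  - apply: emeasurable_funM => //.
    by apply/measurable_EFinP; apply: measurable_indic; exact: measurable_cube.
  - exact/measurable_EFinP.
  move=> y _; rewrite -EFinM lee_fin indicE.
  have [yr|_] := boolP (y \in _); last by rewrite mulr0.
  rewrite mulr1; move: yr; rewrite inE => yr; apply: ltW; apply: xe.
  split => // i j; rewrite (ord1 i) /ball /=.
  by have /andP[h1 h2] := yr j; rewrite ltr_norml; lra.
by rewrite If lee_fin leNgt mulr_gt0// ?divr_gt0// exprn_gt0.
Qed.

Lemma integral_leb_affine n (c : R) (v : 'rV[R]_n) (f : 'rV[R]_n -> R) : (0 < c)%R ->
  (leb R n).-integrable setT (EFin \o f) ->
  (leb R n).-integrable setT (EFin \o (fun x => f (c *: x + v)%R)) /\
  (\int[leb R n]_x f (c *: x + v) = (c^-1) ^+ n * \int[leb R n]_x f x)%R.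
Proof.
move=> c0 jf; have [mf fi] := integrableP _ _ _ jf.
have mg : measurable_fun setT (fun x : 'rV[R]_n => c *: x + v)%R.
  by apply: measurable_addrV => //; apply: measurable_scalerV; exact: measurable_id.
have key (h : 'rV[R]_n -> \bar R) : measurable_fun setT h -> (forall x, 0 <= h x) ->
    \int[leb R n]_x h (c *: x + v)%R = ((c^-1) ^+ n)%:E * \int[leb R n]_x h x.
  exact: ge0_leb_affine.
have jg : (leb R n).-integrable setT (EFin \o (fun x => f (c *: x + v)%R)).
  apply/integrableP; split; first exact: (measurableT_comp mf mg).
  rewrite (key (fun x => `|(EFin \o f) x|))//; last exact: measurableT_comp.
  by rewrite lte_mul_pinfty// lee_fin exprn_ge0// invr_ge0 ltW.
split=> //; rewrite /Rintegral.
rewrite integralE [in RHS]integralE.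
pose fE x := (f x)%:E.
have Ep : \int[leb R n]_x (fun y => (f (c *: y + v)%R)%:E)^\+ x =
    ((c^-1) ^+ n)%:E * \int[leb R n]_x fE^\+ x.
  rewrite -(key fE^\+)//; last exact: measurable_funepos.
  apply: eq_integral => x _.
  exact: (congr1 (fun h => h x) (funepos_comp fE (fun y => c *: y + v)%R)).
have En : \int[leb R n]_x (fun y => (f (c *: y + v)%R)%:E)^\- x =
    ((c^-1) ^+ n)%:E * \int[leb R n]_x fE^\- x.
  rewrite -(key fE^\-)//; last exact: measurable_funeneg.
  apply: eq_integral => x _.
  exact: (congr1 (fun h => h x) (funeneg_comp fE (fun y => c *: y + v)%R)).
rewrite Ep En.
rewrite -muleBr//; last first.
  apply: fin_num_adde_defr.
  exact: (integrable_pos_fin_num measurableT jf).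
rewrite fineM//.
by have := integrable_fin_num measurableT jf; rewrite integralE.
Qed.

Lemma cint_leb_affine n (c : R) (v : 'rV[R]_n) (f : 'rV[R]_n -> R[i]) : (0 < c)%R ->
  cintegrable (leb R n) f ->
  cintegrable (leb R n) (fun x => f (c *: x + v)%R) /\
  cint (leb R n) (fun x => f (c *: x + v)%R) =
    (Complex ((c^-1) ^+ n) 0 * cint (leb R n) f)%R.
Proof.
move=> c0 jf; have [mf jaf] := jf.
have mg : measurable_fun setT (fun x : 'rV[R]_n => c *: x + v)%R.
  by apply: measurable_addrV => //; apply: measurable_scalerV; exact: measurable_id.
split.
  split; first by split; [exact: (measurableT_comp mf.1 mg)|exact: (measurableT_comp mf.2 mg)].
  exact: (integral_leb_affine v c0 jaf).1.
apply: complex_ext; rewrite ?cReM ?cImM /= !mul0r ?subr0 ?addr0.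
  exact: (integral_leb_affine v c0 (cintegrable_Re jf)).2.
exact: (integral_leb_affine v c0 (cintegrable_Im jf)).2.
Qed.

Lemma cint_leb_shift n (v : 'rV[R]_n) (f : 'rV[R]_n -> R[i]) :
  cintegrable (leb R n) f ->
  cintegrable (leb R n) (fun x => f (x + v)%R) /\
  cint (leb R n) (fun x => f (x + v)%R) = cint (leb R n) f.
Proof.
move=> jf; have [h1 h2] := cint_leb_affine v ltr01 jf.
have E : (fun x => f (1 *: x + v)%R) = (fun x => f (x + v)%R).
  by apply/funext => x; rewrite scale1r.
by rewrite E in h1 h2; split => //; rewrite h2 invr1 expr1n mul1r.
Qed.

End LebesgueMore.

(** * Fourier transform of rapidly decaying functions *)

Section WeightedDerivatives.
Context {R : realType} {n : nat}.
Implicit Types (w : 'rV[R]_n -> R) (f g : 'rV[R]_n -> R) (A B : R).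

(* [w |D^a f| <= B] for all derivatives of order at most [k]. *)
Fixpoint dec w (k : nat) B f : Prop :=
  [/\ forall x, differentiable f x,
      forall x, w x * `|f x| <= B &
      match k with
      | 0 => True
      | k'.+1 => forall i, dec w k' B ('D_'e_i f)
      end].

Lemma dec_diff w k B f : dec w k B f -> forall x, differentiable f x.
Proof. by case: k => [|k] []. Qed.

Lemma dec_bound w k B f : dec w k B f -> forall x, w x * `|f x| <= B.
Proof. by case: k => [|k] []. Qed.

Lemma decS w k B f : dec w k.+1 B f -> dec w k B f.
Proof. by elim: k f => [|k IH] f [df bf Df]; split=> // i; exact/IH/Df. Qed.

Lemma dec_leq w k l B f : (l <= k)%N -> dec w k B f -> dec w l B f.
Proof.
move=> /subnK <-; elim: (k - l)%N => [//|m IH]; rewrite addSn => /decS.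
exact: IH.
Qed.

Lemma dec_mono w k A B f : A <= B -> dec w k A f -> dec w k B f.
Proof.
move=> AB; elim: k f => [|k IH] f [df bf Df]; split => //.
- by move=> x; exact: le_trans (bf x) AB.
- by move=> x; exact: le_trans (bf x) AB.
- by move=> i; exact: (IH _ (Df i)).
Qed.

Lemma dec_weight w w' k c B f : 0 <= c -> (forall x, w' x <= c * w x) ->
  dec w k B f -> dec w' k (c * B) f.
Proof.
move=> c0 ww; elim: k f => [|k IH] f [df bf Df].
  split=> // x; apply: le_trans (ler_wpM2l c0 (bf x)).
  by rewrite mulrA ler_wpM2r.
split=> // [x|i]; last exact: (IH _ (Df i)).
apply: le_trans (ler_wpM2l c0 (bf x)).
by rewrite mulrA ler_wpM2r.
Qed.

Lemma dec_ge0 w k B f : (forall x, 0 <= w x) -> dec w k B f -> 0 <= B.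
Proof. by move=> w0 /dec_bound /(_ 0); apply: le_trans; rewrite mulr_ge0. Qed.

Lemma decD w k A B f g : (forall x, 0 <= w x) ->
  dec w k A f -> dec w k B g -> dec w k (A + B) (f \+ g).
Proof.
move=> w0; elim: k f g => [|k IH] f g [df bf Df] [dg bg Dg].
  split=> // x; first exact: differentiableD.
  by apply: le_trans (lerD (bf x) (bg x)); rewrite -mulrDr ler_wpM2l// ler_normD.
split=> [x|x|i]; first exact: differentiableD.
  by apply: le_trans (lerD (bf x) (bg x)); rewrite -mulrDr ler_wpM2l// ler_normD.
rewrite (_ : 'D_ _ _ = 'D_'e_i f \+ 'D_'e_i g); first exact: (IH _ _ (Df i) (Dg i)).
by apply/funext => x; rewrite deriveD//; exact: diff_derivable.
Qed.

Lemma decZ w k B f c : dec w k B f -> dec w k (`|c| * B) (fun x => c * f x).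
Proof.
elim: k f => [|k IH] f [df bf Df].
  split=> // x; first exact: (@differentiableZ _ _ _ f c).
  by rewrite normrM mulrCA ler_wpM2l.
split=> [x|x|i]; first exact: (@differentiableZ _ _ _ f c).
  by rewrite normrM mulrCA ler_wpM2l.
rewrite (_ : 'D_ _ _ = fun x => c * 'D_'e_i f x); first exact: (IH _ (Df i)).
by apply/funext => x; rewrite (@deriveZ _ _ _ f c)//; exact: diff_derivable.
Qed.

Lemma dec0 w k : dec w k 0 (fun=> 0).
Proof.
elim: k => [|k IH]; (split=> //; try by move=> x; rewrite normr0 mulr0).
by move=> i; rewrite (_ : 'D_ _ _ = fun=> 0)//; apply/funext => x; rewrite derive_cst.
Qed.

Lemma dec_sum w k (I : Type) (r : seq I) (B : I -> R) (F : I -> 'rV[R]_n -> R) :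
  (forall x, 0 <= w x) -> (forall i, dec w k (B i) (F i)) ->
  dec w k (\sum_(i <- r) B i) (fun x => \sum_(i <- r) F i x).
Proof.
move=> w0 dF; elim: r => [|i r IH].
  rewrite big_nil; rewrite (_ : (fun x => _) = fun=> 0); first exact: dec0.
  by apply/funext => x; rewrite big_nil.
rewrite big_cons (_ : (fun x => _) = F i \+ fun x => \sum_(j <- r) F j x); last first.
  by apply/funext => x; rewrite big_cons.
exact: (decD w0 (dF i) IH).
Qed.

(** The Leibniz rule doubles the number of terms at each differentiation, whence [2 ^+ k]; the
    weights multiply. *)
Lemma decM w w' k A B f g : (forall x, 0 <= w x) -> (forall x, 0 <= w' x) ->
  dec w k A f -> dec w' k B g ->
  dec (w \* w') k (2 ^+ k * (A * B)) (f \* g).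
Proof.
move=> w0 w'0; elim: k f g => [|k IH] f g hf hg.
  split=> // x; first exact: differentiableM (dec_diff hf x) (dec_diff hg x).
  rewrite expr0 mul1r /= normrM mulrACA ler_pM ?mulr_ge0//.
    exact: dec_bound hf x.
  exact: dec_bound hg x.
have [df bf Df] := hf; have [dg bg Dg] := hg.
have A0 := dec_ge0 w0 hf; have B0 := dec_ge0 w'0 hg.
split=> [x|x|i].
- exact: differentiableM.
- rewrite /= normrM mulrACA; apply: (@le_trans _ _ (A * B)).
    by rewrite ler_pM ?mulr_ge0.
  by rewrite ler_peMl ?mulr_ge0// exprn_ege1// ler1n.
rewrite (_ : 'D_ _ _ = (f \* 'D_'e_i g) \+ ('D_'e_i f \* g)).
  rewrite exprS -mulrA mulr_natl mulr2n; apply: decD.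
  - by move=> x; rewrite /= mulr_ge0.
  - exact: IH (decS hf) (Dg i).
  - exact: IH (Df i) (decS hg).
apply/funext => x; rewrite deriveM; [|exact: diff_derivable..].
by rewrite /= [g x *: _]mulrC.
Qed.

Lemma dec_shift w k B f (a : 'rV[R]_n) : dec w k B f ->
  dec (fun x => w (x - a)) k B (fun x => f (x - a)).
Proof.
have dsub x : differentiable (fun y : 'rV[R]_n => y - a) x.
  exact: differentiableB.
elim: k f => [|k IH] f [df bf Df].
  by split=> // x; exact: (@differentiable_comp _ _ _ _ (fun y => y - a) f).
split=> // [x|i]; first exact: (@differentiable_comp _ _ _ _ (fun y => y - a) f).
rewrite (_ : 'D_ _ _ = fun x => 'D_'e_i f (x - a)); first exact: (IH _ (Df i)).
apply/funext => x; rewrite /derive.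
by under eq_fun do rewrite /= -addrA.
Qed.

Lemma dec_partial w k B f s : dec w k B f -> (size s <= k)%N ->
  (forall x, differentiable (partial s f) x) /\
  forall x, w x * `|partial s f x| <= B.
Proof.
elim: k f s => [|k IH] f s hf.
  by rewrite leqn0 size_eq0 => /eqP ->; split; [exact: dec_diff hf|exact: dec_bound hf].
(* [dec] takes its derivatives from the inside outwards, and the innermost direction is the last one
   of the list. *)
case/lastP: s => [_|s i]; first by split; [exact: dec_diff hf|exact: dec_bound hf].
rewrite size_rcons ltnS => sk; rewrite /partial foldr_rcons.
by have [_ _ Df] := hf; exact: (IH _ s (Df i) sk).
Qed.

Lemma partial_dec w k B f : (forall s x, differentiable (partial s f) x) ->
  (forall s x, (size s <= k)%N -> w x * `|partial s f x| <= B) -> dec w k B f.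
Proof.
elim: k f => [|k IH] f sf bf.
  by split=> // x; [exact: (sf [::])|exact: (bf [::])].
split=> [x|x|i]; [exact: (sf [::])|exact: (bf [::])|].
have E s : partial s ('D_'e_i f) = partial (rcons s i) f.
  by rewrite /partial foldr_rcons.
apply: IH => [s x|s x sk]; rewrite E; first exact: sf.
by apply: bf; rewrite size_rcons.
Qed.

Lemma decays_dec N k f : decays N k f -> exists B, dec (fun x => jap x ^+ N) k B f.
Proof.
have w0 x : 0 <= (@jap R n x) ^+ N by rewrite exprn_ge0// jap_ge0.
elim: k f => [|k IH] f [df [C bf] Df]; first by exists C.
have /fin_all_exists[B HB] : forall i, exists B, dec (fun x => jap x ^+ N) k B ('D_'e_i f).
  by move=> i; exact: (IH _ (Df i)).
have B0 i : 0 <= B i by exact: dec_ge0 (HB i).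
have C0 : 0 <= C by apply: le_trans (bf 0); rewrite mulr_ge0.
exists (C + \sum_i B i); split=> // [x|i].
  by apply: le_trans (bf x) _; rewrite lerDl sumr_ge0.
apply: dec_mono (HB i); rewrite (bigD1 i)//= addrCA lerDl.
by rewrite addr_ge0// sumr_ge0.
Qed.

Lemma derive_coord f x v : differentiable f x ->
  'D_v f x = \sum_i v 0 i * 'D_'e_i f x.
Proof.
move=> df; rewrite deriveE// [in LHS](row_sum_delta v) linear_sum.
by apply: eq_bigr => i _; rewrite linearZ deriveE.
Qed.

Lemma mvt_dir f x v : (forall y, differentiable f y) ->
  exists2 t, 0 <= t <= 1 & f (x + v) - f x = 'D_v f (x + t *: v).
Proof.
move=> df.
pose g (t : R) := f (x + t *: v).
have dg (t : R) : is_derive t (1 : R) g ('D_v f (x + t *: v)).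
  have E : (fun h : R => h^-1 *: ((g \o shift t) (h *: (1 : R)) - g t)) =
      (fun h => h^-1 *: ((f \o shift (x + t *: v)) (h *: v) - f (x + t *: v))).
    apply/funext => h /=; congr (_ *: (f _ - _)).
    by rewrite scalerDl addrCA [h *: 1]mulr1.
  have cf : derivable f (x + t *: v) v by exact: diff_derivable.
  by split; [rewrite /derivable E|rewrite /derive E].
have [] := @MVT_segment R g (fun t => 'D_v f (x + t *: v)) 0 1.
- exact: ler01.
- apply: continuous_subspaceT => t.
  by apply: differentiable_continuous; apply/derivable1_diffP.
move=> t; rewrite in_itv /= => t01 E; exists t => //.
by move: E; rewrite /g scale1r scale0r addr0 subr0 mulr1.
Qed.

End WeightedDerivatives.

(** * Decay of the Fourier transform by integration by parts *)

Section FourierDecay.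
Context {R : realType} {n : nat}.
Implicit Types (q : 'rV[R]_n -> R) (B : R).

(** The least integer power of the bracket whose reciprocal is integrable on R^n: a bound on
    [japw x * |q x|] makes a measurable [q] integrable. *)
Definition japw : 'rV[R]_n -> R := fun x => jap x ^+ n.+1.

Lemma japw_ge0 x : 0 <= japw x.
Proof. by rewrite exprn_ge0// jap_ge0. Qed.

Definition japJ : R := \int[leb R n]_x (jap x `^ (- n.+1%:R)).

Lemma japJ_ge0 : 0 <= japJ.
Proof. by apply: Rintegral_ge0 => x _; rewrite powR_ge0. Qed.

Lemma integrable_japJ (B : R) :
  (leb R n).-integrable setT (EFin \o (fun x => B * jap x `^ (- n.+1%:R))).
Proof.
have h : (n%:R : R) < n.+1%:R by rewrite ltr_nat.
exact: (integrableZl _ B (integrable_japN h)).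
Qed.

Lemma japw_le q B : (forall x, japw x * `|q x| <= B) ->
  forall x, `|q x| <= B * jap x `^ (- n.+1%:R).
Proof.
move=> qB x; rewrite powR_invn ?jap_ge0// ler_pdivlMr ?exprn_gt0 ?jap_gt0//.
by rewrite mulrC; exact: qB.
Qed.

Lemma japw_integrable q B : measurable_fun setT q ->
  (forall x, japw x * `|q x| <= B) -> (leb R n).-integrable setT (EFin \o q).
Proof.
move=> mq /japw_le qB; apply: le_integrable (integrable_japJ B) => //.
  exact/measurable_EFinP.
by move=> x _ /=; rewrite lee_fin; apply: le_trans (qB x) (ler_norm _).
Qed.

Lemma japw_Rintegral q B : measurable_fun setT q ->
  (forall x, japw x * `|q x| <= B) -> `|\int[leb R n]_x q x| <= B * japJ.
Proof.
move=> mq qB; have jq := japw_integrable mq qB.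
apply: le_trans (le_normr_Rintegral measurableT jq) _.
have h : (n%:R : R) < n.+1%:R by rewrite ltr_nat.
rewrite /japJ -RintegralZl//; last exact: integrable_japN h.
apply: le_Rintegral => //.
- exact: integrable_norm jq.
- exact: integrable_japJ.
- by move=> x _; exact: japw_le.
Qed.

Lemma diff_measurable q : (forall x, differentiable q x) -> measurable_fun setT q.
Proof.
by move=> dq; apply: continuous_rV_measurable => x; exact: differentiable_continuous.
Qed.

(* Translation invariance makes the integral of every difference quotient
   vanish; the mean value theorem dominates the quotients. *)
Lemma int_derive0 q B i : dec japw 1 B q -> \int[leb R n]_x 'D_'e_i q x = 0.
Proof.
move=> hq; have [dq bq Dq] := hq; have [dDq bDq _] := Dq i.
have mq := diff_measurable dq; have mDq := diff_measurable dDq.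
have jq := japw_integrable mq bq.
pose F m x := m.+1%:R * (q (x + m.+1%:R^-1 *: 'e_i) - q x).
have mF m : measurable_fun setT (F m).
  apply: measurable_funM => //; apply: measurable_funB => //.
  by apply: measurableT_comp => //; apply: measurable_addrV.
have IF m : \int[leb R n]_x F m x = 0.
  have [jq' E] := integral_leb_affine (m.+1%:R^-1 *: 'e_i) ltr01 jq.
  have E1 : (fun x => q (1 *: x + m.+1%:R^-1 *: 'e_i)) =
            (fun x => q (x + m.+1%:R^-1 *: 'e_i)).
    by apply/funext => x; rewrite scale1r.
  rewrite E1 invr1 expr1n mul1r in jq' E.
  rewrite /F RintegralZl//; last exact: integrableB jq' jq.
  by rewrite RintegralB// E subrr mulr0.
have FD x : F ^~ x @ \oo --> 'D_'e_i q x.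
  have := @diff_derivable _ _ _ q x 'e_i (dq x).
  rewrite /derivable -/('D_'e_i q x) => /cvg_ex[l cl].
  rewrite /derive (cvg_lim _ cl)//.
  have c0 : (fun m : nat => (m.+1%:R : R)^-1) @ \oo --> (0 : R)^'.
    move=> A A0; have c1 : (fun m : nat => (m.+1%:R : R)^-1) @ \oo --> (0 : R).
      exact: cvg_harmonic.
    have A1 : nbhs (0 : R) [set y | y != 0 -> A y] := A0.
    have A2 : \forall m \near \oo, (m.+1%:R : R)^-1 != 0 -> A (m.+1%:R : R)^-1 := c1 _ A1.
    change (\forall m \near \oo, A (m.+1%:R : R)^-1).
    by apply: filterS A2 => m; apply; rewrite invr_eq0 pnatr_eq0.
  have := cvg_comp _ _ c0 cl; apply: cvg_trans; apply: near_eq_cvg.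
  apply: nearW => m.
  change ((m.+1%:R : R)^-1^-1 * (q ((m.+1%:R : R)^-1 *: 'e_i + x) - q x) = F m x).
  by rewrite invrK [_ *: _ + _]addrC.
(* [F m x] is the derivative at a point [y] of the segment from [x] to [x + e_i / m.+1]. Peetre's
   inequality with [<x - y> <= 2] exchanges the weight at [y] for the weight at [x] at the cost
   [4 ^+ n.+1]. *)
have FB m x : `|F m x| <= (4 ^+ n.+1 * B) * jap x `^ (- n.+1%:R).
  have [t /andP[t0 t1] E] := mvt_dir x (m.+1%:R^-1 *: 'e_i) dq.
  rewrite /F E derive_coord// (bigD1 i)//= big1 ?addr0; last first.
    by move=> j ji; rewrite !mxE eqxx (negPf ji) mulr0 mul0r.
  rewrite !mxE !eqxx mulr1 mulrA mulfV// mul1r.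
  set y := x + _; rewrite -mulrA; apply: le_trans (japw_le bDq y) _.
  rewrite mulrCA ler_wpM2l//; first by apply: le_trans (bq 0); rewrite mulr_ge0 ?japw_ge0.
  rewrite !powR_invn ?jap_ge0// ler_pdivlMr ?exprn_gt0 ?jap_gt0// mulrC.
  rewrite ler_pdivrMr ?exprn_gt0 ?jap_gt0// -exprMn lerXn2r ?nnegrE ?mulr_ge0 ?jap_ge0//.
  apply: le_trans (jap_shift y x) _; rewrite mulrAC ler_wpM2r ?jap_ge0//.
  rewrite (_ : 4 = 2 * 2); last by ring.
  rewrite ler_wpM2l// /y opprD addrA subrr add0r japN.
  apply: le_trans (jap_le_sum _) _; rewrite (bigD1 i)//= big1 ?addr0.
    rewrite !mxE !eqxx mulr1 (_ : 2 = 1 + 1)// lerD2l ger0_norm ?mulr_ge0//.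
    by rewrite mulr_ile1// invf_le1// ler1n.
  by move=> j ji; rewrite !mxE eqxx (negPf ji) !mulr0 normr0.
have := Rintegral_dct mF mDq (integrable_japJ (4 ^+ n.+1 * B)) FB FD.
under eq_fun do rewrite IF.
by move=> /(cvg_unique _ (cvg_cst _)) <-.
Qed.

Definition phase (eta t : 'rV[R]_n) : R := 2 * pi * dotp t eta.

Lemma phase_diff eta x : differentiable (phase eta) x.
Proof.
rewrite (_ : phase eta = \sum_(j < n) (fun t : 'rV[R]_n => (2 * pi * eta 0 j) *: t 0 j)).
  apply: (@differentiable_sum _ _ _ n (fun j (t : 'rV[R]_n) => (2 * pi * eta 0 j) *: t 0 j)) => j.
  apply: (@differentiableZ _ _ _ (fun t : 'rV[R]_n => t 0 j)).
  exact: differentiable_coord.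
apply/funext => t; rewrite /phase dotpE mulr_sumr fct_sumE; apply: eq_bigr => j _.
by rewrite /= /GRing.scale/=; ring.
Qed.

Lemma diff_phase eta x i : 'd (phase eta) x 'e_i = 2 * pi * eta 0 i.
Proof.
rewrite -deriveE; last exact: phase_diff.
rewrite /derive; apply: lim_near_cst => //; near=> h.
rewrite /phase /= -mulrBr !dotpE -sumrB (bigD1 i)//= big1 => [|j ji].
  rewrite !mxE !eqxx /GRing.scale /=.
  have h0 : h != 0 by near: h; exact: nbhs_dnbhs_neq.
  by field.
by rewrite !mxE eqxx /= (negPf ji) /GRing.scale /=; ring.
Unshelve. all: by end_near. Qed.

Lemma derive_cos_phase eta x i :
  'D_'e_i (fun t => cos (phase eta t)) x = - (2 * pi * eta 0 i) * sin (phase eta x).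
Proof.
rewrite (_ : (fun t => _) = cos \o phase eta)//.
have dl := phase_diff eta x.
have dc : differentiable cos (phase eta x) by apply/derivable1_diffP.
rewrite deriveE; last exact: differentiable_comp.
rewrite diff_comp//= diff_phase diff1E//.
rewrite derive1E derive_val /GRing.scale/=; ring.
Qed.

Lemma derive_sin_phase eta x i :
  'D_'e_i (fun t => sin (phase eta t)) x = (2 * pi * eta 0 i) * cos (phase eta x).
Proof.
rewrite (_ : (fun t => _) = sin \o phase eta)//.
have dl := phase_diff eta x.
have dc : differentiable sin (phase eta x) by apply/derivable1_diffP.
rewrite deriveE; last exact: differentiable_comp.
rewrite diff_comp//= diff_phase diff1E//.
rewrite derive1E derive_val /GRing.scale/=; ring.
Qed.

Lemma dec_trig k eta c : 0 <= c ->
  dec (fun=> 1) k (c * (1 + 2 * pi * jap eta) ^+ k) (fun t => c * cos (phase eta t)) /\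
  dec (fun=> 1) k (c * (1 + 2 * pi * jap eta) ^+ k) (fun t => c * sin (phase eta t)).
Proof.
have M1 : 1 <= 1 + 2 * pi * jap eta by rewrite lerDl !mulr_ge0 ?pi_ge0 ?jap_ge0.
have dC x : differentiable (fun t => cos (phase eta t)) x.
  apply: (@differentiable_comp _ _ _ _ (phase eta) cos); first exact: phase_diff.
  exact/derivable1_diffP.
have dS x : differentiable (fun t => sin (phase eta t)) x.
  apply: (@differentiable_comp _ _ _ _ (phase eta) sin); first exact: phase_diff.
  exact/derivable1_diffP.
have dCc c' x : differentiable (fun t => c' * cos (phase eta t)) x.
  exact: (@differentiableZ _ _ _ _ c' x (dC x)).
have dSc c' x : differentiable (fun t => c' * sin (phase eta t)) x.
  exact: (@differentiableZ _ _ _ _ c' x (dS x)).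
have bC c' x l : 0 <= c' ->
    1 * `|c' * cos (phase eta x)| <= c' * (1 + 2 * pi * jap eta) ^+ l.
  move=> c0; rewrite mul1r normrM (ger0_norm c0) ler_wpM2l//.
  by apply: le_trans (cos_max _) _; rewrite exprn_ege1.
have bS c' x l : 0 <= c' ->
    1 * `|c' * sin (phase eta x)| <= c' * (1 + 2 * pi * jap eta) ^+ l.
  move=> c0; rewrite mul1r normrM (ger0_norm c0) ler_wpM2l//.
  by apply: le_trans (sin_max _) _; rewrite exprn_ege1.
have step i : `|2 * pi * eta 0 i| <= 1 + 2 * pi * jap eta.
  rewrite !normrM (ger0_norm (pi_ge0 R)) (@ger0_norm _ 2)//.
  by apply: le_trans (ler_wpM2l _ (coord_le_jap eta i)) _; rewrite ?mulr_ge0 ?pi_ge0// lerDr.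
have gen (F : 'rV[R]_n -> R) l a b c' : 0 <= c' -> `|a| <= 1 + 2 * pi * jap eta ->
    dec (fun=> 1) l (c' * (1 + 2 * pi * jap eta) ^+ l) (fun t => c' * F t) ->
    `|b| = 1 ->
    dec (fun=> 1) l (c' * (1 + 2 * pi * jap eta) ^+ l.+1) (fun t => c' * ((b * a) * F t)).
  move=> c0 aM dF b1.
  have := decZ (b * a) dF.
  rewrite (_ : (fun x => b * a * (c' * F x)) = (fun t => c' * (b * a * F t))); last first.
    by apply/funext => t; ring.
  apply: dec_mono; rewrite normrM b1 mul1r exprS mulrCA ler_wpM2l//.
  by rewrite ler_wpM2r// exprn_ge0// (le_trans ler01).
elim: k => [|k IH] c0; split; split=> //; try (by move=> x; exact: bC); try (by move=> x; exact: bS).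
- move=> i; rewrite (_ : 'D_ _ _ = fun t => c * (-1 * (2 * pi * eta 0 i) * sin (phase eta t))).
    by apply: (gen (fun t => sin (phase eta t))) => //; [exact: (IH c0).2|rewrite normrN normr1].
  apply/funext => x; rewrite (@deriveZ _ _ _ (fun t => cos (phase eta t)) c)//; last exact: diff_derivable.
  by rewrite derive_cos_phase /GRing.scale /= mulN1r.
- move=> i; rewrite (_ : 'D_ _ _ = fun t => c * (1 * (2 * pi * eta 0 i) * cos (phase eta t))).
    by apply: (gen (fun t => cos (phase eta t))) => //; [exact: (IH c0).1|rewrite normr1].
  apply/funext => x; rewrite (@deriveZ _ _ _ (fun t => sin (phase eta t)) c)//; last exact: diff_derivable.
  by rewrite derive_sin_phase /GRing.scale /= mul1r.
Qed.

(** Cosine and sine transforms of a real function. Integration by parts exchanges the two;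
    [ft_decay] assembles the complex transform from those of the real and imaginary parts. *)
Definition fourC q eta : R := \int[leb R n]_t (q t * cos (phase eta t)).
Definition fourS q eta : R := \int[leb R n]_t (q t * sin (phase eta t)).

Lemma trig_bound q B (h : 'rV[R]_n -> R) : (forall x, `|h x| <= 1) ->
  (forall x, japw x * `|q x| <= B) -> forall x, japw x * `|q x * h x| <= B.
Proof.
move=> h1 qB x; apply: le_trans (qB x); rewrite ler_wpM2l ?japw_ge0//.
by rewrite normrM ler_piMr.
Qed.

Lemma measurable_phase eta d (T : measurableType d) (f : T -> 'rV[R]_n) :
  measurable_fun setT f -> measurable_fun setT (fun x => phase eta (f x)).
Proof.
move=> mf; apply: measurable_funM => //; exact: measurable_dotp.
Qed.

Lemma measurable_cos_comp d (T : measurableType d) (f : T -> R) :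
  measurable_fun setT f -> measurable_fun setT (fun x => cos (f x)).
Proof.
move=> mf; have mc : measurable_fun [set: R] (@cos R).
  by apply: continuous_measurable_fun; exact: continuous_cos.
exact: (measurableT_comp mc mf).
Qed.

Lemma measurable_sin_comp d (T : measurableType d) (f : T -> R) :
  measurable_fun setT f -> measurable_fun setT (fun x => sin (f x)).
Proof.
move=> mf; have mc : measurable_fun [set: R] (@sin R).
  by apply: continuous_measurable_fun; exact: continuous_sin.
exact: (measurableT_comp mc mf).
Qed.

(** Integration by parts: the product of [q] with the cosine or the sine of the phase is
    differentiated, and the integral of the derivative vanishes by [int_derive0]. *)
Lemma fourCS_derive q B i eta : dec japw 1 B q ->
  fourC ('D_'e_i q) eta = (2 * pi * eta 0 i) * fourS q eta /\
  fourS ('D_'e_i q) eta = - (2 * pi * eta 0 i) * fourC q eta.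
Proof.
move=> hq; have [dq bq Dq] := hq; have [dDq bDq _] := Dq i.
have mq := diff_measurable dq; have mDq := diff_measurable dDq.
have mp : measurable_fun setT (phase eta) by apply: measurable_phase; exact: measurable_id.
have mC := measurable_cos_comp mp; have mS := measurable_sin_comp mp.
have [hC hS] := dec_trig 1 eta ler01.
have E1 (h : 'rV[R]_n -> R) : (fun t => 1 * h t) = h by apply/funext => t; rewrite mul1r.
rewrite !E1 in hC hS.
have w1 : forall x : 'rV[R]_n, 0 <= (fun=> 1 : R) x by [].
have bc x : `|cos (phase eta x)| <= 1 by exact: cos_max.
have bs x : `|sin (phase eta x)| <= 1 by exact: sin_max.
have ww : japw \* (fun=> 1) = japw by apply/funext => x /=; rewrite mulr1.
have kC := decM japw_ge0 w1 hq hC; have kS := decM japw_ge0 w1 hq hS.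
rewrite ww in kC kS.
have jqC := japw_integrable (measurable_funM mq mC) (trig_bound bc bq).
have jqS := japw_integrable (measurable_funM mq mS) (trig_bound bs bq).
have jDC := japw_integrable (measurable_funM mDq mC) (trig_bound bc bDq).
have jDS := japw_integrable (measurable_funM mDq mS) (trig_bound bs bDq).
have dc x : derivable (fun t => cos (phase eta t)) x 'e_i.
  by apply: diff_derivable; exact: dec_diff hC x.
have ds x : derivable (fun t => sin (phase eta t)) x 'e_i.
  by apply: diff_derivable; exact: dec_diff hS x.
split.
  have := int_derive0 i kC.
  have -> : (fun x => 'D_'e_i (q \* (fun t => cos (phase eta t))) x) =
      (fun x => 'D_'e_i q x * cos (phase eta x) - (2 * pi * eta 0 i) * (q x * sin (phase eta x))).
    apply/funext => x; rewrite deriveM//; last exact: diff_derivable.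
    by rewrite derive_cos_phase /GRing.scale /=; ring.
  rewrite RintegralB//; last exact: (integrableZl _ _ jqS).
  by rewrite RintegralZl// => /eqP; rewrite subr_eq0 => /eqP.
have := int_derive0 i kS.
have -> : (fun x => 'D_'e_i (q \* (fun t => sin (phase eta t))) x) =
    (fun x => 'D_'e_i q x * sin (phase eta x) + (2 * pi * eta 0 i) * (q x * cos (phase eta x))).
  apply/funext => x; rewrite deriveM//; last exact: diff_derivable.
  by rewrite derive_sin_phase /GRing.scale /=; ring.
rewrite RintegralD//; last exact: (integrableZl _ _ jqC).
by rewrite RintegralZl// => /eqP; rewrite addr_eq0 mulNr => /eqP.
Qed.

(** A factor [eta 0 i] is traded for a derivative of [q]. As [<eta> <= 1 + sum_i |eta_i|], each
    power of the bracket costs the factor [1 + n], and the constant stays uniform in [q] and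
    [eta]. *)
Lemma fourCS_decay k : exists2 C, 0 <= C & forall B q eta, dec japw k B q ->
  `|fourC q eta| * jap eta ^+ k <= C * B /\ `|fourS q eta| * jap eta ^+ k <= C * B.
Proof.
elim: k => [|k [C C0 IH]].
  exists japJ => [|B q eta [dq bq _]]; first exact: japJ_ge0.
  have mq := diff_measurable dq.
  have mp : measurable_fun setT (phase eta) by apply: measurable_phase; exact: measurable_id.
  rewrite !expr0 !mulr1 mulrC; split.
    apply: japw_Rintegral; first exact: measurable_funM mq (measurable_cos_comp mp).
    by apply: trig_bound => // x; exact: cos_max.
  apply: japw_Rintegral; first exact: measurable_funM mq (measurable_sin_comp mp).
  by apply: trig_bound => // x; exact: sin_max.
exists (C * (1 + n%:R)) => [|B q eta hq]; first by rewrite mulr_ge0// addr_ge0.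
have B0 : 0 <= B by exact: dec_ge0 japw_ge0 hq.
have [dq bq Dq] := hq.
have [IC IS] := IH B q eta (decS hq).
have h1 : dec japw 1 B q by exact: dec_leq hq.
have pi1 i : `|eta 0 i| <= `|2 * pi * eta 0 i|.
  rewrite normrM ler_peMl// ger0_norm ?mulr_ge0 ?pi_ge0//.
  by have := pi_ge2 R; lra.
have step (F : R) : `|F| * jap eta ^+ k <= C * B ->
    (forall i, `|eta 0 i| * `|F| * jap eta ^+ k <= C * B) ->
    `|F| * jap eta ^+ k.+1 <= C * (1 + n%:R) * B.
  move=> F0 FD; rewrite exprS mulrCA.
  apply: le_trans (ler_wpM2r _ (jap_le_sum eta)) _.
    by rewrite mulr_ge0// exprn_ge0// jap_ge0.
  rewrite mulrDl mul1r (_ : _ * _ * B = C * B + n%:R * (C * B)); last by ring.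
  apply: lerD => //; rewrite mulr_suml.
  have -> : n%:R * (C * B) = \sum_(i < n) (C * B).
    by rewrite sumr_const card_ord mulr_natl.
  by apply: ler_sum => i _; rewrite mulrA.
split; apply: step => // i.
  have [_ ES] := fourCS_derive i eta h1; have [_] := IH B _ eta (Dq i).
  rewrite ES normrM normrN; apply: le_trans.
  by rewrite ler_wpM2r ?exprn_ge0 ?jap_ge0// ler_wpM2r.
have [EC _] := fourCS_derive i eta h1; have [+ _] := IH B _ eta (Dq i).
rewrite EC normrM; apply: le_trans.
by rewrite ler_wpM2r ?exprn_ge0 ?jap_ge0// ler_wpM2r.
Qed.

End FourierDecay.

Section ParametricIntegrals.
Context d1 d2 (T1 : measurableType d1) (T2 : measurableType d2) (R : realType).
Variable m1 : {sigma_finite_measure set T1 -> \bar R}.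
Variable m2 : {sigma_finite_measure set T2 -> \bar R}.

(** Tonelli gives measurability for the positive and the negative part; their difference and its
    [fine] value remain measurable even where the integrals diverge. *)
Lemma measurable_Rintegral (k : T1 * T2 -> R) : measurable_fun setT k ->
  measurable_fun setT (fun x => \int[m2]_y k (x, y)).
Proof.
move=> mk; have mkE : measurable_fun setT (EFin \o k) by exact/measurable_EFinP.
apply: (measurableT_comp (@fine_measurable R setT measurableT)).
under eq_fun do rewrite integralE.
apply: emeasurable_funB.
- have := measurable_fun_fubini_tonelli_F (m2 := m2) ((EFin \o k)^\+)%E.
  have mp := measurable_funepos mkE.
  move=> /(_ mp (fun=> funepos_ge0 _ _)); congr (measurable_fun _ _).
  apply/funext => x; apply: eq_integral => y _.
  exact: esym (congr1 (fun h => h y) (funepos_comp (EFin \o k) (fun y => (x, y)))).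
- have := measurable_fun_fubini_tonelli_F (m2 := m2) ((EFin \o k)^\-)%E.
  have mp := measurable_funeneg mkE.
  move=> /(_ mp (fun=> funeneg_ge0 _ _)); congr (measurable_fun _ _).
  apply/funext => x; apply: eq_integral => y _.
  exact: esym (congr1 (fun h => h y) (funeneg_comp (EFin \o k) (fun y => (x, y)))).
Qed.

Lemma cmeas_cint (f : T1 * T2 -> R[i]) : cmeas f ->
  cmeas (fun x => cint m2 (fun y => f (x, y))).
Proof.
move=> [fr fi]; split.
  exact: (measurable_Rintegral fr).
exact: (measurable_Rintegral fi).
Qed.

Lemma dominated_prod_lty (f : T1 * T2 -> R[i]) (a : T1 -> R) (b : T2 -> R) : cmeas f ->
  m1.-integrable setT (EFin \o a) -> m2.-integrable setT (EFin \o b) ->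
  (forall x y, cabs (f (x, y)) <= a x * b y) ->
  (\int[m1]_x \int[m2]_y (cabs (f (x, y)))%:E < +oo)%E.
Proof.
move=> mf ja jb fab.
have [ma ia] := integrableP _ _ _ ja; have [mb ib] := integrableP _ _ _ jb.
apply: (@le_lt_trans _ _ ((\int[m1]_x `|(a x)%:E|) * (\int[m2]_y `|(b y)%:E|)))%E; last first.
  by rewrite lte_mul_pinfty ?ge0_fin_numE ?integral_ge0.
rewrite -ge0_integralZr//; last 2 first.
- exact: measurableT_comp.
- exact: integral_ge0.
have mcf : measurable_fun setT (fun z => (cabs (f z))%:E).
  exact/measurable_EFinP/cmeas_cabs.
apply: ge0_le_integral => //.
- by move=> x _; apply: integral_ge0 => y _; rewrite lee_fin cabs_ge0.
- apply: (measurable_fun_fubini_tonelli_F (m2 := m2) (fun z => (cabs (f z))%:E)) => // z.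
  by rewrite lee_fin cabs_ge0.
- apply: emeasurable_funM => //; exact: measurableT_comp.
move=> x _; rewrite -ge0_integralZl//; last exact: measurableT_comp.
apply: ge0_le_integral => //.
- by move=> y _; rewrite lee_fin cabs_ge0.
- exact: (measurableT_comp mcf (measurable_pair1 x)).
- apply: emeasurable_funM => //; exact: measurableT_comp.
move=> y _; rewrite /= lee_fin; apply: le_trans (fab x y) _.
by rewrite -normrM ler_norm.
Qed.

Lemma cint_fubini_dom (f : T1 * T2 -> R[i]) (a : T1 -> R) (b : T2 -> R) : cmeas f ->
  m1.-integrable setT (EFin \o a) -> m2.-integrable setT (EFin \o b) ->
  (forall x y, cabs (f (x, y)) <= a x * b y) ->
  cint m1 (fun x => cint m2 (fun y => f (x, y))) =
  cint m2 (fun y => cint m1 (fun x => f (x, y))).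
Proof.
by move=> mf ja jb fab; apply: cint_fubini => //; exact: dominated_prod_lty fab.
Qed.

End ParametricIntegrals.

Section SplitComplex.
Context {R : realType}.

Lemma integral_split m n (f : 'rV[R]_(m + n) -> R) :
  (leb R (m + n)).-integrable setT (EFin \o f) ->
  \int[leb R (m + n)]_z f z = \int[leb R m]_x \int[leb R n]_y f (row_mx x y).
Proof.
move=> jf; have [mf fi] := integrableP _ _ _ jf.
pose r (p : 'rV[R]_m * 'rV[R]_n) : 'rV[R]_(m + n) := row_mx p.1 p.2.
have mr : measurable_fun setT r.
  by apply: measurable_row_mx; [exact: measurable_fst|exact: measurable_snd].
have key (F : 'rV[R]_(m + n) -> \bar R) : measurable_fun setT F -> (forall x, 0 <= F x)%E ->
    (\int[leb R (m + n)]_z F z = \int[(leb R m \x leb R n)]_p F (r p))%E.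
  move=> mF F0; rewrite ge0_leb_split// (fubini_tonelli1 (fun p => F (r p)))//.
  exact: measurableT_comp.
have jg : (leb R m \x leb R n)%E.-integrable setT (fun p => (f (r p))%:E).
  apply/integrableP; split; first exact: (measurableT_comp mf mr).
  by rewrite -(key (fun z => `|(f z)%:E|%E))//; exact: measurableT_comp.
have E : (\int[leb R (m + n)]_z (f z)%:E = \int[(leb R m \x leb R n)]_p (f (r p))%:E)%E.
  rewrite integralE [in RHS]integralE; congr (_ - _)%E.
    rewrite (key ((EFin \o f)^\+)%E)//; last exact: measurable_funepos.
    apply: eq_integral => p _.
    exact: esym (congr1 (fun h => h p) (funepos_comp (EFin \o f) r)).
  rewrite (key ((EFin \o f)^\-)%E)//; last exact: measurable_funeneg.
  apply: eq_integral => p _.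
  exact: esym (congr1 (fun h => h p) (funeneg_comp (EFin \o f) r)).
rewrite /Rintegral E -(integral12_prod_meas1 jg); congr fine.
have fin : {ae leb R m, forall x, (\int[leb R n]_y (f (row_mx x y))%:E \is a fin_num)%E}.
  apply: filterS (ae_integrable1 jg) => x jx.
  exact: (integrable_fin_num measurableT jx).
apply: ae_eq_integral => //.
- exact: (measurable_fubini_F jg).
- apply/measurable_EFinP.
  apply: (measurableT_comp (@fine_measurable R setT measurableT)).
  exact: (measurable_fubini_F jg).
by apply: filterS fin => x fx _; rewrite fineK.
Qed.

Lemma cint_split m n (f : 'rV[R]_(m + n) -> R[i]) :
  cintegrable (leb R (m + n)) f ->
  cint (leb R (m + n)) f = cint (leb R m) (fun x => cint (leb R n) (fun y => f (row_mx x y))).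
Proof.
move=> jf; apply: complex_ext => /=.
  exact: (integral_split (cintegrable_Re jf)).
exact: (integral_split (cintegrable_Im jf)).
Qed.

End SplitComplex.

Lemma cRe_cint d (T : measurableType d) (R : realType)
    (mu : {measure set T -> \bar R}) (f : T -> R[i]) :
  complex.Re (cint mu f) = \int[mu]_x complex.Re (f x).
Proof. by []. Qed.

Lemma cIm_cint d (T : measurableType d) (R : realType)
    (mu : {measure set T -> \bar R}) (f : T -> R[i]) :
  complex.Im (cint mu f) = \int[mu]_x complex.Im (f x).
Proof. by []. Qed.

Section CisFourier.
Context {R : realType}.

Lemma mul_cisJ (a : R) : Complex (cos a) (sin a) * conjc (Complex (cos a) (sin a)) = 1.
Proof.
by rewrite mulrC mulJ /cabs /= cos2Dsin2 sqrtr1 expr1n.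
Qed.

Definition cis (a : R) : R[i] := Complex (cos a) (sin a).

Lemma cisD a b : cis (a + b) = cis a * cis b.
Proof. by apply: complex_ext; rewrite ?cReM ?cImM /= ?cosD ?sinD //; ring. Qed.

Lemma cisN a : cis (- a) = conjc (cis a).
Proof. by apply: complex_ext; rewrite /= ?cosN ?sinN. Qed.

Lemma cabs_cis a : cabs (cis a) = 1.
Proof. by rewrite /cabs /= cos2Dsin2 sqrtr1. Qed.

Lemma cmeas_cis d (T : measurableType d) (f : T -> R) :
  measurable_fun setT f -> cmeas (fun x => cis (f x)).
Proof. by move=> mf; split; [exact: measurable_cos_comp|exact: measurable_sin_comp]. Qed.

Variable n : nat.
Implicit Types (h : 'rV[R]_n -> R[i]) (B : R).

Lemma phaseC (eta t : 'rV[R]_n) : phase eta t = phase t eta.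
Proof.
rewrite /phase !dotpE; congr (_ * _); apply: eq_bigr => i _; exact: mulrC.
Qed.

Lemma phaseD (eta s t : 'rV[R]_n) : phase eta (s + t) = phase eta s + phase eta t.
Proof.
rewrite /phase -mulrDr !dotpE -big_split /=; congr (_ * _).
by apply: eq_bigr => i _; rewrite mxE mulrDl.
Qed.

Lemma phaseN (eta t : 'rV[R]_n) : phase eta (- t) = - phase eta t.
Proof.
rewrite /phase -mulrN !dotpE -sumrN; congr (_ * _).
by apply: eq_bigr => i _; rewrite mxE mulNr.
Qed.

Lemma phaseZ (eta t : 'rV[R]_n) c : phase eta (c *: t) = phase (c *: eta) t.
Proof.
rewrite /phase !dotpE; congr (_ * _).
by apply: eq_bigr => i _; rewrite !mxE; ring.
Qed.

Definition cdec w k B h : Prop :=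
  dec w k B (fun x => complex.Re (h x)) /\ dec w k B (fun x => complex.Im (h x)).

Definition ft h (eta : 'rV[R]_n) : R[i] :=
  cint (leb R n) (fun t => h t * conjc (cis (phase eta t))).

(** The reciprocal of [japw], hence integrable: the standard majorant in the dominated convergence
    and Fubini arguments below, both on R^d and on the phase space R^(d+d). *)
Definition rapid : 'rV[R]_n -> R := fun x => jap x `^ (- n.+1%:R).

Lemma rapid_ge0 x : 0 <= rapid x.
Proof. exact: powR_ge0. Qed.

Lemma rapid_le1 x : rapid x <= 1.
Proof.
rewrite /rapid powR_invn ?jap_ge0// invf_le1 ?exprn_gt0 ?jap_gt0//.
by rewrite exprn_ege1// jap_ge1.
Qed.

Lemma integrable_rapid c : (leb R n).-integrable setT (EFin \o (fun x => c * rapid x)).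
Proof. exact: integrable_japJ. Qed.

Lemma cdec_cmeas w k B h : cdec w k B h -> cmeas h.
Proof.
by move=> [hr hi]; split; apply: diff_measurable;
  [exact: dec_diff hr|exact: dec_diff hi].
Qed.

Lemma cdec_ge0 w k B h : (forall x, 0 <= w x) -> cdec w k B h -> 0 <= B.
Proof. by move=> w0 [hr _]; exact: dec_ge0 hr. Qed.

Lemma cdec_bound w k B h : (forall x, 0 <= w x) -> cdec w k B h ->
  forall x, w x * cabs (h x) <= 2 * B.
Proof.
move=> w0 [hr hi] x; apply: le_trans (ler_wpM2l (w0 x) (cabs_ReIm _)) _.
rewrite mulrDr mulr_natl mulr2n; apply: lerD; first exact: dec_bound hr x.
exact: dec_bound hi x.
Qed.

Lemma cdec_rapid k B h : cdec japw k B h -> forall x, cabs (h x) <= 2 * B * rapid x.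
Proof.
move=> hh x; have := cdec_bound japw_ge0 hh x.
rewrite /rapid powR_invn ?jap_ge0// ler_pdivlMr ?exprn_gt0 ?jap_gt0//.
by rewrite mulrC.
Qed.

Lemma cdec_integrable k B h : cdec japw k B h -> cintegrable (leb R n) h.
Proof.
move=> hh; apply: cintegrable_le (cdec_cmeas hh) (integrable_rapid (2 * B)) _.
exact: cdec_rapid hh.
Qed.

Lemma cmeas_phase (eta : 'rV[R]_n) : cmeas (fun t => cis (phase eta t)).
Proof. by apply: cmeas_cis; apply: measurable_phase; exact: measurable_id. Qed.

Lemma cintegrable_ft k B h eta : cdec japw k B h ->
  cintegrable (leb R n) (fun t => h t * conjc (cis (phase eta t))).
Proof.
move=> hh; apply: cintegrable_le _ (integrable_rapid (2 * B)) _.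
  exact: cmeasM (cdec_cmeas hh) (cmeasJ (cmeas_phase eta)).
by move=> x; rewrite cabsM cabsJ cabs_cis mulr1; exact: cdec_rapid hh x.
Qed.

Lemma ft_decay k : exists2 C, 0 <= C & forall B h eta, cdec japw k B h ->
  cabs (ft h eta) * jap eta ^+ k <= C * B.
Proof.
have [C C0 HC] := @fourCS_decay R n k.
exists (4 * C) => [|B h eta hh]; first by rewrite mulr_ge0.
have [hr hi] := hh; have [rC rS] := HC _ _ eta hr; have [iC iS] := HC _ _ eta hi.
have mp := measurable_phase eta (@measurable_id _ 'rV[R]_n setT).
have mC := measurable_cos_comp mp; have mS := measurable_sin_comp mp.
have bc x : `|cos (phase eta x)| <= 1 by exact: cos_max.
have bs x : `|sin (phase eta x)| <= 1 by exact: sin_max.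
have jt q (u : 'rV[R]_n -> R) : measurable_fun setT u -> (forall x, `|u x| <= 1) ->
    dec japw k B q -> (leb R n).-integrable setT (EFin \o (fun x => q x * u x)).
  move=> mu u1 hq; apply: (@japw_integrable _ _ _ B).
    exact: measurable_funM (diff_measurable (dec_diff hq)) mu.
  exact: trig_bound u1 (dec_bound hq).
have EI : ft h eta = Complex
   (fourC (fun x => complex.Re (h x)) eta + fourS (fun x => complex.Im (h x)) eta)
   (fourC (fun x => complex.Im (h x)) eta - fourS (fun x => complex.Re (h x)) eta).
  apply: complex_ext; rewrite /ft ?cRe_cint ?cIm_cint.
    rewrite [RHS]/= /fourC /fourS -RintegralD//; [|exact: jt|exact: jt].
    by apply: eq_Rintegral => x _; rewrite cReM /=; ring.
  rewrite [RHS]/= /fourC /fourS -RintegralB//; [|exact: jt|exact: jt].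
  by apply: eq_Rintegral => x _; rewrite cImM /=; ring.
rewrite EI; have J0 : 0 <= jap eta ^+ k by rewrite exprn_ge0// jap_ge0.
apply: le_trans (ler_wpM2r J0 (cabs_le _ _)) _.
apply: le_trans (ler_wpM2r J0 (lerD (ler_normD _ _) (ler_normB _ _))) _.
by rewrite !mulrDl; lra.
Qed.

Lemma cmeas_ft h : cmeas h -> cmeas (ft h).
Proof.
move=> mh; apply: (@cmeas_cint _ _ _ _ R (leb R n) (fun p => h p.2 * conjc (cis (phase p.1 p.2)))).
apply: cmeasM.
  split.
    exact: (measurableT_comp mh.1 (@measurable_snd _ _ _ _)).
  exact: (measurableT_comp mh.2 (@measurable_snd _ _ _ _)).
apply: cmeasJ; apply: cmeas_cis; apply: measurable_funM => //.
by apply: measurable_dotp; [exact: measurable_snd|exact: measurable_fst].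
Qed.

Lemma ft_rapid : exists2 C, 0 <= C & forall B h eta, cdec japw n.+1 B h ->
  cabs (ft h eta) <= C * B * rapid eta.
Proof.
have [C C0 HC] := ft_decay n.+1; exists C => // B h eta hh.
by rewrite /rapid powR_invn ?jap_ge0// ler_pdivlMr ?exprn_gt0 ?jap_gt0//; exact: HC.
Qed.

Lemma cintegrable_ftE B h : cdec japw n.+1 B h -> cintegrable (leb R n) (ft h).
Proof.
move=> hh; have [C C0 HC] := ft_rapid.
apply: cintegrable_le (cmeas_ft (cdec_cmeas hh)) (integrable_rapid (C * B)) _.
by move=> x; exact: HC.
Qed.

(** The inverse transform of [ft h] at the origin; inversion at other points follows by translating
    [h]. *)
Definition ftL h : R[i] := cint (leb R n) (ft h).

Lemma ft_shift B h x eta : cdec japw n.+1 B h ->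
  ft (fun t => h (t + x)) eta = cis (phase eta x) * ft h eta.
Proof.
move=> hh; have jh := cintegrable_ft eta hh.
rewrite /ft -cintZ//.
have jh2 := cintegrableZ (cis (phase eta x)) jh.
have [_ <-] := cint_leb_shift x jh2.
apply: eq_cint => t; rewrite phaseD cisD conjM.
by rewrite -[LHS]mulr1 -(mul_cisJ (phase eta x)) /cis; ring.
Qed.

End CisFourier.

#[global] Arguments cis : simpl never.

(** * Fourier inversion and Parseval's identity up to a constant *)

Section FourierInversion.
Context {R : realType} {n : nat}.
Implicit Types (h phi u v : 'rV[R]_n -> R[i]) (B : R).
Local Notation mu := (leb R n).

Lemma cdec_cabs_le k B h : cdec japw k B h -> forall x, cabs (h x) <= 2 * B.
Proof.
move=> hh x; apply: le_trans (cdec_rapid hh x) _.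
by rewrite ler_piMr ?rapid_le1// mulr_ge0// (cdec_ge0 japw_ge0 hh).
Qed.

Lemma cabs_ft_le u eta : cintegrable mu u ->
  cintegrable mu (fun t => u t * conjc (cis (phase eta t))) /\
  cabs (ft u eta) <= \int[mu]_x cabs (u x).
Proof.
move=> ju; have [mu' jau] := ju.
have E x : cabs (u x * conjc (cis (phase eta x))) = cabs (u x).
  by rewrite cabsM cabsJ cabs_cis mulr1.
have j : cintegrable mu (fun t => u t * conjc (cis (phase eta t))).
  split; first exact: cmeasM mu' (cmeasJ (cmeas_phase eta)).
  by under eq_fun do rewrite E.
split=> //; apply: le_trans (cabs_cint j) _.
by under eq_Rintegral do rewrite E.
Qed.

Lemma ft_mult u v : cintegrable mu u -> cintegrable mu v ->
  cint mu (fun eta => v eta * ft u eta) = cint mu (fun s => u s * ft v s).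
Proof.
move=> ju jv; have [mu' jau] := ju; have [mv jav] := jv.
pose F (p : 'rV[R]_n * 'rV[R]_n) := v p.1 * (u p.2 * conjc (cis (phase p.1 p.2))).
have mF : cmeas F.
  apply: cmeasM.
    split; first exact: (measurableT_comp mv.1 (@measurable_fst _ _ _ _)).
    exact: (measurableT_comp mv.2 (@measurable_fst _ _ _ _)).
  apply: cmeasM.
    split; first exact: (measurableT_comp mu'.1 (@measurable_snd _ _ _ _)).
    exact: (measurableT_comp mu'.2 (@measurable_snd _ _ _ _)).
  apply: cmeasJ; apply: cmeas_cis; apply: measurable_funM => //.
  by apply: measurable_dotp; [exact: measurable_snd|exact: measurable_fst].
have FB x y : cabs (F (x, y)) <= cabs (v x) * cabs (u y).
  by rewrite /F [cabs _]cabsM [X in _ * X]cabsM cabsJ cabs_cis mulr1.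
transitivity (cint mu (fun x => cint mu (fun y => F (x, y)))).
  by apply: eq_cint => x; rewrite -(cintZ _ (cabs_ft_le x ju).1).
rewrite (cint_fubini_dom mF jav jau FB); apply: eq_cint => s.
rewrite -(cintZ _ (cabs_ft_le s jv).1).
by apply: eq_cint => x; rewrite /F phaseC [_.1]/= [_.2]/=; ring.
Qed.

Lemma complex_expVK (e : R) : 0 < e -> Complex (e ^+ n) 0 * Complex (e^-1 ^+ n) 0 = 1.
Proof.
move=> e0; apply: complex_ext; rewrite ?cReM ?cImM /=; last by ring.
by rewrite mulr0 subr0 -exprMn mulfV ?expr1n// gt_eqF.
Qed.

(** The multiplication formula [ft_mult] applied to [phi] and to the dilate of [h]. The dilation
    ends up on the untransformed factor of either side, so both sides have a limit as [e] tends to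
    0. *)
Lemma ft_scale (e : R) h phi B1 B2 : 0 < e -> cdec japw n.+1 B1 h -> cdec japw n.+1 B2 phi ->
  cint mu (fun eta => ft h eta * phi (e *: eta)) =
  cint mu (fun s => h (e *: s) * ft phi s).
Proof.
move=> e0 hh hphi; have jh := cdec_integrable hh; have jphi := cdec_integrable hphi.
pose he t := h (e *: t).
have jhe : cintegrable mu he.
  have := (cint_leb_affine 0 e0 jh).1.
  by rewrite (_ : (fun x => h (e *: x + 0)) = he)//; apply/funext => x; rewrite addr0.
have ftE eta : ft h eta = Complex (e ^+ n) 0 * ft he (e *: eta).
  have [_ E] := cint_leb_affine 0 e0 (cabs_ft_le eta jh).1.
  have -> : ft he (e *: eta) =
      cint mu (fun x => h (e *: x + 0) * conjc (cis (phase eta (e *: x + 0)))).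
    by apply: eq_cint => t; rewrite addr0 /he phaseZ.
  by rewrite E mulrA complex_expVK// mul1r.
pose K eta := phi eta * ft he eta.
have jK : cintegrable mu K.
  have [mhe _] := jhe; have [mphi japhi] := jphi.
  pose M := \int[mu]_x cabs (he x).
  apply: (@cintegrable_le _ _ _ _ _ (fun x => M * cabs (phi x))).
  - exact: cmeasM mphi (cmeas_ft mhe).
  - exact: (integrableZl _ _ japhi).
  - by move=> x; rewrite cabsM mulrC ler_wpM2r ?cabs_ge0//; exact: (cabs_ft_le x jhe).2.
have -> : (fun eta => ft h eta * phi (e *: eta)) =
    (fun eta => Complex (e ^+ n) 0 * K (e *: eta + 0)).
  by apply/funext => eta; rewrite addr0 ftE /K; ring.
have [jK' EK] := cint_leb_affine 0 e0 jK.
rewrite (cintZ _ jK') EK mulrA (complex_expVK e0) mul1r.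
exact: ft_mult.
Qed.

Lemma cvg_scale0 (q : 'rV[R]_n -> R) x : (forall y, differentiable q y) ->
  (fun m : nat => q (m.+1%:R^-1 *: x)) @ \oo --> q 0.
Proof.
move=> dq; have c0 : {for (0 : 'rV[R]_n), continuous q} by exact: differentiable_continuous.
have c1 : (fun m : nat => (m.+1%:R : R)^-1 *: x) @ \oo --> (0 : 'rV[R]_n).
  rewrite -(scale0r x); apply: cvgZr_tmp.
  exact: cvg_harmonic.
exact: (cvg_comp _ _ c1 c0).
Qed.

(** The limit of [ft_scale] as the dilation tends to 0, by dominated convergence. It says that the
    ratio of [ftL h] to [h 0] does not depend on [h], which is inversion at the origin up to a
    constant. *)
Lemma ftL_cross h phi B1 B2 : cdec japw n.+1 B1 h -> cdec japw n.+1 B2 phi ->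
  phi 0 * ftL h = h 0 * ftL phi.
Proof.
move=> hh hphi; have [C C0 HC] := @ft_rapid R n.
pose e m : R := m.+1%:R^-1.
have e0 m : 0 < e m by rewrite invr_gt0.
have lim h1 h2 A1 A2 : cdec japw n.+1 A1 h1 -> cdec japw n.+1 A2 h2 ->
    (fun m => complex.Re (cint mu (fun eta => ft h1 eta * h2 (e m *: eta)))) @ \oo -->
       complex.Re (h2 0 * ftL h1) /\
    (fun m => complex.Im (cint mu (fun eta => ft h1 eta * h2 (e m *: eta)))) @ \oo -->
       complex.Im (h2 0 * ftL h1).
  move=> d1 d2; rewrite /ftL -cintZ; last exact: cintegrable_ftE d1.
  under [in X in _ @ _ --> X /\ _]eq_cint do rewrite mulrC.
  under [in X in _ /\ _ @ _ --> X]eq_cint do rewrite mulrC.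
  have [h2r h2i] := d2; have m2 := cdec_cmeas d2.
  have m1 := cmeas_ft (cdec_cmeas d1).
  apply: (@cint_dct _ _ _ _ _ _ (fun x => 2 * A2 * (C * A1) * rapid x)).
  - move=> m; apply: cmeasM => //; have ms : measurable_fun setT (fun x : 'rV[R]_n => e m *: x).
      by apply: measurable_scalerV; exact: measurable_id.
    by split; [exact: (measurableT_comp m2.1 ms)|exact: (measurableT_comp m2.2 ms)].
  - by apply: cmeasM m1 _; exact: cmeas_cst.
  - exact: integrable_rapid.
  - move=> m x; rewrite cabsM -mulrA mulrC ler_pM ?cabs_ge0//.
      exact: cdec_cabs_le d2 _.
    exact: HC.
  - move=> x; have cr := cvg_scale0 x (dec_diff h2r); have ci := cvg_scale0 x (dec_diff h2i).
    under eq_fun do rewrite cReM; rewrite cReM.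
    by apply: cvgB; apply: cvgM => //; exact: cvg_cst.
  - move=> x; have cr := cvg_scale0 x (dec_diff h2r); have ci := cvg_scale0 x (dec_diff h2i).
    under eq_fun do rewrite cImM; rewrite cImM.
    by apply: cvgD; apply: cvgM => //; exact: cvg_cst.
have [r1 i1] := lim _ _ _ _ hh hphi; have [r2 i2] := lim _ _ _ _ hphi hh.
have E m : cint mu (fun eta => ft h eta * phi (e m *: eta)) =
           cint mu (fun eta => ft phi eta * h (e m *: eta)).
  by rewrite (ft_scale (e0 m) hh hphi); apply: eq_cint => x; rewrite mulrC.
have r3 : (fun m => complex.Re (cint mu (fun eta => ft phi eta * h (e m *: eta)))) @ \oo -->
    complex.Re (phi 0 * ftL h) by move: r1; under eq_fun do rewrite E.
have i3 : (fun m => complex.Im (cint mu (fun eta => ft phi eta * h (e m *: eta)))) @ \oo -->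
    complex.Im (phi 0 * ftL h) by move: i1; under eq_fun do rewrite E.
by apply: complex_ext; [exact: (cvg_unique _ r3 r2)|exact: (cvg_unique _ i3 i2)].
Qed.

Lemma cdec_shift_japw k B h a : cdec japw k B h ->
  cdec japw k ((2 * jap a) ^+ n.+1 * B) (fun t => h (t - a)).
Proof.
move=> [hr hi].
have c0 : 0 <= (2 * jap a) ^+ n.+1 by rewrite exprn_ge0// mulr_ge0// jap_ge0.
have ww (x : 'rV[R]_n) : japw x <= (2 * jap a) ^+ n.+1 * japw (x - a).
  by rewrite /japw -exprMn lerXn2r ?nnegrE ?mulr_ge0 ?jap_ge0//; exact: jap_shift.
by split; [exact: dec_weight c0 ww (dec_shift a hr)|exact: dec_weight c0 ww (dec_shift a hi)].
Qed.

Variables (phi0 : 'rV[R]_n -> R[i]) (B0 : R).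
Hypothesis dphi0 : cdec japw n.+1 B0 phi0.
Hypothesis phi00 : phi0 0 != 0.

(** The common ratio of [ftL_cross], read off the reference function [phi0]. *)
Definition kappa : R[i] := ftL phi0 / phi0 0.

Lemma ftL_kappa h B : cdec japw n.+1 B h -> ftL h = kappa * h 0.
Proof.
move=> hh; rewrite /kappa mulrAC; apply: (mulfI phi00).
by rewrite (ftL_cross hh dphi0) mulrCA mulfV// mulr1 mulrC.
Qed.

Lemma ft_inversion h B x : cdec japw n.+1 B h ->
  cint mu (fun eta => ft h eta * cis (phase eta x)) = kappa * h x.
Proof.
move=> hh; have := ftL_kappa (cdec_shift_japw (- x) hh).
rewrite opprK add0r => <-; rewrite /ftL; apply: eq_cint => eta.
by rewrite (ft_shift _ _ hh) mulrC.
Qed.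

(** Fubini moves the exponential of the conjugate transform of [h2] onto [ft h1], where the
    inversion formula applies. *)
Lemma ft_parseval h1 h2 B1 B2 : cdec japw n.+1 B1 h1 -> cdec japw n.+1 B2 h2 ->
  cint mu (fun eta => ft h1 eta * conjc (ft h2 eta)) =
  kappa * cint mu (fun t => h1 t * conjc (h2 t)).
Proof.
move=> d1 d2; have j1 := cdec_integrable d1; have j2 := cdec_integrable d2.
have jf1 := cintegrable_ftE d1; have [mf1 jaf1] := jf1; have [m2 ja2] := j2.
have [m1 ja1] := j1.
have EJ eta : conjc (ft h2 eta) = cint mu (fun t => conjc (h2 t) * cis (phase eta t)).
  rewrite /ft -cintJ; last exact: (cabs_ft_le eta j2).1.
  by apply: eq_cint => t; rewrite conjM conjJ.
have jJ eta : cintegrable mu (fun t => conjc (h2 t) * cis (phase eta t)).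
  have := cintegrableJ (cabs_ft_le eta j2).1.
  by under eq_fun do rewrite conjM conjJ.
pose F (p : 'rV[R]_n * 'rV[R]_n) :=
  ft h1 p.1 * (conjc (h2 p.2) * cis (phase p.1 p.2)).
have mF : cmeas F.
  apply: cmeasM.
    split; first exact: (measurableT_comp mf1.1 (@measurable_fst _ _ _ _)).
    exact: (measurableT_comp mf1.2 (@measurable_fst _ _ _ _)).
  apply: cmeasM.
    apply: cmeasJ; split; first exact: (measurableT_comp m2.1 (@measurable_snd _ _ _ _)).
    exact: (measurableT_comp m2.2 (@measurable_snd _ _ _ _)).
  apply: cmeas_cis; apply: measurable_funM => //.
  by apply: measurable_dotp; [exact: measurable_snd|exact: measurable_fst].
have FB x y : cabs (F (x, y)) <= cabs (ft h1 x) * cabs (h2 y).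
  by rewrite /F /= !cabsM cabsJ cabs_cis mulr1.
transitivity (cint mu (fun x => cint mu (fun y => F (x, y)))).
  by apply: eq_cint => x; rewrite EJ -(cintZ _ (jJ x)).
rewrite (cint_fubini_dom mF jaf1 ja2 FB) -cintZ; last first.
  apply: (@cintegrable_le _ _ _ _ _ (fun x => 2 * B1 * cabs (h2 x))).
  - exact: cmeasM m1 (cmeasJ m2).
  - exact: (integrableZl _ _ ja2).
  - move=> x; rewrite cabsM cabsJ ler_wpM2r ?cabs_ge0//.
    exact: cdec_cabs_le d1 x.
apply: eq_cint => t; rewrite /F /= mulrA -(ft_inversion t d1) mulrC -cintZ.
  by apply: eq_cint => x; ring.
split.
  exact: cmeasM mf1 (cmeas_cis (measurable_funM (@measurable_cst _ _ _ _ setT _)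
     (measurable_dotp (@measurable_cst _ _ _ _ setT t) (@measurable_id _ _ setT)))).
by under eq_fun do rewrite cabsM cabs_cis mulr1.
Qed.

End FourierInversion.

(** * Schwartz seminorms and time-frequency shifts *)

Section SchwartzSeminorms.
Context {R : realType} {n : nat}.
Implicit Types (f g w h : 'rV[R]_n -> R[i]) (B C : R) (N : nat).

Lemma cdec_leq (v : 'rV[R]_n -> R) k l B f : (l <= k)%N -> cdec v k B f -> cdec v l B f.
Proof. by move=> lk [fr fi]; split; exact: dec_leq lk _. Qed.

Lemma cdec_mono (v : 'rV[R]_n -> R) k A B f : A <= B -> cdec v k A f -> cdec v k B f.
Proof. by move=> AB [fr fi]; split; exact: dec_mono AB _. Qed.

Lemma cdec_weight (v v' : 'rV[R]_n -> R) k c B f : 0 <= c ->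
  (forall x, v' x <= c * v x) -> cdec v k B f -> cdec v' k (c * B) f.
Proof. by move=> c0 vv [fr fi]; split; exact: dec_weight c0 vv _. Qed.

Lemma cdecM (v v' : 'rV[R]_n -> R) k A B f g :
  (forall x, 0 <= v x) -> (forall x, 0 <= v' x) -> cdec v k A f -> cdec v' k B g ->
  cdec (v \* v') k (2 * (2 ^+ k * (A * B))) (fun x => f x * g x).
Proof.
move=> v0 v'0 [fr fi] [gr gi].
have vv0 x : 0 <= (v \* v') x by exact: mulr_ge0.
rewrite mulr_natl mulr2n; split.
  rewrite (_ : (fun x => _) = (fun x => complex.Re (f x)) \* (fun x => complex.Re (g x)) \+
     (fun x => -1 * ((fun x => complex.Im (f x)) \* (fun x => complex.Im (g x))) x)).
    apply: (decD vv0); first exact: decM.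
    by rewrite -[X in dec _ _ X](mul1r) -{1}(normrN1 R); apply: decZ; exact: decM.
  by apply/funext => x; rewrite cReM /=; ring.
rewrite (_ : (fun x => _) = (fun x => complex.Re (f x)) \* (fun x => complex.Im (g x)) \+
     (fun x => complex.Im (f x)) \* (fun x => complex.Re (g x))).
  by apply: (decD vv0); exact: decM.
by apply/funext => x; rewrite cImM.
Qed.

Lemma cdecJ (v : 'rV[R]_n -> R) k B f : cdec v k B f -> cdec v k B (fun x => conjc (f x)).
Proof.
move=> [fr fi]; split.
  by under eq_fun do rewrite cReJ.
rewrite (_ : (fun x => _) = fun x => -1 * complex.Im (f x)).
  by have := decZ (-1) fi; rewrite normrN1 mul1r.
by apply/funext => x; rewrite cImJ mulN1r.
Qed.

Lemma cdecD (v : 'rV[R]_n -> R) k A B f g : (forall x, 0 <= v x) ->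
  cdec v k A f -> cdec v k B g -> cdec v k (A + B) (fun x => f x + g x).
Proof.
move=> v0 [fr fi] [gr gi]; split.
  by under eq_fun do rewrite cReD; exact: (decD v0).
by under eq_fun do rewrite cImD; exact: (decD v0).
Qed.

Lemma cdec_shift (v : 'rV[R]_n -> R) k B f a : cdec v k B f ->
  cdec (fun x => v (x - a)) k B (fun x => f (x - a)).
Proof. by move=> [fr fi]; split; [exact: (dec_shift a fr)|exact: (dec_shift a fi)]. Qed.

Lemma cdecZ (v : 'rV[R]_n -> R) k B f (c : R[i]) : (forall x, 0 <= v x) ->
  cdec v k B f -> cdec v k (2 * cabs c * B) (fun x => c * f x).
Proof.
move=> v0 hf; have B0 := cdec_ge0 v0 hf; have [fr fi] := hf.
have := norm_Re c; have := norm_Im c => ci cr.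
have E : `|complex.Re c| * B + `|complex.Im c| * B <= 2 * cabs c * B.
  by rewrite -mulrDl ler_wpM2r//; lra.
split; apply: dec_mono E _.
  rewrite (_ : (fun x => _) = (fun x => complex.Re c * complex.Re (f x)) \+
     (fun x => (- complex.Im c) * complex.Im (f x))).
    by rewrite -(normrN (complex.Im c)); apply: (decD v0); exact: decZ.
  by apply/funext => x; rewrite cReM /=; ring.
rewrite addrC (_ : (fun x => _) = (fun x => complex.Im c * complex.Re (f x)) \+
     (fun x => complex.Re c * complex.Im (f x))).
  by apply: (decD v0); exact: decZ.
by apply/funext => x; rewrite cImM /=; ring.
Qed.

Lemma cdec_sum (v : 'rV[R]_n -> R) k (I : Type) (r : seq I) (B : I -> R)
    (F : I -> 'rV[R]_n -> R[i]) : (forall x, 0 <= v x) ->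
  (forall i, cdec v k (B i) (F i)) ->
  cdec v k (\sum_(i <- r) B i) (fun x => \sum_(i <- r) F i x).
Proof.
move=> v0 dF; split.
  rewrite (_ : (fun x => _) = fun x => \sum_(i <- r) complex.Re (F i x)).
    by apply: dec_sum => // i; exact: (dF i).1.
  by apply/funext => x; rewrite cRe_sum.
rewrite (_ : (fun x => _) = fun x => \sum_(i <- r) complex.Im (F i x)).
  by apply: dec_sum => // i; exact: (dF i).2.
by apply/funext => x; rewrite cIm_sum.
Qed.

Definition japX N : 'rV[R]_n -> R := fun x => jap x ^+ N.

Lemma japX_ge0 N x : 0 <= japX N x.
Proof. by rewrite exprn_ge0// jap_ge0. Qed.

(** Equivalent to a bound on [seminorm N], up to a factor 2 from splitting into real and imaginary
    parts ([seminorm_le_sdec], [sdec_seminorm]), and open to the calculus of [dec] for sums,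
    products and shifts. *)
Definition sdec N B f := cdec (japX N) N B f.

Lemma sdec_ge0 N B f : sdec N B f -> 0 <= B.
Proof. exact: cdec_ge0 (japX_ge0 N). Qed.

Lemma sdec_cdec N k m B f : (k <= N)%N -> (m <= N)%N -> sdec N B f -> cdec (japX m) k B f.
Proof.
move=> kN mN /(cdec_leq kN) hf; rewrite -[B]mul1r; apply: cdec_weight hf => // x.
by rewrite mul1r ler_weXn2l// jap_ge1.
Qed.

Lemma schwartz_sdec N (f : schwartz R n) : exists2 B, 0 <= B & sdec N B f.
Proof.
have /asboolP/is_schwartzP/(_ N N)[/decays_dec[A hA] /decays_dec[B hB]] := schwartz_funP f.
have A0 := dec_ge0 (japX_ge0 N) hA; have B0 := dec_ge0 (japX_ge0 N) hB.
exists (A + B); first exact: addr_ge0.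
by split; [apply: dec_mono hA; rewrite lerDl|apply: dec_mono hB; rewrite lerDr].
Qed.

Lemma seminorm_le_sdec N B (f : schwartz R n) : sdec N B f -> (seminorm N f <= (2 * B)%:E)%E.
Proof.
move=> [fr fi]; apply: ge_ereal_sup => _ [x [s [sN ->]]]; rewrite lee_fin.
apply: le_trans (ler_wpM2l (japX_ge0 N x) (cabs_ReIm _)) _.
rewrite mulrDr mulr_natl mulr2n; apply: lerD.
  exact: (dec_partial fr sN).2.
exact: (dec_partial fi sN).2.
Qed.

Lemma seminorm_fin N (f : schwartz R n) : seminorm N f \is a fin_num.
Proof.
have [B _ hB] := schwartz_sdec N f.
by rewrite ge0_fin_numE ?seminorm_ge0// (le_lt_trans (seminorm_le_sdec hB))// ltry.
Qed.

Lemma sdec_seminorm N (f : schwartz R n) : sdec N (fine (seminorm N f)) f.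
Proof.
have /asboolP[[sr si] _] := schwartz_funP f.
have H s x : (size s <= N)%N -> japX N x * cabs (cpartial s f x) <= fine (seminorm N f).
  move=> sN; rewrite -lee_fin fineK ?seminorm_fin//.
  by apply: ereal_sup_ubound; exists x, s.
split; apply: partial_dec => s x; [exact: sr|move=> sN|exact: si|move=> sN];
  apply: le_trans (H s x sN); rewrite ler_wpM2l ?japX_ge0//.
  exact: (norm_Re (cpartial s f x)).
exact: (norm_Im (cpartial s f x)).
Qed.

Lemma tempered_sdec (u : schwartz R n -> R[i]) : is_tempered u ->
  exists N, exists2 C, 0 <= C & forall (f : schwartz R n) B, sdec N B f -> cabs (u f) <= C * B.
Proof.
move=> [_ [N [C [C0 HC]]]]; exists N; exists (2 * C); first exact: mulr_ge0.
move=> f B hf; rewrite -lee_fin (le_trans (HC f))// mulrAC mulrC EFinM.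
rewrite lee_wpmul2l ?lee_fin//; exact: seminorm_le_sdec.
Qed.

Lemma sdec_tempered (u : schwartz R n -> R[i]) N C : 0 <= C ->
  (forall (a : R[i]) (f g : schwartz R n), u (a *: f + g) = conjc a * u f + u g) ->
  (forall (f : schwartz R n) B, sdec N B f -> cabs (u f) <= C * B) ->
  u \in @tempered_pred R n.
Proof.
move=> C0 ul HC; apply/asboolP; split=> //; exists N, C; split=> // f.
rewrite -(fineK (seminorm_fin N f)) -EFinM lee_fin.
exact/HC/sdec_seminorm.
Qed.

End SchwartzSeminorms.

Section TimeFrequency.
Context {R : realType} {d : nat}.
Implicit Types (f w : 'rV[R]_d -> R[i]) (B C : R) (N : nat) (z : 'rV[R]_(d + d)).

Lemma tfshift_funE z w t :
  tfshift_fun z w t = cis (phase (rsubmx z) t) * w (t - lsubmx z).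
Proof. by []. Qed.

(** Translation costs [<z>^N] through the weight, by Peetre's inequality; modulation costs another
    [<z>^N] through the derivatives of the exponential. *)
Lemma sdec_tfshift N : exists2 C, 0 <= C & forall w B z, sdec N B w ->
  sdec N (C * jap z ^+ (N + N) * B) (tfshift_fun z w).
Proof.
have P0 := pi_ge0 R.
pose P : R := 1 + 2 * pi.
exists (2 ^+ N * (2 * (2 ^+ N * P ^+ N))).
  by rewrite !mulr_ge0 ?exprn_ge0// /P; lra.
move=> w B z hw; have B0 := sdec_ge0 hw.
have hc : cdec (fun=> 1) N ((1 + 2 * pi * jap (rsubmx z)) ^+ N) (fun t => cis (phase (rsubmx z) t)).
  have [] := @dec_trig R d N (rsubmx z) 1 ler01; rewrite mul1r => h1 h2; split.
    by move: h1; congr dec; apply/funext => t; rewrite mul1r.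
  by move: h2; congr dec; apply/funext => t; rewrite mul1r.
have := cdecM (fun=> ler01) (fun x => japX_ge0 N (x - lsubmx z)) hc (cdec_shift (lsubmx z) hw).
have c0 : 0 <= (2 * jap (lsubmx z)) ^+ N by rewrite exprn_ge0// mulr_ge0// jap_ge0.
move/(@cdec_weight _ _ _ (japX N) _ _ _ _ c0) => H.
have lez m (A : 'rV[R]_m) (y : 'rV[R]_(d + d)) : dotp A A <= dotp y y -> jap A <= jap y.
  move=> Ay; rewrite -ler_sqr ?nnegrE ?jap_ge0// !sqr_jap; lra.
have dz : dotp z z = dotp (lsubmx z) (lsubmx z) + dotp (rsubmx z) (rsubmx z).
  rewrite !dotpE big_split_ord /=; congr (_ + _); apply: eq_bigr => i _; by rewrite !mxE.
have l1 : jap (lsubmx z) <= jap z by apply: lez; rewrite dz lerDl dotp_ge0.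
have l2 : jap (rsubmx z) <= jap z by apply: lez; rewrite dz lerDr dotp_ge0.
have {H} : sdec N ((2 * jap (lsubmx z)) ^+ N *
    (2 * (2 ^+ N * ((1 + 2 * pi * jap (rsubmx z)) ^+ N * B)))) (fun x => cis (phase (rsubmx z) x) * w (x - lsubmx z)).
  apply: H => x; rewrite /japX /= mul1r -exprMn lerXn2r ?nnegrE ?mulr_ge0 ?jap_ge0//.
  exact: jap_shift.
apply: cdec_mono; rewrite exprD.
have J := @jap_ge1 R _ z.
have I1 : jap (lsubmx z) ^+ N <= jap z ^+ N by rewrite lerXn2r ?nnegrE ?jap_ge0.
have I2 : (1 + 2 * pi * jap (rsubmx z)) ^+ N <= P ^+ N * jap z ^+ N.
  rewrite -exprMn lerXn2r ?nnegrE ?addr_ge0 ?mulr_ge0 ?jap_ge0// /P.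
    by rewrite addr_ge0// mulr_ge0.
  have : 2 * pi * jap (rsubmx z) <= 2 * pi * jap z by rewrite ler_wpM2l ?mulr_ge0.
  lra.
rewrite exprMn.
have p2 : 0 <= 2 ^+ N :> R by rewrite exprn_ge0.
rewrite (_ : _ * _ = 2 ^+ N * (2 * 2 ^+ N) * (jap (lsubmx z) ^+ N * (1 + 2 * pi * jap (rsubmx z)) ^+ N) * B); last by ring.
rewrite [leRHS](_ : _ = 2 ^+ N * (2 * 2 ^+ N) * (jap z ^+ N * (P ^+ N * jap z ^+ N)) * B); last by ring.
rewrite ler_wpM2r// ler_wpM2l ?mulr_ge0// ler_pM ?exprn_ge0 ?jap_ge0//.
by rewrite addr_ge0// !mulr_ge0// jap_ge0.
Qed.

Lemma innerE f w z : inner f (tfshift_fun z w) =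
  ft (fun t => f t * conjc (w (t - lsubmx z))) (rsubmx z).
Proof.
by apply: eq_cint => t; rewrite tfshift_funE conjM; ring.
Qed.

(** Peetre's inequality gives [1 <= (2 / <x>)^k <t>^k <t - x>^k]: the weights of order [k] on [f]
    and on [w] buy the decay [<x>^(-k)], and the weight of order [m] is kept. *)
Lemma cdec_window m k C B f w x : sdec (k + m) C f -> sdec (k + m) B w ->
  cdec (japX m) k ((2 / jap x) ^+ k * (2 * (2 ^+ k * (C * B))))
    (fun t => f t * conjc (w (t - x))).
Proof.
move=> hf hw.
have hf' : cdec (japX (k + m)) k C f := cdec_leq (leq_addr _ _) hf.
have hw' : cdec (japX k) k B (fun t => conjc (w t)).
  by apply/cdecJ/(sdec_cdec _ _ hw); exact: leq_addr.
have := cdecM (japX_ge0 (k + m)) (fun t => japX_ge0 k (t - x)) hf' (cdec_shift x hw').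
apply: cdec_weight; first by rewrite exprn_ge0// divr_ge0// jap_ge0.
move=> t; rewrite /japX /= exprD.
rewrite (_ : (2 / jap x) ^+ k * (jap t ^+ k * jap t ^+ m * jap (t - x) ^+ k) =
  (2 / jap x * jap t * jap (t - x)) ^+ k * jap t ^+ m); last first.
  by rewrite !exprMn; ring.
rewrite ler_peMl ?exprn_ge0 ?jap_ge0// exprn_ege1//.
rewrite (_ : 2 / jap x * _ * _ = 2 * jap t * jap (x - t) / jap x); last by rewrite japBC; ring.
by rewrite ler_pdivlMr ?jap_gt0// mul1r jap_shift.
Qed.

(** Decay in frequency comes from the smoothness of the windowed function ([ft_decay]), decay in
    position from [cdec_window], and [<z> <= <x> <eta>] joins them. Of the order [M + d.+1], [M] is
    spent on decay and [d.+1] on integrability. *)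
Lemma inner_tfshift_decay M (w : schwartz R d) : exists2 C, 0 <= C & forall f B z,
  sdec (M + d.+1) B f -> cabs (inner f (tfshift_fun z w)) * jap z ^+ M <= C * B.
Proof.
have [C0 C00 HC] := @ft_decay R d M.
have [W W0 hW] := schwartz_sdec (M + d.+1) w.
exists (C0 * (2 ^+ M * (2 * (2 ^+ M * W)))) => [|f B z hf].
  by rewrite !mulr_ge0 ?exprn_ge0.
rewrite innerE; set x := lsubmx z; set h := (fun t => _).
have := HC _ _ (rsubmx z) (cdec_window x hf hW).
have Jx := @jap_gt0 R _ x; have J0 := exprn_gt0 M Jx.
have -> : (2 / jap x) ^+ M = 2 ^+ M / jap x ^+ M by rewrite exprMn exprVn.
rewrite -(ler_pM2r J0).
have -> : C0 * (2 ^+ M / jap x ^+ M * (2 * (2 ^+ M * (B * W)))) * jap x ^+ M =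
   C0 * (2 ^+ M * (2 * (2 ^+ M * W))) * B.
  by rewrite -[LHS]mulr1 -(mulfV (lt0r_neq0 J0)); field; exact: lt0r_neq0.
apply: le_trans; rewrite -mulrA ler_wpM2l ?cabs_ge0// -exprMn.
rewrite lerXn2r ?nnegrE ?mulr_ge0 ?jap_ge0//.
by rewrite mulrC -{1}(hsubmxK z) jap_row_mx.
Qed.

Lemma tfshiftD z z' w t :
  tfshift_fun z (tfshift_fun z' w) t =
  conjc (cis (phase (rsubmx z') (lsubmx z))) * tfshift_fun (z + z') w t.
Proof.
have El : lsubmx (z + z') = lsubmx z + lsubmx z' by rewrite linearD.
have Er : rsubmx (z + z') = rsubmx z + rsubmx z' by rewrite linearD.
rewrite !tfshift_funE El Er (phaseC (_ + _) t) !phaseD !cisD !(phaseC t) phaseN cisN.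
by rewrite opprD addrA; ring.
Qed.

Lemma inner_shift f w x : cintegrable (leb R d) (fun t => f t * conjc (w t)) ->
  inner (fun t => f (t - x)) (fun t => w (t - x)) = inner f w.
Proof. by move=> j; exact: (cint_leb_shift (- x) j).2. Qed.

Lemma inner_tfshift2 f w z : cintegrable (leb R d) (fun t => f t * conjc (w t)) ->
  inner (tfshift_fun z f) (tfshift_fun z w) = inner f w.
Proof.
move=> j; rewrite -(inner_shift (lsubmx z) j); apply: eq_cint => t.
by rewrite !tfshift_funE conjM mulrACA [_ * conjc (cis _)]mulrC mulJ cabs_cis expr1n mul1r.
Qed.

Lemma schwartz_cintegrable (f : schwartz R d) : cintegrable (leb R d) f.
Proof. by have [B _ hB] := schwartz_sdec d.+1 f; exact: cdec_integrable hB. Qed.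

Lemma schwartz_cmeas (f : schwartz R d) : cmeas f.
Proof. by have [] := schwartz_cintegrable f. Qed.

Lemma schwartz_bounded (f : schwartz R d) : exists2 B, 0 <= B & forall x, cabs (f x) <= B.
Proof.
have [B B0 hB] := schwartz_sdec d.+1 f; exists (2 * B); first exact: mulr_ge0.
exact: cdec_cabs_le hB.
Qed.

Lemma schwartz_innerI (f w : schwartz R d) : cintegrable (leb R d) (fun t => f t * conjc (w t)).
Proof.
have [B B0 HB] := schwartz_bounded w; have [mf jf] := schwartz_cintegrable f.
apply: (@cintegrable_le _ _ _ _ _ (fun t => B * cabs (f t))).
- exact: cmeasM mf (cmeasJ (schwartz_cmeas w)).
- exact: (integrableZl _ _ jf).
- by move=> x; rewrite cabsM cabsJ mulrC ler_wpM2r ?cabs_ge0.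
Qed.

(** Time-frequency shifts are unitary and compose up to a phase, so the modulus depends on [z' - z]
    only. *)
Lemma cabs_inner_tfshift (f w : schwartz R d) z z' :
  cabs (inner (tfshift z f) (tfshift z' w)) =
  cabs (inner f (tfshift (z' - z) w)).
Proof.
rewrite -(inner_tfshift2 z (schwartz_innerI f (tfshift (z' - z) w))).
set c := conjc (cis (phase (rsubmx (z' - z)) (lsubmx z))).
have E t : conjc (tfshift_fun z (tfshift (z' - z) w) t) = conjc c * conjc (tfshift z' w t).
  by rewrite (tfshiftD z (z' - z) w t) conjM [z + _]addrC subrK.
have -> : inner (tfshift_fun z f) (tfshift_fun z (tfshift (z' - z) w)) =
    conjc c * inner (tfshift z f) (tfshift z' w).
  rewrite -[RHS](cintZ _ (schwartz_innerI (tfshift z f) (tfshift z' w))).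
  by apply: eq_cint => t; rewrite E; exact: mulrCA.
by rewrite cabsM !cabsJ cabs_cis mul1r.
Qed.

Lemma innerJ (f w : schwartz R d) : inner w f = conjc (inner f w).
Proof.
rewrite /inner [cintegral]lock -lock -cintJ; last exact: schwartz_innerI.
by apply: eq_cint => t; rewrite conjM conjJ mulrC.
Qed.

End TimeFrequency.

(** * Moyal's identity *)

Section FourierConstant.
Context {R : realType} {n : nat}.
Implicit Types (h : 'rV[R]_n -> R[i]) (B : R).

Lemma mvt_bound (f : 'rV[R]_n -> R) x v (K : 'I_n -> R) :
  (forall y, differentiable f y) -> (forall i y, `|'D_'e_i f y| <= K i) ->
  `|f (x + v) - f x| <= \sum_i `|v 0 i| * K i.
Proof.
move=> df fK; have [t _ ->] := mvt_dir x v df.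
rewrite derive_coord//; apply: le_trans (ler_norm_sum _ _ _) _.
by apply: ler_sum => i _; rewrite normrM ler_wpM2l.
Qed.

Lemma phase0r (eta : 'rV[R]_n) : phase eta 0 = 0.
Proof. by rewrite -(subrr 0) phaseD phaseN subrr. Qed.

Lemma phase0l (t : 'rV[R]_n) : phase 0 t = 0.
Proof. by rewrite phaseC phase0r. Qed.

Lemma cis0 : cis 0 = 1 :> R[i].
Proof. by rewrite /cis cos0 sin0. Qed.

Lemma cis_phase_sub1 (eta t : 'rV[R]_n) (M : R) : (forall i, `|eta 0 i| <= M) ->
  0 <= M -> cabs (cis (phase eta t) - 1) <= 4 * pi * n%:R * jap t * M.
Proof.
move=> e0 M0; have P0 := pi_ge0 R.
have d1 x : differentiable (fun t => cos (phase eta t)) x.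
  apply: (@differentiable_comp _ _ _ _ (phase eta) cos); first exact: phase_diff.
  exact/derivable1_diffP.
have d2 x : differentiable (fun t => sin (phase eta t)) x.
  apply: (@differentiable_comp _ _ _ _ (phase eta) sin); first exact: phase_diff.
  exact/derivable1_diffP.
have S : \sum_i `|t 0 i| * (2 * pi * M) <= 2 * pi * n%:R * jap t * M.
  apply: (@le_trans _ _ (\sum_(i < n) jap t * (2 * pi * M))).
    by apply: ler_sum => i _; rewrite ler_wpM2r ?coord_le_jap// !mulr_ge0.
  by rewrite sumr_const card_ord -[leLHS]mulr_natl [leLHS](_ : _ = 2 * pi * n%:R * jap t * M)//; ring.
have npe i : `|2 * pi * eta 0 i| <= 2 * pi * M.
  by rewrite normrM ger0_norm ?mulr_ge0// ler_wpM2l ?mulr_ge0.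
apply: le_trans (cabs_ReIm _) _.
rewrite [leRHS](_ : _ = 2 * pi * n%:R * jap t * M + 2 * pi * n%:R * jap t * M); last by ring.
have Re1 : complex.Re (1 : R[i]) = 1 by [].
have Im1 : complex.Im (1 : R[i]) = 0 by [].
apply: lerD; apply: le_trans S.
  rewrite cReD cReN Re1.
  have := @mvt_bound _ 0 t (fun=> 2 * pi * M) d1; rewrite add0r phase0r cos0; apply=> i y.
  rewrite derive_cos_phase normrM normrN -[leRHS]mulr1.
  by rewrite ler_pM// ?sin_max.
rewrite cImD cImN Im1.
have := @mvt_bound _ 0 t (fun=> 2 * pi * M) d2; rewrite add0r phase0r sin0 !subr0; apply=> i y.
rewrite derive_sin_phase normrM -[leRHS]mulr1.
by rewrite ler_pM// ?cos_max.
Qed.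

Lemma ft0 h : ft h 0 = cint (leb R n) h.
Proof.
by apply: eq_cint => t; rewrite phase0l cis0 rmorph1 mulr1.
Qed.

(** One power of the weight beyond integrability absorbs the factor [jap t] of [cis_phase_sub1]. *)
Lemma ft_lipschitz0 h k B : cdec (japX n.+2) k B h -> exists K, forall (eta : 'rV[R]_n) (M : R),
  (forall i, `|eta 0 i| <= M) -> 0 <= M -> cabs (ft h eta - ft h 0) <= K * M.
Proof.
move=> hh.
have hh1 : cdec japw k B h.
  rewrite -[B]mul1r; apply: cdec_weight hh => // x.
  by rewrite mul1r /japw /japX ler_weXn2l// jap_ge1.
have B0 : 0 <= B := cdec_ge0 (japX_ge0 _) hh.
have hb x : jap x * cabs (h x) <= 2 * B * rapid x.
  have := cdec_bound (japX_ge0 n.+2) hh x; rewrite /japX exprS mulrAC.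
  by rewrite /rapid powR_invn ?jap_ge0// ler_pdivlMr ?exprn_gt0 ?jap_gt0//.
pose c : R := 4 * pi * n%:R.
exists (\int[leb R n]_x (c * (2 * B) * rapid x)) => eta M eM M0.
have j1 := cintegrable_ft eta hh1; have j0 := cintegrable_ft 0 hh1.
have c0 : 0 <= c by rewrite !mulr_ge0// pi_ge0.
have -> : ft h eta - ft h 0 = cint (leb R n)
   (fun t => h t * conjc (cis (phase eta t)) + (-1) * (h t * conjc (cis (phase 0 t)))).
  by rewrite cintD ?cintZ ?mulN1r//; exact: cintegrableZ.
have j := cintegrableD j1 (cintegrableZ (-1) j0).
apply: le_trans (cabs_cint j) _.
rewrite mulrC -RintegralZl//; last exact: integrable_rapid.
apply: le_Rintegral => //.
- exact: j.2.
- rewrite (_ : _ \o _ = EFin \o (fun x => (M * (c * (2 * B))) * rapid x)).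
    exact: integrable_rapid.
  by apply/funext => x /=; rewrite mulrA.
move=> t _; rewrite (_ : _ + _ = h t * conjc (cis (phase eta t) - 1)); last first.
  by rewrite phase0l cis0 !rmorphB !rmorph1; ring.
rewrite cabsM cabsJ; apply: (@le_trans _ _ (cabs (h t) * (c * jap t * M))).
  by rewrite ler_wpM2l ?cabs_ge0// cis_phase_sub1.
rewrite (_ : _ * _ = M * (c * (jap t * cabs (h t)))); last by ring.
by rewrite ler_wpM2l// -mulrA ler_wpM2l// hb.
Qed.

Lemma ft_continuous0 h k B : cdec (japX n.+2) k B h ->
  {for 0, continuous (fun eta => cabs (ft h eta))}.
Proof.
move=> hh; have [K HK] := ft_lipschitz0 hh.
suff : (fun eta => cabs (ft h eta)) @ nbhs (0 : 'rV[R]_n) --> cabs (ft h 0) by [].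
apply/cvgrPdist_le => e e0.
have K0 : 0 < `|K| + 1 by rewrite ltr_wpDl.
have : \forall y \near (0 : 'rV[R]_n), `|y| < e / (`|K| + 1).
  by apply: nbhs0_lt; rewrite divr_gt0.
apply: filterS => y; rewrite ltr_pdivlMr// => /ltW ye.
have dist (a b : R[i]) : `|cabs a - cabs b| <= cabs (a - b).
  rewrite ler_norml; have := cabsD (a - b) b; have := cabsD (b - a) a.
  by rewrite !subrK (cabsBC b a); lra.
have yi i : `|y 0 i| <= `|y|.
  rewrite [leRHS]/Num.norm /= mx_normrE.
  exact: (le_bigmax _ (fun ij : 'I_1 * 'I_n => `|y ij.1 ij.2|) (0, i)).
apply: le_trans (dist _ _) _; rewrite cabsBC; apply: le_trans (HK y _ yi (normr_ge0 _)) _.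
apply: le_trans ye; rewrite mulrC ler_wpM2l//; have := ler_norm K; lra.
Qed.

Lemma cint_sqr_eq0 (u : 'rV[R]_n -> R[i]) x0 : cmeas u ->
  cintegrable (leb R n) (fun x => u x * conjc (u x)) ->
  {for x0, continuous (fun x => cabs (u x))} ->
  cint (leb R n) (fun x => u x * conjc (u x)) = 0 -> u x0 = 0.
Proof.
move=> mu ju cu; rewrite (@eq_cint _ _ _ _ _ (fun x => Complex (cabs (u x) ^+ 2) 0)).
  move=> [] E0 _; apply: cabs_eq0; apply/eqP; rewrite -sqrf_eq0; apply/eqP.
  apply: (@integral_eq0_continuous _ n (fun x => cabs (u x) ^+ 2)).
  - by move=> x; rewrite exprn_ge0// cabs_ge0.
  - by apply: measurable_funX; exact: cmeas_cabs.
  - by apply: (@continuous_comp _ _ _ (fun x => cabs (u x)) (fun r : R => r ^+ 2)) => //; exact: exprn_continuous.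
  - have j : (leb R n).-integrable setT (fun x => (cabs (u x) ^+ 2)%:E).
      have := cintegrable_Re ju; congr integrable; apply/funext => x.
      by rewrite mulrC mulJ.
    by rewrite -(fineK (integrable_fin_num measurableT j)) -/(Rintegral _ _ _) E0.
by move=> x; rewrite mulrC mulJ.
Qed.

Lemma cabs_continuous (u : 'rV[R]_n -> R[i]) x0 :
  {for x0, continuous (fun x => complex.Re (u x))} ->
  {for x0, continuous (fun x => complex.Im (u x))} ->
  {for x0, continuous (fun x => cabs (u x))}.
Proof.
move=> cr ci.
rewrite (_ : (fun x => _) = (@Num.sqrt R) \o (fun t => complex.Re (u t) ^+ 2 + complex.Im (u t) ^+ 2)).
  have c2 (q : 'rV[R]_n -> R) : {for x0, continuous q} -> {for x0, continuous (fun t => q t ^+ 2)}.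
    by move=> cq; exact: (continuous_comp cq (@exprn_continuous R 2 _)).
  apply: continuous_comp; last exact: sqrt_continuous.
  exact: (cvgD (c2 _ cr) (c2 _ ci)).
by apply/funext => t /=; rewrite -sqr_cabs sqrtr_sqr ger0_norm// cabs_ge0.
Qed.

Lemma schwartz_neq0 (f : schwartz R n) : f <> 0 -> exists a, f a != 0.
Proof.
move=> f0; apply: contrapT => H; apply: f0; apply: val_inj; apply/funext => x.
by apply/eqP/negP => /negP fx; apply: H; exists x.
Qed.

Lemma schwartz_comp_continuous (f : schwartz R n) (q : 'rV[R]_n -> 'rV[R]_n) x :
  differentiable q x -> {for x, continuous (fun x => cabs (f (q x)))}.
Proof.
move=> dq; have [B _ [fr fi]] := schwartz_sdec 0 f.
apply: cabs_continuous; apply: differentiable_continuous.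
  exact: (differentiable_comp dq (dec_diff fr (q x))).
exact: (differentiable_comp dq (dec_diff fi (q x))).
Qed.

(* [kap] stands for the value 1 of the classical constant, which need not be
   computed. *)
Lemma fourier_constant (f : schwartz R n) : f <> 0 ->
  exists2 kap : R[i], kap != 0 & forall h1 h2 B1 B2,
  cdec japw n.+1 B1 h1 -> cdec japw n.+1 B2 h2 ->
  cint (leb R n) (fun eta => ft h1 eta * conjc (ft h2 eta)) =
  kap * cint (leb R n) (fun t => h1 t * conjc (h2 t)).
Proof.
move=> f0.
have [a fa] := schwartz_neq0 f0.
(* [|f|^2] translated so as not to vanish at 0, which [kappa] requires of its reference function. *)
pose phi0 t : R[i] := f (t - - a) * conjc (f (t - - a)).
have [B B0 hB] := schwartz_sdec n.+2 f.
have hphi : exists B', cdec (japX n.+2) n.+2 B' phi0.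
  have hs : sdec n.+2 B f := hB.
  have c0 : 0 <= (2 * jap (- a)) ^+ n.+2 by rewrite exprn_ge0// mulr_ge0// jap_ge0.
  have ww (x : 'rV[R]_n) : japX n.+2 x <= (2 * jap (- a)) ^+ n.+2 * japX n.+2 (x - - a).
    by rewrite /japX -exprMn lerXn2r ?nnegrE ?mulr_ge0 ?jap_ge0//; exact: jap_shift.
  have hs' := cdec_weight c0 ww (cdec_shift (- a) hs).
  have h1 : cdec (fun=> 1) n.+2 (1 * ((2 * jap (- a)) ^+ n.+2 * B)) (fun t => conjc (f (t - - a))).
    apply: (cdec_weight ler01 _ (cdecJ hs')) => x.
    by rewrite mul1r /japX exprn_ege1// jap_ge1.
  eexists; have := cdecM (japX_ge0 n.+2) (fun=> ler01) hs' h1.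
  apply: (@cdec_weight _ _ _ _ _ 1) => // x.
  by rewrite mul1r /= mulr1.
have [B' hB'] := hphi.
have dphi : cdec japw n.+1 B' phi0.
  rewrite -[B']mul1r; apply: cdec_weight (cdec_leq (leqnSn _) hB') => // x.
  by rewrite mul1r /japw /japX ler_weXn2l// jap_ge1.
have phi00 : phi0 0 != 0.
  by rewrite /phi0 opprK add0r mulf_neq0// conjc_eq0.
exists (kappa phi0) => [|h1 h2 B1 B2 d1 d2]; last exact: (ft_parseval dphi phi00 d1 d2).
(* If the constant were 0, Parseval would annihilate [ft phi0], in particular its value at 0, which
   is the integral of the translated [|f|^2]; then [f] would vanish at [a]. *)
apply/negP => /eqP k0.
have E := ft_parseval dphi phi00 dphi dphi; rewrite k0 mul0r in E.
have mphi := cdec_cmeas dphi.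
have f00 : ft phi0 0 = 0.
  apply: cint_sqr_eq0 => //.
  - exact: cmeas_ft.
  - have jf := cintegrable_ftE dphi; have [C C0 HC] := @ft_rapid R n.
    apply: (@cintegrable_le _ _ _ _ _ (fun x => C * B' * cabs (ft phi0 x))).
    + exact: cmeasM jf.1 (cmeasJ jf.1).
    + exact: (integrableZl _ _ jf.2).
    + move=> x; rewrite cabsM cabsJ ler_wpM2r ?cabs_ge0//.
      apply: le_trans (HC _ _ x dphi) _; rewrite ler_piMr ?rapid_le1//.
      by rewrite mulr_ge0// (cdec_ge0 (japX_ge0 _) hB').
  - exact: ft_continuous0 hB'.
rewrite ft0 in f00.
suff : f (0 - - a) = 0 by rewrite opprK add0r; exact/eqP.
apply: (@cint_sqr_eq0 (fun t => f (t - - a))) => //.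
- exact: cdec_cmeas (cdec_shift (- a) hB).
- exact: (cdec_integrable dphi).
- by apply: schwartz_comp_continuous; exact: differentiableB.
Qed.

End FourierConstant.

Section Moyal.
Context {R : realType} {d : nat}.
Implicit Types (f w : schwartz R d) (z : 'rV[R]_(d + d)).

Lemma cabs_cint_le d0 (T : measurableType d0) (mu : {measure set T -> \bar R})
    (f : T -> R[i]) (k : T -> R) :
  cmeas f -> mu.-integrable setT (EFin \o k) -> (forall x, cabs (f x) <= k x) ->
  cabs (cint mu f) <= \int[mu]_x k x.
Proof.
move=> mf jk fk; have jf := cintegrable_le mf jk fk.
apply: le_trans (cabs_cint jf) _; apply: le_Rintegral => //; exact: jf.2.
Qed.

Lemma cmeas_comp d1 d2 (T1 : measurableType d1) (T2 : measurableType d2)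
    (f : T2 -> R[i]) (q : T1 -> T2) :
  cmeas f -> measurable_fun setT q -> cmeas (f \o q).
Proof.
by move=> [fr fi] mq; split; [exact: (measurableT_comp fr mq)|exact: (measurableT_comp fi mq)].
Qed.

Lemma cmeas_window (w : 'rV[R]_d -> R[i]) : cmeas w ->
  cmeas (fun p : 'rV[R]_d * 'rV[R]_d => w (p.2 - p.1)).
Proof.
move=> mw; apply: (cmeas_comp mw).
by apply: measurable_subrV; [exact: measurable_snd|exact: measurable_fst].
Qed.

Lemma cmeas_inner_tfshift (f w : 'rV[R]_d -> R[i]) : cmeas f -> cmeas w ->
  cmeas (fun z : 'rV[R]_(d + d) => inner f (tfshift_fun z w)).
Proof.
move=> mf mw.
apply: (@cmeas_cint _ _ _ _ R (leb R d) (fun p : 'rV[R]_(d + d) * 'rV[R]_d =>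
  f p.2 * conjc (tfshift_fun p.1 w p.2))).
apply: cmeasM; first exact: (cmeas_comp mf (@measurable_snd _ _ _ _)).
have m1 := @measurable_fst _ _ 'rV[R]_(d + d) 'rV[R]_d.
have m2 := @measurable_snd _ _ 'rV[R]_(d + d) 'rV[R]_d.
apply: cmeasJ; apply: cmeasM.
  apply: cmeas_cis; apply: measurable_funM => //.
  apply: measurable_dotp; first exact: m2.
  exact: (measurableT_comp (@measurable_rsubmx R d d) m1).
apply: (cmeas_comp mw); apply: measurable_subrV; first exact: m2.
exact: (measurableT_comp (@measurable_lsubmx R d d) m1).
Qed.

Lemma inner_tfshift_rapid M f w : exists2 C, 0 <= C & forall z,
  cabs (inner f (tfshift z w)) <= C * jap z `^ (- M%:R).
Proof.
have [C C0 HC] := inner_tfshift_decay M w; have [B B0 hB] := schwartz_sdec (M + d.+1) f.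
exists (C * B) => [|z]; first exact: mulr_ge0.
case: M C HC B hB C0 B0 => [|M] C HC B hB C0 B0.
  by have := HC _ _ z hB; rewrite expr0 mulr1 oppr0 powRr0 mulr1.
by rewrite powR_invn ?jap_ge0// ler_pdivlMr ?exprn_gt0 ?jap_gt0//; exact: HC.
Qed.

Lemma inner_tfshift_integrable f w :
  cintegrable (leb R (d + d)) (fun z => inner f (tfshift z w)).
Proof.
have [C C0 HC] := inner_tfshift_rapid (d + d).+1 f w.
apply: (@cintegrable_le _ _ _ _ _ (fun z => C * rapid z)) => //; last exact: integrable_rapid.
by apply: cmeas_inner_tfshift; exact: schwartz_cmeas.
Qed.

Lemma window_mass (w : schwartz R d) :
  cintegrable (leb R d) (fun x => w (- x) * conjc (w (- x))) /\
  (w <> 0 -> cint (leb R d) (fun x => w (- x) * conjc (w (- x))) != 0).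
Proof.
have [B B0 hB] := schwartz_sdec d.+1 w.
have mw : cmeas (fun x : 'rV[R]_d => w (- x)).
  apply: (cmeas_comp (schwartz_cmeas w)).
  rewrite (_ : -%R = fun x : 'rV[R]_d => 0 - x); last by apply/funext => x; rewrite sub0r.
  by apply: measurable_subrV; [exact: measurable_cst|exact: measurable_id].
have j : cintegrable (leb R d) (fun x => w (- x) * conjc (w (- x))).
  apply: (@cintegrable_le _ _ _ _ _ (fun x => 2 * B * (2 * B) * rapid x)).
  - exact: cmeasM mw (cmeasJ mw).
  - exact: integrable_rapid.
  move=> x; rewrite cabsM cabsJ mulrAC.
  apply: ler_pM; rewrite ?cabs_ge0//; last exact: (cdec_cabs_le hB).
  by have := cdec_rapid hB (- x); rewrite /rapid japN.
split=> // w0; apply/eqP => E; have [a /eqP] := schwartz_neq0 w0; apply.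
rewrite -[a]opprK; apply: (cint_sqr_eq0 mw j) => //.
by apply: schwartz_comp_continuous; exact: differentiableN.
Qed.

(* For fixed position variable [x] of [z], the short-time transform is a Fourier
   transform in the frequency variable, to which Parseval applies. *)
Lemma moyal (w : schwartz R d) : w <> 0 -> exists2 kap : R[i], kap != 0 &
  forall f1 f2,
  cint (leb R (d + d)) (fun z => inner f1 (tfshift z w) * conjc (inner f2 (tfshift z w))) =
  kap * inner f1 f2.
Proof.
move=> w0; have [kap kap0 HK] := fourier_constant w0.
have [jw /(_ w0) m0] := window_mass w.
(* The mass of the window comes out of the integral over position: [|w(t - x)|^2] integrates in [x]
   to a value independent of [t]. *)
exists (kap * cint (leb R d) (fun x => w (- x) * conjc (w (- x)))) => [|f1 f2].
  exact: mulf_neq0.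
have [B1 B10 hB1] := schwartz_sdec (d.+1 + d.+1) f1.
have [B2 B20 hB2] := schwartz_sdec (d.+1 + d.+1) f2.
have [W W0 hW] := schwartz_sdec (d.+1 + d.+1) w.
pose h (f : schwartz R d) (x t : 'rV[R]_d) := f t * conjc (w (t - x)).
pose c (x : 'rV[R]_d) : R := (2 / jap x) ^+ d.+1.
pose K B : R := 2 * (2 ^+ d.+1 * (B * W)).
have c1 x : c x <= 2 ^+ d.+1.
  rewrite /c lerXn2r ?nnegrE ?divr_ge0 ?jap_ge0// ler_pdivrMr ?jap_gt0//.
  by rewrite ler_peMr ?jap_ge1.
have dh1 x : cdec japw d.+1 (c x * K B1) (h f1 x) := cdec_window x hB1 hW.
have dh2 x : cdec japw d.+1 (c x * K B2) (h f2 x) := cdec_window x hB2 hW.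
have jz : cintegrable (leb R (d + d)) (fun z => inner f1 (tfshift z w) * conjc (inner f2 (tfshift z w))).
  have [C C0 HC] := inner_tfshift_rapid 0 f2 w.
  have [m1 j1] := inner_tfshift_integrable f1 w; have [m2 j2] := inner_tfshift_integrable f2 w.
  apply: (@cintegrable_le _ _ _ _ _ (fun z => C * cabs (inner f1 (tfshift z w)))).
  - exact: cmeasM m1 (cmeasJ m2).
  - exact: (integrableZl _ _ j1).
  - move=> z; rewrite cabsM cabsJ mulrC ler_wpM2r ?cabs_ge0//.
    by have := HC z; rewrite oppr0 powRr0 mulr1.
rewrite (cint_split jz).
transitivity (cint (leb R d) (fun x => kap * cint (leb R d) (fun t => h f1 x t * conjc (h f2 x t)))).
  apply: eq_cint => x; rewrite -(HK _ _ _ _ (dh1 x) (dh2 x)).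
  by apply: eq_cint => y; rewrite !innerE !row_mxKl !row_mxKr.
pose F (p : 'rV[R]_d * 'rV[R]_d) := h f1 p.1 p.2 * conjc (h f2 p.1 p.2).
have mh (f : schwartz R d) : cmeas (fun p : 'rV[R]_d * 'rV[R]_d => h f p.1 p.2).
  apply: cmeasM; first exact: (cmeas_comp (schwartz_cmeas f) (@measurable_snd _ _ _ _)).
  exact: cmeasJ (cmeas_window (schwartz_cmeas w)).
have mF : cmeas F by exact: cmeasM (mh f1) (cmeasJ (mh f2)).
have K1 : 0 <= K B1 by rewrite !mulr_ge0// exprn_ge0.
have K2 : 0 <= K B2 by rewrite !mulr_ge0// exprn_ge0.
have cr x : c x = 2 ^+ d.+1 * rapid x.
  by rewrite /c /rapid powR_invn ?jap_ge0// exprMn exprVn.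
(* A product majorant for Fubini: decay in [x] through [c x], decay in [y] through the weight on
   [h f1 x], while [h f2 x] is merely bounded. *)
have FB x y : cabs (F (x, y)) <= (2 ^+ d.+1 * (2 * K B1 * (2 * (2 ^+ d.+1 * K B2))) * rapid x) * (1 * rapid y).
  rewrite /F [cabs _]cabsM cabsJ /=.
  have b1 := cdec_rapid (dh1 x) y; have b2 := cdec_cabs_le (dh2 x) y.
  have b3 : cabs (h f2 x y) <= 2 * (2 ^+ d.+1 * K B2).
    by apply: le_trans b2 _; rewrite ler_wpM2l// ler_wpM2r.
  apply: le_trans (ler_pM (cabs_ge0 _) (cabs_ge0 _) b1 b3) _.
  rewrite cr; move: (2 ^+ d.+1) (K B1) (K B2) (rapid x) (rapid y) => p k1 k2 rx ry.
  by rewrite le_eqVlt; apply/orP; left; apply/eqP; ring.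
have jab : (\int[leb R d]_x \int[leb R d]_y (cabs (F (x, y)))%:E < +oo)%E.
  by apply: (dominated_prod_lty mF _ _ FB); exact: integrable_rapid.
have Kp : cintegrable (leb R d) (fun x => cint (leb R d) (fun t => h f1 x t * conjc (h f2 x t))).
  move: FB; set DD := 2 ^+ d.+1 * (_ * _) => FB.
  apply: (@cintegrable_le _ _ _ _ _ (fun x => (\int[leb R d]_y (1 * rapid y)) * DD * rapid x)).
  - exact: (cmeas_fubini1 mF jab).
  - exact: integrable_rapid.
  - move=> x; apply: le_trans (cabs_cint_le _ _ (FB x)) _.
    + exact: (cmeasM (cdec_cmeas (dh1 x)) (cmeasJ (cdec_cmeas (dh2 x)))).
    + rewrite (_ : _ \o _ = EFin \o (fun y => (DD * rapid x) * rapid y)).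
        exact: integrable_rapid.
      by apply/funext => y /=; rewrite mul1r.
    + by rewrite RintegralZl//; [rewrite mulrC mulrA|exact: integrable_rapid].
rewrite (cintZ _ Kp) -mulrA; congr (_ * _).
rewrite (cint_fubini mF jab).
have jf := schwartz_innerI f1 f2.
rewrite /inner -[cintegral (fun t => f1 t * _)]/(cint (leb R d) _) -(cintZ _ jf).
apply: eq_cint => t; rewrite mulrC -(cint_leb_shift (- t) jw).2.
rewrite -(cintZ _ (cint_leb_shift (- t) jw).1).
apply: eq_cint => x; rewrite /F /h [_.1]/= [_.2]/= conjM conjJ opprD opprK [- x + t]addrC; ring.
Qed.

End Moyal.

(** * Frame expansions of Schwartz functions and tempered distributions *)

Section Vanishing.
Context {R : realType} {n : nat}.
Implicit Types (f : 'rV[R]_n -> R) (B eps : R).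

(* Landau's inequality: a difference quotient of step [h] approximates the
   derivative up to [h] times a bound of the second derivatives. *)
Lemma landau f B delta h : dec (fun=> 1) 2 B f -> (forall x, `|f x| <= delta) -> 0 < h ->
  forall i x, `|'D_'e_i f x| <= 2 * delta / h + h * B.
Proof.
move=> hf fd h0 i x; have [df _ Df] := hf; have [d2 _ D2] := Df i.
have [t /andP[t0 t1] E] := mvt_dir x (h *: 'e_i) df.
have Ei : f (x + h *: 'e_i) - f x = h * 'D_'e_i f (x + t *: (h *: 'e_i)).
  by rewrite E !deriveE// linearZ.
have := @mvt_bound _ _ ('D_'e_i f) x (t *: (h *: 'e_i)) (fun=> B) d2.
have b2 j y : `|'D_'e_j ('D_'e_i f) y| <= B.
  by have [_ + _] := D2 j; move/(_ y); rewrite mul1r.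
have B0 : 0 <= B by apply: le_trans (b2 i 0).
move=> /(_ (fun j y => b2 j y)).
have -> : \sum_j `|(t *: (h *: ('e_i : 'rV[R]_n))) 0 j| * B = t * h * B.
  rewrite (bigD1 i)//= big1 => [|j ji]; rewrite !mxE eqxx.
    by rewrite addr0 eqxx mulr1 ger0_norm// mulr_ge0// ltW.
  by rewrite (negPf ji) !mulr0 normr0 mul0r.
set y := x + t *: _ in Ei *; move=> H.
have hB : t * h * B <= h * B by rewrite ler_wpM2r// ler_piMl// ltW.
have E2 : 'D_'e_i f y = (f (x + h *: 'e_i) - f x) / h by rewrite Ei [h * _]mulrC mulfK// gt_eqF.
have : `|'D_'e_i f y| <= 2 * delta / h.
  rewrite E2 normrM normfV (gtr0_norm h0) ler_pM2r ?invr_gt0//.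
  apply: le_trans (ler_normB _ _) _; rewrite mulr_natl mulr2n; exact: lerD.
have := ler_normD ('D_'e_i f y - ('D_'e_i f y - 'D_'e_i f x)) 0.
rewrite addr0 normr0 addr0 => _.
have := ler_normB ('D_'e_i f y) ('D_'e_i f y - 'D_'e_i f x).
by rewrite opprB addrC subrK; move: H; lra.
Qed.

(** Induction on [k]: by Landau's inequality each derivative inherits uniform smallness, at the
    price of a bound one order higher. *)
Lemma dec_vanish k (r : nat -> 'rV[R]_n -> R) B :
  (forall m, dec (fun=> 1) k.+1 B (r m)) ->
  (forall eps, 0 < eps -> \forall m \near \oo, forall x, `|r m x| <= eps) ->
  forall eps, 0 < eps -> \forall m \near \oo, dec (fun=> 1) k eps (r m).
Proof.
elim: k r => [|k IH] r hr r0 eps e0.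
  apply: filterS (r0 _ e0) => m rm; split=> // x; first exact: dec_diff (hr m) x.
  by rewrite mul1r.
have : \forall m \near \oo, forall i, dec (fun=> 1) k eps ('D_'e_i (r m)).
  apply: filter_forall => i; apply: IH eps e0 => [m|e ee]; first by have [_ _] := hr m; exact.
  have B0 : 0 <= B by exact: dec_ge0 (fun=> ler01) (hr 0).
  (* Balances the two terms of Landau's inequality: [h * B <= e / 2], and the sup bound [e * h / 4]
     makes the other term equal to [e / 2]. *)
  pose h := e / (2 * (B + 1)).
  have h0 : 0 < h by rewrite divr_gt0// mulr_gt0// ltr_wpDl.
  have de : 0 < e * h / 4 by rewrite divr_gt0// mulr_gt0.
  apply: filterS (r0 _ de) => m rm x.
  apply: le_trans (landau (dec_leq _ (hr m)) rm h0 i x) _ => //.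
  have -> : 2 * (e * h / 4) / h = e / 2 by field; exact: lt0r_neq0.
  have : h * B <= e / 2; last by lra.
  rewrite /h mulrAC ler_pdivrMr ?mulr_gt0 ?ltr_wpDl//.
  have -> : e / 2 * (2 * (B + 1)) = e * (B + 1) by field.
  by rewrite ler_wpM2l ?ltW//; lra.
move=> H; near=> m; split.
- by move=> x; exact: dec_diff (hr m) x.
- move=> x; rewrite mul1r; move: x; near: m; exact: r0.
- by near: m.
Unshelve. all: by end_near. Qed.

(** Where [<x> <= rho] the weight is at most [rho ^+ N] and the unweighted bound suffices; elsewhere
    the spare power of the weight gains [1 / rho]. *)
Lemma dec_interpolate N k f B delta rho eps : 0 < rho -> rho ^+ N * delta <= eps -> B / rho <= eps ->
  dec (fun=> 1) k delta f -> dec (japX N.+1) k B f -> dec (japX N) k eps f.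
Proof.
move=> rho0 re Be.
have key q : (forall x, 1 * `|q x| <= delta) -> (forall x : 'rV[R]_n, japX N.+1 x * `|q x| <= B) ->
    forall x, japX N x * `|q x| <= eps.
  move=> q1 q2 x; have [xr|rx] := leP (jap x) rho.
    apply: le_trans re; apply: ler_pM => //; rewrite ?japX_ge0//.
      by rewrite lerXn2r ?nnegrE ?jap_ge0// ltW.
    by have := q1 x; rewrite mul1r.
  apply: le_trans Be; rewrite ler_pdivlMr//; apply: le_trans (q2 x).
  rewrite /japX exprS mulrC mulrA ler_wpM2r// ler_wpM2r ?exprn_ge0 ?jap_ge0// ltW//.
elim: k f => [|k IH] f [df b1 D1] [_ b2 D2]; split=> //; try exact: key.
by move=> i; exact: IH (D1 i) (D2 i).
Qed.

Lemma dec_vanishX N k (r : nat -> 'rV[R]_n -> R) B :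
  (forall m, dec (japX N.+1) k.+1 B (r m)) ->
  (forall eps, 0 < eps -> \forall m \near \oo, forall x, `|r m x| <= eps) ->
  forall eps, 0 < eps -> \forall m \near \oo, dec (japX N) k eps (r m).
Proof.
move=> hr r0 eps e0.
have B0 : 0 <= B by exact: dec_ge0 (japX_ge0 _) (hr 0).
pose rho := (B + 1) / eps.
have rho0 : 0 < rho by rewrite divr_gt0// ltr_wpDl.
have rN : 0 < rho ^+ N by rewrite exprn_gt0.
have hr1 m : dec (fun=> 1) k.+1 B (r m).
  rewrite -[B]mul1r; apply: dec_weight (hr m) => // x.
  by rewrite mul1r /japX exprn_ege1// jap_ge1.
have de : 0 < eps / rho ^+ N by rewrite divr_gt0.
apply: filterS (dec_vanish hr1 r0 de) => m hm.
apply: (dec_interpolate rho0 _ _ hm (decS (hr m))).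
  by rewrite mulrC divfK// gt_eqF.
rewrite /rho invf_div mulrA ler_pdivrMr ?ltr_wpDl// mulrC ler_wpM2l ?ltW//; lra.
Qed.

(* A Lipschitz function that is large at a point is large on a cube around it. *)
Lemma small_integral_sup B eps : 0 <= B -> 0 < eps -> exists2 eta, 0 < eta &
  forall f, dec (fun=> 1) 1 B f -> (\int[leb R n]_x (f x ^+ 2)%:E < eta%:E)%E ->
    forall x, `|f x| <= eps.
Proof.
move=> B0 e0.
(* On a cube of side [rho] the function varies by at most [n * rho * B <= eps / 2], so [|f| > eps]
   at the corner forces [|f| >= eps / 2] on the whole cube. *)
pose rho := eps / (2 * (n%:R * B + 1)).
have K0 : 0 < n%:R * B + 1 by rewrite ltr_wpDl// mulr_ge0.
have rho0 : 0 < rho by rewrite divr_gt0// mulr_gt0.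
exists ((eps / 2) ^+ 2 * rho ^+ n) => [|f hf].
  by rewrite mulr_gt0// exprn_gt0// divr_gt0.
apply: contraPP => /existsNP[x0 /negP]; rewrite -ltNge => fx0; apply/negP; rewrite -leNgt.
have [df _ Df] := hf.
rewrite EFinM -(integral_cube x0 (ltW rho0)).
have mc := measurable_cube x0 rho.
rewrite -ge0_integralZl//; last 2 first.
- by apply/measurable_EFinP; exact: measurable_indic.
- by rewrite lee_fin exprn_ge0// divr_ge0// ltW.
apply: ge0_le_integral => //.
- by move=> x _; rewrite -EFinM lee_fin mulr_ge0// exprn_ge0// divr_ge0// ltW.
- by apply/measurable_EFinP; apply: measurable_funM => //; exact: measurable_indic.
- by apply/measurable_EFinP; apply: measurable_funX; exact: diff_measurable.
move=> x _; rewrite -EFinM lee_fin indicE.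
case: (boolP (x \in cube x0 rho)) => [/set_mem xc|_]; last by rewrite mulr0 sqr_ge0.
rewrite mulr1 -[leRHS]real_normK ?num_real// lerXn2r ?nnegrE ?divr_ge0 ?(ltW e0)//.
have := @mvt_bound _ _ f x0 (x - x0) (fun=> B) df.
move=> /(_ (fun i y => _)) H.
have {}H : `|f (x0 + (x - x0)) - f x0| <= \sum_i `|(x - x0) 0 i| * B.
  by apply: H => i y; have [_ + _] := Df i; move/(_ y); rewrite mul1r.
rewrite [x0 + _]addrC subrK in H.
have S : \sum_i `|(x - x0) 0 i| * B <= eps / 2.
  apply: (@le_trans _ _ (\sum_(i < n) rho * B)).
    apply: ler_sum => i _; rewrite ler_wpM2r// !mxE.
    by have /andP[a1 a2] := xc i; rewrite ger0_norm; lra.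
  rewrite sumr_const card_ord -[leLHS]mulr_natl /rho.
  rewrite (_ : _ * _ = eps / 2 * ((n%:R * B) / (n%:R * B + 1))); last by field; exact: lt0r_neq0.
  by rewrite ler_piMr ?divr_ge0 ?(ltW e0)// ler_pdivrMr// mul1r; lra.
have := ler_normB (f x) (f x - f x0); rewrite opprB addrC subrK.
lra.
Qed.

End Vanishing.

Section SquareIntegrals.
Context d (T : measurableType d) (R : realType).
Variable mu : {measure set T -> \bar R}.
Implicit Types (f h : T -> R[i]).
Local Open Scope ereal_scope.

(** The square of the L^2 norm, kept without the root; over counting measure it is the square of the
    l^2 norm. *)
Definition sqint f : \bar R := \int[mu]_x (cabs (f x) ^+ 2)%:E.

Lemma sqint_ge0 f : 0 <= sqint f.
Proof. by apply: integral_ge0 => x _; rewrite lee_fin sqr_ge0. Qed.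

Lemma measurable_sq f : cmeas f -> measurable_fun setT (fun x => (cabs (f x) ^+ 2)%:E).
Proof. by move=> mf; apply/measurable_EFinP; apply: measurable_funX; exact: cmeas_cabs. Qed.

Lemma eq_sqint f h : (forall x, f x = h x) -> sqint f = sqint h.
Proof. by move=> fh; apply: eq_integral => x _; rewrite fh. Qed.

Lemma sqint_integrable f : cmeas f -> sqint f < +oo ->
  mu.-integrable setT (EFin \o (fun x => cabs (f x) ^+ 2)%R).
Proof.
move=> mf jf; apply/integrableP; split; first exact: measurable_sq.
by under eq_integral do rewrite /= ger0_norm ?sqr_ge0//.
Qed.

Lemma sqint_prod f h : cmeas f -> cmeas h -> sqint f < +oo -> sqint h < +oo ->
  cintegrable mu (fun x => (f x * conjc (h x))%R).
Proof.
move=> mf mh jf jh.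
apply: (@cintegrable_le _ _ _ _ _ (fun x => cabs (f x) ^+ 2 + cabs (h x) ^+ 2)%R).
- exact: cmeasM mf (cmeasJ mh).
- exact: (integrableD measurableT (sqint_integrable mf jf) (sqint_integrable mh jh)).
move=> x; rewrite cabsM cabsJ; have := sqr_ge0 (cabs (f x) - cabs (h x))%R.
have := cabs_ge0 (f x); have := cabs_ge0 (h x); nra.
Qed.

Lemma Rsqint f : sqint f < +oo -> sqint f = (\int[mu]_x (cabs (f x) ^+ 2))%R%:E.
Proof. by move=> jf; rewrite /Rintegral fineK// ge0_fin_numE// sqint_ge0. Qed.

(** Cauchy-Schwarz in Young's form [a b <= t a^2 / 2 + b^2 / (2 t)], with the parameter chosen at
    each use. *)
Lemma cint_prod_le f h (t : R) : cmeas f -> cmeas h -> sqint f < +oo -> sqint h < +oo ->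
  (0 < t)%R -> (cabs (cint mu (fun x => (f x * conjc (h x))%R)))%:E <=
   (t / 2)%:E * sqint f + (t^-1 / 2)%:E * sqint h.
Proof.
move=> mf mh jf jh t0; have j1 := sqint_integrable mf jf; have j2 := sqint_integrable mh jh.
rewrite (Rsqint jf) (Rsqint jh) -!EFinM -EFinD lee_fin.
rewrite -!RintegralZl// -RintegralD//; last 2 first.
- exact: (integrableZl measurableT _ j1).
- exact: (integrableZl measurableT _ j2).
apply: cabs_cint_le.
- exact: cmeasM mf (cmeasJ mh).
- exact: (integrableD measurableT (integrableZl measurableT _ j1) (integrableZl measurableT _ j2)).
move=> x; rewrite cabsM cabsJ; set a := cabs _; set b := cabs _.
have := sqr_ge0 (t * a - b)%R; have ti : (0 < t^-1)%R by rewrite invr_gt0.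
rewrite -(pmulr_rge0 _ ti); have -> : (t^-1 * (t * a - b) ^+ 2 = t * a ^+ 2 + t^-1 * b ^+ 2 - 2 * a * b)%R.
  by field; exact: lt0r_neq0.
lra.
Qed.

End SquareIntegrals.

Section L2norm.
Context {R : realType} {n : nat}.
Implicit Types f : 'rV[R]_n -> R[i].
Local Open Scope ereal_scope.

Lemma Lpnorm2E f : Lpnorm 2%:E f = sqint (leb R n) f `^ (2^-1)%R.
Proof.
rewrite /Lpnorm unlock; congr (_ `^ _); apply: eq_integral => x _.
by rewrite gee0_abs ?lee_fin ?cabs_ge0// poweR_EFin powR_mulrn ?cabs_ge0.
Qed.

Lemma Lpnorm2_lt f (e : R) : (0 <= e)%R -> Lpnorm 2%:E f < e%:E -> sqint (leb R n) f < (e ^+ 2)%:E.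
Proof.
rewrite Lpnorm2E => e0 fe; have f0 := sqint_ge0 (leb R n) f.
have flt : sqint (leb R n) f < +oo.
  by apply: (@lty_poweRy _ _ (2^-1)%R); [rewrite invr_eq0|exact: lt_trans fe (ltry _)].
move: fe f0 flt; case: (sqint _ f) => [r|//|//].
rewrite lee_fin poweR_EFin !lte_fin => re r0 _.
have <- : ((r `^ 2^-1) ^+ 2 = r)%R by rewrite powR12_sqrt// sqr_sqrtr.
by rewrite ltrXn2r// ?powR_ge0// ltW.
Qed.

Lemma L2P f : L2 f <-> cmeas f /\ sqint (leb R n) f < +oo.
Proof.
rewrite /L2 Lpnorm2E; split=> -[mf jf]; split=> //.
  by apply: (@lty_poweRy _ _ (2^-1)%R) => //; rewrite invr_eq0.
exact: poweR_lty.
Qed.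

Lemma schwartz_sqint (f : schwartz R n) : sqint (leb R n) f < +oo.
Proof.
have [mf jf] := schwartz_cintegrable f; have [B B0 HB] := schwartz_bounded f.
have /integrableP[_] := integrableZl measurableT B jf.
apply: le_lt_trans; apply: ge0_le_integral => //.
- by move=> x _; rewrite lee_fin sqr_ge0.
- exact: measurable_sq.
- have [mj _] := integrableP _ _ _ (integrableZl measurableT B jf).
  exact: measurableT_comp.
move=> x _; rewrite -EFinM /= lee_fin; apply: le_trans (ler_norm _).
by rewrite expr2 ler_wpM2r ?cabs_ge0.
Qed.

Lemma schwartz_L2 (f : schwartz R n) : L2 f.
Proof. by apply/L2P; split; [exact: schwartz_cmeas|exact: schwartz_sqint]. Qed.

End L2norm.

Lemma cmeasB d (T : measurableType d) (R : realType) (f h : T -> R[i]) :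
  cmeas f -> cmeas h -> cmeas (fun x => f x - h x).
Proof.
move=> mf mh; rewrite (_ : (fun x => _) = fun x => f x + -1 * h x).
  exact: (cmeasD mf (cmeasM (cmeas_cst _ _) mh)).
by apply/funext => x; rewrite mulN1r.
Qed.

(** Turns sums over the lattice into sums over [nat], injectivity counting each point once.
    Positivity of [m] makes the lattice infinite, hence equipotent to [nat]. *)
Lemma lattice_enumeration m : (0 < m)%N ->
  exists b : nat -> 'cV[int]_m, injective b /\ forall k, exists n, b n = k.
Proof.
move=> m0.
pose f (n : nat) : 'cV[int]_m := const_mx n%:Z.
have fi : {in [set: nat] &, injective f}.
  move=> x y _ _ /matrixP/(_ (Ordinal m0) 0); rewrite !mxE => /eqP.
  by rewrite eqz_nat => /eqP.
have inf : ~ finite_set [set: 'cV[int]_m].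
  move=> fin; apply: infinite_nat.
  by rewrite -(eq_finite_set (inj_card_eq fi)); exact: sub_finite_set fin.
have /card_set_bijP[q [_ qi qs]] : ([set: 'cV[int]_m] #= [set: nat])%card by apply: eq_card_nat.
have qs' n : exists k, q k = n by have [k _ <-] := qs n I; exists k.
pose b n := projT1 (cid (qs' n)).
have bK n : q (b n) = n by rewrite /b; case: cid.
exists b; split=> [x y bxy|k]; first by rewrite -[x]bK bxy bK.
by exists (q k); apply: qi; rewrite ?inE.
Qed.

(** * Bessel's inequality and convergence of the frame expansion *)

Section FrameExpansion.
Context {R : realType} {d : nat}.
Variables (g : schwartz R d) (A : 'M[R]_(d + d)) (b : nat -> 'cV[int]_(d + d)).
Hypotheses (injb : injective b) (surjb : forall k, exists n, b n = k).
Hypotheses (Au : A \in unitmx) (pf : parseval_frame g A).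
Local Notation mu := (leb R d).
Implicit Types (f h : 'rV[R]_d -> R[i]).

Definition node k : 'rV[R]_(d + d) := lattice_pt A (b k).
Definition atom k : schwartz R d := tfshift (node k) g.
Definition frame_part n f : 'rV[R]_d -> R[i] :=
  fun t => \sum_(0 <= k < n) inner f (atom k) * atom k t.

(** Unconditional convergence specialises to the enumeration: a long enough initial segment contains
    the finite set [F0]. *)
Lemma parseval_seq f (eps : R) : L2 f -> 0 < eps ->
  \forall n \near \oo, (sqint mu (fun t => f t - frame_part n f t)%R < eps%:E)%E.
Proof.
move=> Lf e0; have se0 : 0 < Num.sqrt eps by rewrite sqrtr_gt0.
have [F0 HF] := pf Lf se0.
have [b' Hb'] : exists b' : 'cV[int]_(d + d) -> nat, forall k, b (b' k) = k.
  by exists (fun k => projT1 (cid (surjb k))) => k; case: cid.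
exists (\max_(x <- F0) (b' x).+1) => // n /= Nn.
pose F := [fset k in [seq b i | i <- index_iota 0 n]]%fset.
have pF : perm_eq F [seq b i | i <- index_iota 0 n].
  apply: uniq_perm; first exact: fset_uniq.
    by rewrite map_inj_uniq ?iota_uniq.
  by move=> x; rewrite !inE.
have sF : (F0 `<=` F)%fset.
  apply/fsubsetP => x xF0; rewrite !inE -[x]Hb' mem_map// mem_index_iota /=.
  by apply: leq_trans Nn; rewrite (@leq_bigmax_seq _ _ xpredT (fun x => (b' x).+1)).
have := HF F sF; move/(Lpnorm2_lt (ltW se0)); rewrite sqr_sqrtr ?ltW//.
rewrite (_ : (fun t => f t - frame_sum g A F f t) = (fun t => f t - frame_part n f t))//.
apply/funext => t; congr (_ - _); rewrite /frame_sum (perm_big _ pF) /= big_map.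
by [].
Qed.

Lemma cmeas_frame_part n f : cmeas (frame_part n f).
Proof. by apply: cmeas_sum => k; exact: (cmeasM (cmeas_cst _ _) (schwartz_cmeas (atom k))). Qed.

Definition synth (r : seq nat) (a : nat -> R[i]) : schwartz R d := \sum_(k <- r) a k *: atom k.

Lemma synthE r a t : synth r a t = \sum_(k <- r) a k * atom k t.
Proof.
rewrite /synth; elim: r => [|k r IH]; first by rewrite !big_nil.
by rewrite !big_cons -IH.
Qed.

Lemma inner_synthl r a (phi : schwartz R d) :
  inner (synth r a) phi = \sum_(k <- r) a k * inner (atom k) phi.
Proof.
transitivity (cint mu (fun t => \sum_(k <- r) a k * (atom k t * conjc (phi t)))).
  by apply: eq_cint => t; rewrite synthE big_distrl /=; apply: eq_bigr => k _; rewrite mulrA.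
rewrite cint_sum => [|k]; last by apply: cintegrableZ; exact: schwartz_innerI.
by apply: eq_bigr => k _; rewrite cintZ//; exact: schwartz_innerI.
Qed.

Lemma inner_synthr r a f : L2 f ->
  inner f (synth r a) = \sum_(k <- r) conjc (a k) * inner f (atom k).
Proof.
move=> /L2P[mf jf].
have j k : cintegrable mu (fun t => f t * conjc (atom k t)).
  by apply: sqint_prod => //; [exact: schwartz_cmeas|exact: schwartz_sqint].
transitivity (cint mu (fun t => \sum_(k <- r) conjc (a k) * (f t * conjc (atom k t)))).
  apply: eq_cint => t; rewrite synthE conj_sum big_distrr /=; apply: eq_bigr => k _.
  by rewrite conjM mulrCA.
rewrite cint_sum => [|k]; last exact: cintegrableZ.
by apply: eq_bigr => k _; rewrite cintZ.
Qed.

Lemma frame_partE n f t : frame_part n f t = synth (index_iota 0 n) (fun k => inner f (atom k)) t.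
Proof. by rewrite synthE. Qed.

Lemma sqint_inner f : L2 f -> inner f f = Complex (fine (sqint mu f)) 0.
Proof.
move=> /L2P[mf jf]; rewrite (Rsqint jf) /=.
rewrite [inner f f]/inner -[cintegral _]/(cint mu _).
rewrite (@eq_cint _ _ _ _ _ (fun x => Complex (cabs (f x) ^+ 2) 0)); last first.
  by move=> x; rewrite mulrC mulJ.
by apply: complex_ext => //; rewrite cIm_cint /= Rintegral_cst// mul0r.
Qed.

(** Pairing [f] with its partial expansion of length [m] gives exactly the partial sum [S m]. Hence
    [F - S m] is the pairing of [f] with the remainder and tends to 0, while [S] is
    nondecreasing. *)
Lemma bessel f n : L2 f ->
  ((\sum_(0 <= k < n) cabs (inner f (atom k)) ^+ 2)%:E <= sqint mu f)%E.
Proof.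
move=> Lf; have /L2P[mf jf] := Lf; have F0 := sqint_ge0 mu f.
pose c k := inner f (atom k).
pose S m : R := \sum_(0 <= k < m) cabs (c k) ^+ 2.
have SE m : inner f (synth (index_iota 0 m) c) = Complex (S m) 0.
  rewrite (inner_synthr _ _ Lf) /S; under eq_bigr do rewrite mulJ.
  apply: complex_ext; rewrite ?cRe_sum ?cIm_sum //=; exact: big1.
have Sm m k : (m <= k)%N -> S m <= S k.
  move=> mk; rewrite /S (big_cat_nat (leq0n m) mk) /= lerDl sumr_ge0// => i _; exact: sqr_ge0.
rewrite (Rsqint jf) lee_fin -/(S n); apply/ler_addgt0Pr => e e0.
set F := Rintegral _ _ _.
have F0' : 0 <= F by rewrite -lee_fin -(Rsqint jf).
(* With this Young parameter [t * F / 2 <= e / 2], and a remainder of square norm below [e * t]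
   bounds the second term by [e / 2] as well. *)
pose t := e / (F + 1).
have t0 : 0 < t by rewrite divr_gt0// ltr_wpDl.
have te0 : 0 < e * t by exact: mulr_gt0.
have [N _ HN] := parseval_seq Lf te0.
pose m := maxn n N; apply: le_trans (Sm n m (leq_maxl _ _)) _.
have := HN m (leq_maxr _ _); set q := (fun t => _) => qlt.
have mq : cmeas q by exact: (cmeasB mf (cmeas_frame_part m f)).
have jq : (sqint mu q < +oo)%E by apply: lt_trans qlt (ltry _).
have := cint_prod_le mf mq jf jq t0.
have -> : cint mu (fun x => f x * conjc (q x)) = Complex (F - S m) 0.
  have j2 := sqint_prod mf (schwartz_cmeas (synth (index_iota 0 m) c)) jf (schwartz_sqint _).
  transitivity (cint mu (fun x => f x * conjc (f x) + (-1) * (f x * conjc (synth (index_iota 0 m) c x)))).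
    by apply: eq_cint => x; rewrite /q frame_partE conjD rmorphN; ring.
  rewrite cintD; [|exact: sqint_prod|exact: cintegrableZ].
  rewrite (cintZ _ j2) -[cint mu (fun x => f x * conjc (f x))]/(inner f f) (sqint_inner Lf).
  rewrite -[cint mu _]/(inner f (synth (index_iota 0 m) c)) SE (Rsqint jf).
  rewrite [fine _]/= -/F mulN1r.
  by apply: complex_ext; rewrite ?cReD ?cImD ?cReN ?cImN //; exact: subr0.
rewrite cabs_real (Rsqint jf) (Rsqint jq) -!EFinM -EFinD lee_fin -/F.
move: qlt; rewrite (Rsqint jq) lte_fin; set Q := Rintegral _ _ _ => qlt H.
have h1 : t / 2 * F <= e / 2.
  rewrite /t (_ : _ * F = e / 2 * (F / (F + 1))); last by field; apply: lt0r_neq0; rewrite ltr_wpDl.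
  by rewrite ler_piMr ?divr_ge0 ?(ltW e0)// ler_pdivrMr ?ltr_wpDl// mul1r lerDl.
have h2 : t^-1 / 2 * Q <= e / 2.
  rewrite mulrAC ler_pM2r// mulrC ler_pdivrMr//; exact: ltW.
have := ler_norm (S m - F); rewrite distrC; lra.
Qed.

(** Dual form of Bessel's inequality. The square norm of the sum [s] equals
    [sum_k conj(a_k) <s, e_k>]; Young's inequality, then Bessel for [s] itself, leave
    [|s|^2 <= |a|^2 / 2 + |s|^2 / 2]. *)
Lemma synth_sqint r a : uniq r ->
  (sqint mu (synth r a) <= (\sum_(k <- r) cabs (a k) ^+ 2)%:E)%E.
Proof.
move=> ur; have LS := schwartz_L2 (synth r a); have jS := schwartz_sqint (synth r a).
have E := inner_synthr r a LS; rewrite (sqint_inner LS) in E.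
rewrite (Rsqint jS) lee_fin; set F := Rintegral _ _ _.
have E1 : F = complex.Re (\sum_(k <- r) conjc (a k) * inner (synth r a) (atom k)).
  by rewrite -E /= (Rsqint jS).
pose n := (\max_(k <- r) k).+1.
have B : \sum_(k <- r) cabs (inner (synth r a) (atom k)) ^+ 2 <= F.
  have := bessel n LS; rewrite (Rsqint jS) lee_fin; apply: le_trans.
  have rn k : k \in r -> (k < n)%N.
    by move=> kr; rewrite ltnS (@leq_bigmax_seq _ _ xpredT (fun k => k)).
  rewrite [leRHS](bigID (fun k => k \in r)) /=.
  rewrite -[leLHS]addr0 lerD//; last by apply: sumr_ge0 => k _; exact: sqr_ge0.
  rewrite -[leRHS]big_filter [leLHS](perm_big [seq i <- index_iota 0 n | i \in r])//.
  apply: uniq_perm => //; first by rewrite filter_uniq// iota_uniq.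
  by move=> k; rewrite mem_filter mem_index_iota /=; case: (boolP (k \in r)) => //= /rn.
have : F <= \sum_(k <- r) cabs (a k) * cabs (inner (synth r a) (atom k)).
  rewrite E1; apply: le_trans (ler_norm _) _; apply: le_trans (norm_Re _) _.
  apply: le_trans (cabs_sum _ _) _; apply: ler_sum => k _.
  by rewrite cabsM cabsJ.
have : \sum_(k <- r) cabs (a k) * cabs (inner (synth r a) (atom k)) <=
   (\sum_(k <- r) cabs (a k) ^+ 2) / 2 + (\sum_(k <- r) cabs (inner (synth r a) (atom k)) ^+ 2) / 2.
  rewrite !mulr_suml -big_split; apply: ler_sum => k _.
  move: (cabs (a k)) (cabs (inner _ _)) => x y.
  have h : x * y <= x ^+ 2 / 2 + y ^+ 2 / 2 by have := sqr_ge0 (x - y); nra.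
  exact: h.
lra.
Qed.

Lemma lattice_rapid : exists2 C : R, 0 < C & forall z n,
  \sum_(0 <= k < n) rapid (node k - z) <= C.
Proof.
have hs : (d + d)%:R < (d + d).+1%:R :> R by rewrite ltr_nat.
by have [C C0 HC] := lattice_sum injb Au hs; exists C.
Qed.

(** The shift to [node k] inflates the seminorm by [<node k>^(2N)]; the remaining [(d + d).+1]
    powers of decay make the sum over the lattice converge, uniformly in [n]. *)
Lemma synth_sdec N (a : nat -> R[i]) (K : R) : 0 <= K ->
  (forall k, cabs (a k) * jap (node k) ^+ (N + N + (d + d).+1) <= K) ->
  exists2 B, 0 <= B & forall n, sdec N B (synth (index_iota 0 n) a).
Proof.
move=> K0 Ha; have [C C0 HC] := lattice_rapid.
have [C1 C10 HC1] := @sdec_tfshift R d N; have [G G0 hG] := schwartz_sdec N g.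
have ar k : cabs (a k) * jap (node k) ^+ (N + N) <= K * rapid (node k).
  rewrite /rapid powR_invn ?jap_ge0// ler_pdivlMr ?exprn_gt0 ?jap_gt0//.
  by rewrite -mulrA -exprD.
exists (2 * (C1 * G * (K * C))) => [|n]; first by rewrite !mulr_ge0// ltW.
have H k : sdec N (2 * (C1 * G) * (K * rapid (node k))) (fun t => a k * atom k t).
  have := cdecZ (a k) (japX_ge0 N) (HC1 _ _ (node k) hG).
  apply: cdec_mono.
  rewrite (_ : _ * (C1 * _ * G) = 2 * (C1 * G) * (cabs (a k) * jap (node k) ^+ (N + N))); last by ring.
  by rewrite ler_wpM2l ?mulr_ge0.
have := cdec_sum (index_iota 0 n) (japX_ge0 N) H.
rewrite (_ : (fun t => _) = synth (index_iota 0 n) a); last first.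
  by apply/funext => t; rewrite synthE.
apply: cdec_mono; rewrite -!mulr_sumr -!mulrA.
rewrite !ler_wpM2l//.
have -> : \sum_(0 <= k < n) rapid (node k) = \sum_(0 <= k < n) rapid (node k - 0).
  by apply: eq_bigr => k _; rewrite subr0.
exact: HC.
Qed.

Lemma tempered_synth (u : tempered R d) r a :
  u (synth r a) = \sum_(k <- r) conjc (a k) * u (atom k).
Proof.
have /asboolP[ul _] := tempered_funP u.
have u0 : u 0 = 0.
  have := ul 1 0 0; rewrite scaler0 addr0 rmorph1 mul1r => /eqP.
  by rewrite addrC -subr_eq subrr eq_sym => /eqP.
rewrite /synth; elim: r => [|k r IH]; first by rewrite !big_nil.
by rewrite !big_cons ul IH.
Qed.

(* The remainder is bounded in a stronger seminorm and tends to 0 in L^2, hence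
   uniformly, hence by interpolation in the given seminorm. *)
Lemma schwartz_expansion N (f : schwartz R d) (eps : R) : 0 < eps ->
  \forall n \near \oo, sdec N eps (f - synth (index_iota 0 n) (fun k => inner f (atom k))).
Proof.
move=> e0; set c := fun k : nat => inner f (atom k).
(* [N.+1] where the claim has [N]: the interpolation in [dec_vanishX] loses one weight and one
   derivative. *)
have [C C0 HC] := inner_tfshift_decay (N.+1 + N.+1 + (d + d).+1) g.
have [F0 F00 hF0] := schwartz_sdec (N.+1 + N.+1 + (d + d).+1 + d.+1) f.
have [B B0 HB] := synth_sdec (mulr_ge0 C0 F00) (fun k => HC _ _ (node k) hF0).
have [F F_0 hF] := schwartz_sdec N.+1 f.
pose r n t := (f - synth (index_iota 0 n) c : schwartz R d) t.
have rE n t : r n t = f t - frame_part n f t by rewrite frame_partE.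
have hr n : sdec N.+1 (F + 2 * cabs (-1 : R[i]) * B) (r n).
  have := cdecD (japX_ge0 N.+1) hF (cdecZ (-1) (japX_ge0 N.+1) (HB n)).
  by rewrite (_ : (fun t => _) = r n)//; apply/funext => t; rewrite mulN1r.
set BB := F + _ in hr.
have BB0 : 0 <= BB := sdec_ge0 (hr 0%N).
have sup (q : nat -> 'rV[R]_d -> R) : (forall n, dec (japX N.+1) N.+1 BB (q n)) ->
    (forall n x, `|q n x| <= cabs (r n x)) ->
    \forall n \near \oo, dec (japX N) N eps (q n).
  move=> hq qr; apply: (dec_vanishX hq) e0 => e1 e10.
  have [eta eta0 Heta] := @small_integral_sup R d BB e1 BB0 e10.
  apply: filterS (parseval_seq (schwartz_L2 f) eta0) => n; rewrite -(@eq_sqint _ _ _ _ (r n)).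
    move=> rn; apply: Heta.
      rewrite -[BB]mul1r; apply: dec_weight (dec_leq _ (hq n)) => // x.
      by rewrite mul1r /japX exprn_ege1// jap_ge1.
    apply: le_lt_trans rn; apply: ge0_le_integral => //.
    - by move=> x _; rewrite lee_fin sqr_ge0.
    - by apply/measurable_EFinP; apply: measurable_funX; exact: diff_measurable (dec_diff (hq n)).
    - exact: (measurable_sq (schwartz_cmeas _)).
    - move=> x _; rewrite lee_fin -real_normK ?num_real// lerXn2r ?nnegrE ?cabs_ge0//.
  by move=> x; rewrite rE.
have H1 := sup (fun n x => complex.Re (r n x)) (fun n => (hr n).1) (fun n x => norm_Re _).
have H2 := sup (fun n x => complex.Im (r n x)) (fun n => (hr n).2) (fun n x => norm_Im _).
by near=> n; split; near: n.
Unshelve. all: by end_near. Qed.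

Lemma tempered_expansion (u : tempered R d) (f : schwartz R d) (eps : R) : 0 < eps ->
  \forall n \near \oo, cabs (u f - \sum_(0 <= k < n) conjc (inner f (atom k)) * u (atom k)) <= eps.
Proof.
move=> e0; have /asboolP ut := tempered_funP u; have [ul _] := ut.
have [N [C C0 HC]] := tempered_sdec ut.
have ee : 0 < eps / (C + 1) by rewrite divr_gt0// ltr_wpDl.
apply: filterS (schwartz_expansion N f ee) => n hn.
have := HC _ _ hn; rewrite addrC -scaleN1r ul tempered_synth rmorphN1 mulN1r addrC.
move=> H; apply: le_trans H _; rewrite mulrC -mulrA ler_piMr ?(ltW e0)//.
by rewrite mulrC ler_pdivrMr ?ltr_wpDl// mul1r lerDl.
Qed.

End FrameExpansion.

(** * Schur's test *)

Section SchurTest.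
Context d1 d2 (T1 : measurableType d1) (T2 : measurableType d2) (R : realType).
Variable m1 : {sigma_finite_measure set T1 -> \bar R}.
Variable m2 : {sigma_finite_measure set T2 -> \bar R}.

Lemma measurable_powR_comp d (T : measurableType d) (K : T -> R) (r : R) :
  measurable_fun setT K -> measurable_fun setT (fun x => K x `^ r).
Proof.
move=> mK; rewrite (_ : (fun x => _) = (@powR R ^~ r) \o K)//.
by apply: measurableT_comp; [exact: measurable_powR|].
Qed.

(** Convexity: the power function of exponent [r] lies above its tangent at [m]. Obtained from
    Young's inequality with the exponents [r] and [r / (r - 1)], the case [r = 1] being apart. *)
Lemma powR_tangent (r y m : R) : 1 <= r -> 0 <= y -> 0 < m ->
  r * m `^ (r - 1) * y <= y `^ r + (r - 1) * m `^ r.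
Proof.
rewrite le_eqVlt => /predU1P[<-|r1] y0 m0.
  by rewrite subrr powRr0 powRr1// mul0r addr0 !mul1r.
have r0 : 0 < r by lra.
pose q := r / (r - 1).
have q0 : 0 < q by rewrite divr_gt0// subr_gt0.
have rn : r != 0 by exact: lt0r_neq0.
have r1n : r - 1 != 0 by rewrite subr_eq0 gt_eqF.
have := conjugate_powR y0 (powR_ge0 m (r - 1)) r0 q0.
rewrite -powRrM (_ : (r - 1) * q = r); last by rewrite /q; field.
rewrite (_ : r^-1 + q^-1 = 1); last by rewrite /q; field; apply/andP.
move=> /(_ erefl) H.
have -> : r * m `^ (r - 1) * y = r * (y * m `^ (r - 1)) by ring.
have -> : y `^ r + (r - 1) * m `^ r = r * (y `^ r / r + m `^ r / q).
  by rewrite /q; field; apply/andP.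
by rewrite ler_pM2l.
Qed.

(** Jensen's inequality for a weight of mass at most [A]: the tangent inequality at [m = a / A] is
    integrated against [h]. Taking the tangent there, and not at the mean, allows [h] to have mass
    strictly below [A]. *)
Lemma jensen_weighted (A a r : R) (h G : T2 -> R) : 0 < A -> 0 <= a -> 1 <= r ->
  measurable_fun setT h -> measurable_fun setT G ->
  (forall y, 0 <= h y) -> (forall y, 0 <= G y) ->
  (\int[m2]_y (h y)%:E <= A%:E)%E ->
  (a%:E <= \int[m2]_y (h y * G y)%:E)%E ->
  ((a `^ r)%:E <= (A `^ (r - 1))%:E * \int[m2]_y (h y * G y `^ r)%:E)%E.
Proof.
move=> A0 a0 r1 mh mG h0 G0 hA ha.
have r0 : 0 < r by lra.
have mGr : measurable_fun setT (fun y => G y `^ r) by exact: measurable_powR_comp.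
have I0 : (0 <= \int[m2]_y (h y * G y `^ r)%:E)%E.
  by apply: integral_ge0 => y _; rewrite lee_fin mulr_ge0// powR_ge0.
move: a0; rewrite le_eqVlt => /predU1P[<-|a0].
  by rewrite powR0 ?gt_eqF// mule_ge0// lee_fin powR_ge0.
pose m := a / A; have m0 : 0 < m by rewrite divr_gt0.
have aE : a = m * A by rewrite /m divfK// gt_eqF.
have key : ((r * m `^ (r - 1) * a)%:E <=
    \int[m2]_y (h y * G y `^ r)%:E + ((r - 1) * m `^ r * A)%:E)%E.
  apply: (@le_trans _ _ ((r * m `^ (r - 1))%:E * \int[m2]_y (h y * G y)%:E)%E).
    by rewrite EFinM lee_wpmul2l// lee_fin mulr_ge0 ?powR_ge0// ltW.
  rewrite -ge0_integralZl//; last 3 first.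
  - by apply/measurable_EFinP; exact: measurable_funM.
  - by move=> y _; rewrite lee_fin mulr_ge0.
  - by rewrite lee_fin mulr_ge0 ?powR_ge0// ltW.
  apply: (@le_trans _ _ (\int[m2]_y ((h y * G y `^ r)%:E + ((r - 1) * m `^ r)%:E * (h y)%:E))%E).
    apply: ge0_le_integral => //.
    - by move=> y _; rewrite -EFinM lee_fin !mulr_ge0 ?powR_ge0// ltW.
    - by under eq_fun do rewrite -EFinM; apply/measurable_EFinP; apply: measurable_funM => //; exact: measurable_funM.
    - under eq_fun do rewrite -EFinM -EFinD; apply/measurable_EFinP; apply: measurable_funD; exact: measurable_funM.
    move=> y _; rewrite -!EFinM -EFinD lee_fin.
    rewrite (_ : r * m `^ (r - 1) * (h y * G y) = h y * (r * m `^ (r - 1) * G y)); last by ring.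
    rewrite (_ : h y * _ + _ = h y * (G y `^ r + (r - 1) * m `^ r)); last by ring.
    by rewrite ler_wpM2l// powR_tangent.
  have c0 : 0 <= (r - 1) * m `^ r by rewrite mulr_ge0 ?powR_ge0// subr_ge0.
  rewrite ge0_integralD//; last 4 first.
  - by move=> y _; rewrite lee_fin mulr_ge0 ?powR_ge0.
  - by apply/measurable_EFinP; exact: measurable_funM.
  - by move=> y _; rewrite -EFinM lee_fin mulr_ge0.
  - by under eq_fun do rewrite -EFinM; apply/measurable_EFinP; exact: measurable_funM.
  rewrite leeD2l// ge0_integralZl//; last 2 first.
  - exact/measurable_EFinP.
  - by move=> y _; rewrite lee_fin.
  by rewrite [leRHS]EFinM lee_wpmul2l.
have mr : m `^ r = m * m `^ (r - 1).
  by rewrite -{2}[m]powRr1 ?ltW// -powRD ?gt_eqF ?implybT// addrC subrK.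
have ar : a `^ r = A `^ (r - 1) * (m `^ r * A).
  rewrite aE powRM ?ltW// [A `^ r](_ : _ = A * A `^ (r - 1)); first by ring.
  by rewrite -{2}[A]powRr1 ?ltW// -powRD ?gt_eqF ?implybT// addrC subrK.
rewrite ar EFinM lee_wpmul2l ?lee_fin ?powR_ge0//.
move: key I0; case: (\int[m2]_y _)%E => [I|_ _|//]; last by rewrite leey.
rewrite -EFinD !lee_fin => key _.
have : r * m `^ (r - 1) * a = r * (m `^ r * A) by rewrite aE mr; ring.
move: key; move: (m `^ r) => mm; lra.
Qed.

Variable H : T1 * T2 -> R.
Variable A : R.
Hypotheses (mH : measurable_fun setT H) (H0 : forall p, 0 <= H p) (A0 : 0 < A).
Hypothesis H1 : forall x, (\int[m2]_y (H (x, y))%:E <= A%:E)%E.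
Hypothesis H2 : forall y, (\int[m1]_x (H (x, y))%:E <= A%:E)%E.

Let mHx x : measurable_fun setT (fun y => H (x, y)).
Proof. exact: (measurableT_comp mH (measurable_pair1 x)). Qed.

(** For finite [p], Jensen in [y] uses the bound on the integrals over [y] to the power [p - 1];
    after Tonelli the bound on the integrals over [x] enters once, and [A^(p - 1) * A = A^p]. For
    [p = +oo] the estimate is pointwise in [x]. *)
Lemma schur_test (F : T1 -> R) (G : T2 -> R) (p : \bar R) : (1 <= p)%E ->
  measurable_fun setT F -> measurable_fun setT G ->
  (forall x, 0 <= F x) -> (forall y, 0 <= G y) ->
  (forall x, ((F x)%:E <= \int[m2]_y (H (x, y) * G y)%:E)%E) ->
  (Lnorm m1 p (EFin \o F) <= A%:E * Lnorm m2 p (EFin \o G))%E.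
Proof.
move=> p1 mF mG F0 G0 FG; rewrite unlock; case: p p1 => [r| |//].
  rewrite lee_fin => r1; have r0 : 0 < r by lra.
  have absE (T : Type) (K : T -> R) x : (forall x, 0 <= K x) -> (`|(EFin \o K) x| `^ r = (K x `^ r)%:E)%E.
    by move=> K0; rewrite /= ger0_norm.
  under eq_integral do rewrite absE//.
  under [X in (_ <= _ * X `^ _)%E]eq_integral do rewrite absE//.
  have mpow d (T : measurableType d) (K : T -> R) : measurable_fun setT K -> measurable_fun setT (fun x => K x `^ r).
    exact: measurable_powR_comp.
  have step : (\int[m1]_x (F x `^ r)%:E <= (A `^ r)%:E * \int[m2]_y (G y `^ r)%:E)%E.
    have mHG : measurable_fun setT (fun q : T1 * T2 => H q * G q.2 `^ r).
      apply: measurable_funM => //; exact: (measurableT_comp (mpow _ _ _ mG) (@measurable_snd _ _ _ _)).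
    have HG0 q : (0%:E <= (H q * G q.2 `^ r)%:E)%E by rewrite lee_fin mulr_ge0// powR_ge0.
    apply: (@le_trans _ _ (\int[m1]_x ((A `^ (r - 1))%:E * \int[m2]_y (H (x, y) * G y `^ r)%:E))%E).
      apply: ge0_le_integral => //.
      - by move=> x _; rewrite lee_fin powR_ge0.
      - by apply/measurable_EFinP; exact: mpow.
      - apply: emeasurable_funM => //.
        by apply: (@measurable_fun_fubini_tonelli_F _ _ _ _ _ m2 (fun q => (H q * G q.2 `^ r)%:E)) => //; exact/measurable_EFinP.
      by move=> x _; apply: jensen_weighted.
    rewrite ge0_integralZl//; last 3 first.
    - by apply: (@measurable_fun_fubini_tonelli_F _ _ _ _ _ m2 (fun q => (H q * G q.2 `^ r)%:E)) => //; exact/measurable_EFinP.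
    - by move=> x _; apply: integral_ge0 => y _; exact: HG0 (x, y).
    - by rewrite lee_fin powR_ge0.
    have -> : (A `^ r = A `^ (r - 1) * A).
      by rewrite -{3}[A]powRr1 ?ltW// -powRD ?gt_eqF ?implybT// subrK.
    rewrite EFinM -muleA lee_wpmul2l ?lee_fin ?powR_ge0//.
    rewrite (fubini_tonelli (fun q => (H q * G q.2 `^ r)%:E))//; last exact/measurable_EFinP.
    rewrite -ge0_integralZl//; last 3 first.
    - by apply/measurable_EFinP; exact: mpow.
    - by move=> y _; rewrite lee_fin powR_ge0.
    - by rewrite lee_fin ltW.
    apply: ge0_le_integral => //.
    - by move=> y _; apply: integral_ge0 => x _; exact: HG0 (x, y).
    - by apply: (@measurable_fun_fubini_tonelli_G _ _ _ _ _ m1 (fun q => (H q * G q.2 `^ r)%:E)) => //; exact/measurable_EFinP.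
    - apply: emeasurable_funM => //; apply/measurable_EFinP; exact: mpow.
    move=> y _ /=; under eq_integral do rewrite mulrC EFinM.
    rewrite ge0_integralZl//; last 3 first.
    - by apply/measurable_EFinP; exact: (measurableT_comp mH (measurable_pair2 y)).
    - by move=> x _; rewrite lee_fin.
    - by rewrite lee_fin powR_ge0.
    by rewrite muleC lee_wpmul2r// lee_fin powR_ge0.
  have i0 : (0 <= \int[m1]_x (F x `^ r)%:E)%E by apply: integral_ge0 => x _; rewrite lee_fin powR_ge0.
  have j0 : (0 <= \int[m2]_x (G x `^ r)%:E)%E by apply: integral_ge0 => x _; rewrite lee_fin powR_ge0.
  apply: (@le_trans _ _ (((A `^ r)%:E * \int[m2]_y (G y `^ r)%:E) `^ r^-1)%E).
    have in0 (z : \bar R) : (0 <= z)%E -> z \in `[0, +oo]%E by move=> z0; rewrite in_itv /= z0 leey.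
    apply: gt0_ler_poweR; [by rewrite invr_ge0 ltW|exact: in0| |exact: step].
    by apply: in0; apply: mule_ge0 => //; rewrite lee_fin powR_ge0.
  rewrite poweRM ?lee_fin ?powR_ge0// poweR_EFin -powRrM divff ?gt_eqF// powRr1//.
  exact: ltW.
(* For [p = +oo] the norm is the essential supremum if the total mass is positive and 0 otherwise; a
   vanishing total mass is treated apart on either side. *)
move=> _; case: ifPn => [m10|_]; last first.
  case: ifPn => m20; rewrite ?mule0// mule_ge0// ?lee_fin ?(ltW A0)//.
  by apply: ess_sup_gee => //; apply: nearW => y; exact: abse_ge0.
apply/ess_supP; apply: nearW => x.
rewrite /= ger0_norm//; apply: le_trans (FG x) _.
have mHG : measurable_fun setT (fun y => (H (x, y) * G y)%:E).
  by apply/measurable_EFinP; exact: measurable_funM.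
case: ifPn => [m20|]; last first.
  rewrite -leNgt measure_le0 => /eqP m20.
  by rewrite (null_set_integral measurableT mHG)// mule0.
have := @ess_sup_ge _ _ _ m2 (abse \o (EFin \o G)).
have : (0 <= ess_sup m2 (abse \o (EFin \o G)))%E.
  by apply: ess_sup_gee => //; apply: nearW => y; exact: abse_ge0.
case: (ess_sup m2 _) => [S| |//]; last first.
  by move=> _ _; rewrite gt0_muley ?lte_fin// leey.
rewrite lee_fin => S0 GS.
apply: (@le_trans _ _ (\int[m2]_y (S%:E * (H (x, y))%:E))%E).
  apply: ae_ge0_le_integral => //.
  - by move=> y _; rewrite lee_fin mulr_ge0.
  - by move=> y _; rewrite -EFinM lee_fin mulr_ge0.
  - by apply: emeasurable_funM => //; exact/measurable_EFinP.
  apply: filterS GS => y; rewrite /= lee_fin ger0_norm// => GS _.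
  by rewrite -EFinM lee_fin mulrC ler_wpM2r.
rewrite ge0_integralZl//; last 2 first.
- exact/measurable_EFinP.
- by move=> y _; rewrite lee_fin.
by rewrite muleC lee_wpmul2r.
Qed.

End SchurTest.

(* The library proves sigma-finiteness of [counting] on [nat] without
   registering it, and Tonelli needs it. *)
HB.instance Definition _ (R : realType) :=
  @Measure_isSigmaFinite.Build _ _ _ (@counting nat R) (sigma_finite_counting R).

(** * Series as integrals against counting measure *)

Section CountingIntegral.
Context {R : realType}.
Local Notation cnt := (@counting nat R).
Implicit Types (a : nat -> R[i]) (h : nat -> R).

Lemma cmeas_nat a : cmeas a.
Proof. by split => _ Y _. Qed.

Lemma measurable_nat d (T : measurableType d) (f : nat -> T) : measurable_fun setT f.
Proof. by move=> _ Y _. Qed.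

Lemma measurable_nat_prod d (T : measurableType d) (f : nat * T -> R) :
  (forall k, measurable_fun setT (fun y => f (k, y))) -> measurable_fun setT f.
Proof.
move=> mf _ Y mY; rewrite setTI.
rewrite (_ : f @^-1` Y = \bigcup_k ([set k] `*` ((fun y => f (k, y)) @^-1` Y))).
  apply: bigcup_measurable => k _; apply: measurableX => //.
  by rewrite -[X in measurable X]setTI; exact: mf.
apply/seteqP; split=> [[k y] /= fY|[k y] /= [i _ [/= -> fY]]] //.
by exists k.
Qed.

Lemma measurable_prod_nat d (T : measurableType d) (f : T * nat -> R) :
  (forall k, measurable_fun setT (fun y => f (y, k))) -> measurable_fun setT f.
Proof.
move=> mf; have -> : f = (fun p => f (p.2, p.1)) \o (fun p => (p.2, p.1)).
  by apply/funext => -[].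
apply: measurableT_comp; first exact: measurable_nat_prod.
exact: measurable_swap.
Qed.

Lemma cmeas_prod_nat d (T : measurableType d) (f : T * nat -> R[i]) :
  (forall k, cmeas (fun y => f (y, k))) -> cmeas f.
Proof. by move=> mf; split; apply: measurable_prod_nat => k; [exact: (mf k).1|exact: (mf k).2]. Qed.

Lemma counting_integral_le h (B : R) : (forall k, 0 <= h k) ->
  (forall n, \sum_(0 <= k < n) h k <= B) -> (\int[cnt]_k (h k)%:E <= B%:E)%E.
Proof.
move=> h0 hB; rewrite ge0_integral_count; last by move=> k; rewrite lee_fin.
apply: nneseries_le_bound => [k|N]; first by rewrite lee_fin.
by rewrite sumEFin lee_fin.
Qed.

Lemma counting_partial_le h n : (forall k, 0 <= h k) ->
  ((\sum_(0 <= k < n) h k)%:E <= \int[cnt]_k (h k)%:E)%E.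
Proof.
move=> h0; rewrite ge0_integral_count; last by move=> k; rewrite lee_fin.
by rewrite -sumEFin; apply: nneseries_lim_ge => k _ _; rewrite lee_fin.
Qed.

Lemma counting_integrable h (B : R) : (forall k, 0 <= h k) ->
  (forall n, \sum_(0 <= k < n) h k <= B) -> cnt.-integrable setT (EFin \o h).
Proof.
move=> h0 hB; apply/integrableP; split; first exact: measurable_nat.
under eq_integral do rewrite /= ger0_norm//.
exact: le_lt_trans (counting_integral_le h0 hB) (ltry _).
Qed.

Lemma summable_cintegrable a h (B : R) : (forall k, cabs (a k) <= h k) ->
  (forall n, \sum_(0 <= k < n) h k <= B) -> cintegrable cnt a.
Proof.
move=> ah hB; apply: (cintegrable_le (cmeas_nat a) _ ah).
by apply: counting_integrable hB => k; apply: le_trans (ah k); exact: cabs_ge0.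
Qed.

Lemma cint_counting_partial a n :
  cint cnt (fun k => if (k < n)%N then a k else 0) = \sum_(0 <= k < n) a k.
Proof.
pose e i (k : nat) : R[i] := Complex (\1_[set i] k) 0.
have ci (i : nat) : (\int[cnt]_k (\1_[set i] k)%:E = 1)%E.
  by rewrite integral_indic// setIT /= /counting asboolT// fset_set1 cardfs1.
have mi (i : nat) : measurable [set i] by [].
have e1 k : e k k = 1.
  by apply: complex_ext => //=; rewrite indicE mem_set.
have e0 i k : i != k -> e i k = 0.
  move=> ik; apply: complex_ext => //=; rewrite indicE memNset//=.
  by move=> ki; rewrite ki eqxx in ik.
have je i : cintegrable cnt (e i).
  apply: (@cintegrable_le _ _ _ _ _ (\1_[set i])); first exact: cmeas_nat.
    apply/integrableP; split; first exact: measurable_nat.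
    rewrite (eq_integral (fun k => (\1_[set i] k)%:E)); last by move=> k _; rewrite /= ger0_norm.
    by rewrite ci ltry.
  by move=> k; rewrite cabs_real ger0_norm// indicE.
have E i : cint cnt (e i) = 1.
  apply: complex_ext; rewrite ?cRe_cint ?cIm_cint /=.
    by rewrite /Rintegral ci.
  by rewrite Rintegral_cst// mul0r.
transitivity (cint cnt (fun k => \sum_(0 <= i < n) a i * e i k)).
  apply: eq_cint => k.
  case: ifPn => kn.
    rewrite (bigD1_seq k) /= ?mem_index_iota ?iota_uniq//= big1 => [|i ik].
      by rewrite addr0 e1 mulr1.
    by rewrite e0 ?mulr0.
  rewrite big_seq big1// => i; rewrite mem_index_iota /= => inn.
  by rewrite e0 ?mulr0//; apply: contraNneq kn => <-.
rewrite cint_sum => [|i]; last exact: cintegrableZ.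
by apply: eq_bigr => i _; rewrite cintZ// E mulr1.
Qed.

Lemma cabs_cvg (z : nat -> R[i]) (l : R[i]) :
  (fun n => complex.Re (z n)) @ \oo --> complex.Re l ->
  (fun n => complex.Im (z n)) @ \oo --> complex.Im l ->
  forall eps, 0 < eps -> \forall n \near \oo, cabs (l - z n) <= eps.
Proof.
move=> zr zi eps e0; have e2 : 0 < eps / 2 by rewrite divr_gt0.
move/cvgrPdist_le : zr => /(_ _ e2) zr; move/cvgrPdist_le : zi => /(_ _ e2) zi.
near=> n; apply: le_trans (cabs_ReIm _) _; rewrite cReD cReN cImD cImN (splitr eps).
by apply: lerD; near: n.
Unshelve. all: by end_near. Qed.

(** Dominated convergence for the truncations of [a], whose integrals are the partial sums. *)
Lemma cint_counting_cvg a : cintegrable cnt a -> forall eps, 0 < eps ->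
  \forall n \near \oo, cabs (cint cnt a - \sum_(0 <= k < n) a k) <= eps.
Proof.
move=> [ma ja]; pose F n k := if (k < n)%N then a k else 0.
have H := @cint_dct _ _ _ cnt F a (fun k => cabs (a k)) (fun n => cmeas_nat _) ma ja.
have [n k|k|k|cr ci eps e0] := H.
- by rewrite /F; case: ifP => // _; rewrite cabs0 cabs_ge0.
- by apply: cvg_near_cst; exists k.+1 => // n /= kn; rewrite /F kn.
- by apply: cvg_near_cst; exists k.+1 => // n /= kn; rewrite /F kn.

by apply: filterS (cabs_cvg cr ci e0) => n; rewrite cint_counting_partial.
Qed.

Lemma cabs_eps_eq (x y : R[i]) : (forall eps, 0 < eps -> cabs (x - y) <= eps) -> x = y.
Proof.
move=> xy; apply/eqP; rewrite -subr_eq0; apply/eqP/cabs_eq0/eqP.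
rewrite eq_le cabs_ge0 andbT; apply/ler_addgt0Pr => e e0; rewrite add0r.
exact: xy.
Qed.

Lemma cint_counting_unique a (l : R[i]) : cintegrable cnt a ->
  (forall eps, 0 < eps -> \forall n \near \oo, cabs (l - \sum_(0 <= k < n) a k) <= eps) ->
  l = cint cnt a.
Proof.
move=> ja la; apply: cabs_eps_eq => eps e0.
have e2 : 0 < eps / 2 by rewrite divr_gt0.
have [n [h1 h2]] : exists n, cabs (l - \sum_(0 <= k < n) a k) <= eps / 2 /\
    cabs (cint cnt a - \sum_(0 <= k < n) a k) <= eps / 2.
  have [N1 _ H1] := la _ e2; have [N2 _ H2] := cint_counting_cvg ja e2.
  exists (maxn N1 N2); split; [apply: H1|apply: H2]; by rewrite /= ?leq_maxl ?leq_maxr.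
rewrite (_ : l - _ = (l - \sum_(0 <= k < n) a k) - (cint cnt a - \sum_(0 <= k < n) a k)).
  by apply: le_trans (cabsB _ _) _; lra.
by rewrite opprB addrA subrK.
Qed.

(** The inclusion of l^p in the bounded sequences. For [p = +oo] the essential supremum bounds every
    term, since no point is null for counting measure. *)
Lemma Lnorm_counting_bounded (F : nat -> R) (p : \bar R) : (1 <= p)%E ->
  (forall k, 0 <= F k) -> (Lnorm cnt p (EFin \o F) < +oo)%E -> exists B, forall k, F k <= B.
Proof.
move=> p1 F0; case: p p1 => [r| |//].
  rewrite lee_fin => r1; have r0 : 0 < r by lra.
  rewrite Lnorm_counting// => /lty_poweRy; rewrite invr_eq0 gt_eqF// => /(_ erefl).
  set S := (\sum_(_ <oo) _)%E => Slt.
  have FS k : ((F k `^ r)%:E <= S)%E.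
    have -> : ((F k `^ r)%:E = `|(EFin \o F) k| `^ r)%E by rewrite /= ger0_norm.
    apply: le_trans (nneseries_lim_ge k.+1 _); last by move=> i _ _; exact: poweR_ge0.
    rewrite big_nat_recr//= leeDr// sume_ge0// => i _; exact: poweR_ge0.
  have S0 : (0 <= S)%E by apply: le_trans (FS 0%N); rewrite lee_fin powR_ge0.
  exists ((fine S) `^ r^-1) => k.
  have FSk : F k `^ r <= fine S by rewrite -lee_fin fineK ?ge0_fin_numE.
  rewrite -[leLHS]powRr1// -(divff (lt0r_neq0 r0)) powRrM.
  by apply: ge0_ler_powR; rewrite ?nnegrE ?powR_ge0 ?fine_ge0// invr_ge0 ltW.
move=> _; rewrite unlock; case: ifPn => [c0|].
  have := @ess_sup_ge _ _ _ cnt (abse \o (EFin \o F)).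
  have S0 : (0 <= ess_sup cnt (abse \o (EFin \o F)))%E.
    by apply: ess_sup_gee => //; apply: nearW => y; exact: abse_ge0.
  case: (ess_sup cnt _) S0 => [S| //|//] _ [N [mN N0 HN]] _.
  exists S => k; apply: contrapT => kS.
  have kN : N k by apply: HN => /= H; apply: kS; move: H; rewrite lee_fin ger0_norm.
  have : (cnt [set k] <= cnt N)%E by apply: le_measure; rewrite ?inE// => _ ->.
  by rewrite N0 /counting asboolT// fset_set1 cardfs1 lee_fin ler10.
move=> /negP c0 _; exfalso; apply: c0.
suff E : cnt [set: nat] = +oo%E by rewrite [X in (_ < X)%E]E.
rewrite /counting; case: ifPn => // /asboolP fin.
by have := infinite_nat fin.
Qed.

End CountingIntegral.

(** * Modulation norms through frame coefficients *)

Section FrameCoefficients.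
Context {R : realType} {d : nat}.
Variables (g : schwartz R d) (A : 'M[R]_(d + d)) (b : nat -> 'cV[int]_(d + d)).
Hypotheses (injb : injective b) (surjb : forall k, exists n, b n = k).
Hypotheses (Au : A \in unitmx) (pf : parseval_frame g A).
Local Notation cnt := (@counting nat R).
Local Notation lam := (node A b).
Local Notation e := (atom g A b).
Implicit Types (u : tempered R d) (w f phi : schwartz R d) (z : 'rV[R]_(d + d)).

Lemma rapidBC z z' : rapid (z - z') = rapid (z' - z).
Proof. by rewrite /rapid japBC. Qed.

Lemma rapidE (m : nat) z : rapid z = (jap z ^+ (d + d).+1)^-1.
Proof. by rewrite /rapid powR_invn// jap_ge0. Qed.

(** [u] is controlled by one seminorm, and [sdec_tfshift] gives the growth of that seminorm on
    shifted windows. *)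
Lemma stft_poly u w : exists P, exists2 C, 0 <= C & forall z, cabs (stft w u z) <= C * jap z ^+ P.
Proof.
have /asboolP ut := tempered_funP u; have [N [C C0 HC]] := tempered_sdec ut.
have [C1 C10 HC1] := @sdec_tfshift R d N; have [W W0 hW] := schwartz_sdec N w.
exists (N + N)%N, (C * (C1 * W)) => [|z]; first by rewrite !mulr_ge0.
apply: le_trans (HC (tfshift z w) _ (HC1 _ _ z hW)) _.
by rewrite le_eqVlt; apply/orP; left; apply/eqP; ring.
Qed.

Lemma inner_atom_decay w M : exists2 C, 0 <= C & forall z k,
  cabs (inner (tfshift z w) (e k)) * jap (lam k - z) ^+ M <= C.
Proof.
have [C C0 HC] := inner_tfshift_decay M g; have [W W0 hW] := schwartz_sdec (M + d.+1) w.
exists (C * W) => [|z k]; first exact: mulr_ge0.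
by rewrite cabs_inner_tfshift; exact: HC.
Qed.

Lemma inner_atom_rapid w : exists2 C, 0 < C & forall z k,
  cabs (inner (tfshift z w) (e k)) <= C * rapid (z - lam k).
Proof.
have [C C0 HC] := inner_atom_decay w (d + d).+1; exists (C + 1) => [|z k]; first by rewrite ltr_wpDl.
rewrite rapidBC (rapidE 0) ler_pdivlMr ?exprn_gt0 ?jap_gt0//.
by apply: le_trans (HC z k) _; rewrite lerDl.
Qed.

Lemma lattice_rapid_gt0 : exists2 C : R, 0 < C & forall z n,
  \sum_(0 <= k < n) rapid (z - lam k) <= C.
Proof.
have [C C0 HC] := lattice_rapid injb Au; exists C; [exact: C0|move=> z n].
apply: le_trans (HC z n); rewrite le_eqVlt; apply/orP; left; apply/eqP.
by apply: eq_bigr => k _; exact: rapidBC.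
Qed.

Lemma rapid_node_sum : exists2 C : R, 0 < C & forall n, \sum_(0 <= k < n) rapid (lam k) <= C.
Proof.
have [C C0 HC] := lattice_rapid injb Au; exists C; [exact: C0|move=> n].
apply: le_trans (HC 0 n); rewrite le_eqVlt; apply/orP; left; apply/eqP.
by apply: eq_bigr => k _; rewrite subr0.
Qed.

Lemma rapid_integrable_cnt (C : R) : cnt.-integrable setT (EFin \o (fun k => C * rapid (lam k))).
Proof.
have [C0 C00 HC] := rapid_node_sum.
have j := @counting_integrable R (fun k => rapid (lam k)) C0 (fun k => rapid_ge0 _) HC.
exact: (integrableZl measurableT C j).
Qed.

Lemma coef_summable u f : cintegrable cnt (fun k => conjc (inner f (e k)) * u (e k)).
Proof.
have [P [C C0 HC]] := stft_poly u g.
have [F F0 HF] := inner_tfshift_decay (P + (d + d).+1) g.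
have [B B0 hB] := schwartz_sdec (P + (d + d).+1 + d.+1) f.
apply: (cintegrable_le (cmeas_nat _) (rapid_integrable_cnt (F * B * C))) => k.
rewrite cabsM cabsJ.
have h1 := HF _ _ (lam k) hB; have h2 : cabs (u (e k)) <= C * jap (lam k) ^+ P := HC (lam k).
have JP : 0 < jap (lam k) ^+ P by rewrite exprn_gt0// jap_gt0.
apply: le_trans (ler_wpM2l (cabs_ge0 _) h2) _.
rewrite (rapidE 0) ler_pdivlMr ?exprn_gt0 ?jap_gt0//.
rewrite (_ : _ * _ = cabs (inner f (tfshift_fun (lam k) g)) * jap (lam k) ^+ (P + (d + d).+1) * C).
  by rewrite ler_wpM2r.
by rewrite exprD; move: (inner _ _) => c; ring.
Qed.

Lemma frame_expansion u f : u f = cint cnt (fun k => conjc (inner f (e k)) * u (e k)).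
Proof.
apply: cint_counting_unique; first exact: coef_summable.
by move=> eps e0; exact: tempered_expansion.
Qed.

Lemma cmeas_inner_l w f : cmeas (fun z => inner (tfshift z w) f).
Proof.
rewrite (_ : (fun z => _) = fun z => conjc (inner f (tfshift z w))).
  by apply: cmeasJ; apply: cmeas_inner_tfshift; exact: schwartz_cmeas.
by apply/funext => z; rewrite -innerJ.
Qed.

(** [u] is an abstract functional; measurability in [z] is read off the frame expansion, a series of
    measurable functions of [z]. *)
Lemma cmeas_stft u w : cmeas (stft w u).
Proof.
rewrite (_ : stft w u = fun z => cint cnt (fun k => conjc (inner (tfshift z w) (e k)) * u (e k))).
  pose F (p : 'rV[R]_(d + d) * nat) := conjc (inner (tfshift p.1 w) (e p.2)) * u (e p.2).
  have mF : cmeas F.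
    apply: cmeas_prod_nat => k.
    have H := cmeasM (cmeasJ (cmeas_inner_l w (e k))) (cmeas_cst _ (u (e k))).
    exact: H.
  have H := cmeas_cint cnt mF.
  exact: H.
by apply/funext => z; exact: frame_expansion.
Qed.

Lemma jap_peetre z z' M : (jap (z - z') ^+ M)^-1 <= (2 * jap z) ^+ M * (jap z' ^+ M)^-1.
Proof.
rewrite ler_pdivlMr ?exprn_gt0 ?jap_gt0// mulrC ler_pdivrMr ?exprn_gt0 ?jap_gt0//.
rewrite -exprMn lerXn2r ?nnegrE ?mulr_ge0 ?jap_ge0//.
by rewrite japBC jap_shift.
Qed.

(** Insert the frame expansion of [u] at [pi(z) w], exchange sum and integral, and apply Moyal's
    identity to each atom; what remains is the frame expansion of [u f]. *)
Lemma reproducing w : w <> 0 -> exists2 kap : R[i], kap != 0 & forall u f,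
  cintegrable (leb R (d + d)) (fun z => conjc (inner f (tfshift z w)) * stft w u z) /\
  kap * u f = cint (leb R (d + d)) (fun z => conjc (inner f (tfshift z w)) * stft w u z).
Proof.
move=> w0; have [kap kap0 Hm] := moyal w0; exists kap => // u f.
have [P [C C0 HC]] := stft_poly u g.
(* Peetre's inequality turns the decay in [z - lam k] of the atoms into [<lam k>^(-M')], which beats
   the growth [<lam k>^P] of the coefficients with [(d + d).+1] powers to spare. The cost [<z>^M']
   is paid by the decay of [inner f (tfshift z w)]. *)
pose M' := (P + (d + d).+1)%N.
have [D D0 HD] := inner_atom_decay w M'.
have [F F0 HF] := inner_tfshift_decay (M' + (d + d).+1) w.
have [B B0 hB] := schwartz_sdec (M' + (d + d).+1 + d.+1) f.
pose G (p : 'rV[R]_(d + d) * nat) :=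
  conjc (inner f (tfshift p.1 w)) * (conjc (inner (tfshift p.1 w) (e p.2)) * u (e p.2)).
have mG : cmeas G.
  apply: cmeas_prod_nat => k; apply: (cmeasM (cmeasJ (cmeas_inner_tfshift (schwartz_cmeas f) (schwartz_cmeas w)))).
  have H := cmeasM (cmeasJ (cmeas_inner_l w (e k))) (cmeas_cst _ (u (e k))).
  exact: H.
pose K : R := F * B * (2 ^+ M' * (D * C)).
have fz z : cabs (inner f (tfshift z w)) <= F * B * (jap z ^+ (M' + (d + d).+1))^-1.
  by rewrite ler_pdivlMr ?exprn_gt0 ?jap_gt0//; exact: HF.
have GB z k : cabs (G (z, k)) <= (K * rapid z) * (1 * rapid (lam k)).
  rewrite /G [_.1]/= [_.2]/= !cabsM !cabsJ.
  have h1 := fz z.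
  have h2 : cabs (inner (tfshift z w) (e k)) <= D * ((2 * jap z) ^+ M' * (jap (lam k) ^+ M')^-1).
    apply: (@le_trans _ _ (D * (jap (z - lam k) ^+ M')^-1)).
      by rewrite ler_pdivlMr ?exprn_gt0 ?jap_gt0// japBC; exact: HD.
    by rewrite ler_wpM2l// jap_peetre.
  have h3 : cabs (u (e k)) <= C * jap (lam k) ^+ P := HC (lam k).
  have h23 := ler_pM (cabs_ge0 _) (cabs_ge0 _) h2 h3.
  have := ler_pM (cabs_ge0 _) (mulr_ge0 (cabs_ge0 _) (cabs_ge0 _)) h1 h23.
  rewrite [leRHS](_ : _ = K * rapid z * (1 * rapid (lam k))) //.
  have EM : jap (lam k) ^+ M' = jap (lam k) ^+ P * jap (lam k) ^+ (d + d).+1 by rewrite -exprD.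
  rewrite !(rapidE 0) /K exprMn [jap z ^+ (M' + _)]exprD EM.
  have := @jap_gt0 R _ z; have := @jap_gt0 R _ (lam k).
  move=> /lt0r_neq0 x0 /lt0r_neq0 y0; rewrite mul1r.
  have xn n : jap z ^+ n != 0 by rewrite expf_neq0.
  have yn n : jap (lam k) ^+ n != 0 by rewrite expf_neq0.
  move: (xn M') (xn (d + d).+1) (yn P) (yn (d + d).+1).
  move: (jap z ^+ M') (jap z ^+ (d + d).+1) (jap (lam k) ^+ P) (jap (lam k) ^+ (d + d).+1) (2 ^+ M').
  move=> a1 a2 a3 a4 a5 n1 n2 n3 n4.
  by field; rewrite n1 n2 n3 n4.
have ja : (leb R (d + d)).-integrable setT (EFin \o (fun z => K * rapid z)) by exact: integrable_rapid.
have jb := rapid_integrable_cnt 1.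
have jG := @dominated_prod_lty _ _ _ _ R (leb R (d + d)) cnt G _ _ mG ja jb GB.
have E z : conjc (inner f (tfshift z w)) * stft w u z = cint cnt (fun k => G (z, k)).
  by rewrite /stft frame_expansion -(cintZ _ (coef_summable u (tfshift z w))).
have jst : cintegrable (leb R (d + d)) (fun z => conjc (inner f (tfshift z w)) * stft w u z).
  have [Q [S S0 HS]] := stft_poly u w.
  have [F' F'0 HF'] := inner_tfshift_decay (Q + (d + d).+1) w.
  have [B' B'0 hB'] := schwartz_sdec (Q + (d + d).+1 + d.+1) f.
  apply: (@cintegrable_le _ _ _ _ _ (fun z => F' * B' * S * rapid z)).
  - apply: cmeasM; last exact: cmeas_stft.
    by apply: cmeasJ; apply: cmeas_inner_tfshift; exact: schwartz_cmeas.
  - exact: integrable_rapid.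
  move=> z; rewrite cabsM cabsJ; apply: le_trans (ler_wpM2l (cabs_ge0 _) (HS z)) _.
  rewrite (rapidE 0) ler_pdivlMr ?exprn_gt0 ?jap_gt0//.
  rewrite (_ : _ * _ = cabs (inner f (tfshift_fun z w)) * jap z ^+ (Q + (d + d).+1) * S).
    by rewrite ler_wpM2r//; exact: HF'.
  by rewrite exprD; move: (inner _ _) => c; ring.
split=> //; rewrite (eq_cint _ E) (@cint_fubini_dom _ _ _ _ R (leb R (d + d)) cnt G _ _ mG ja jb GB).
rewrite frame_expansion -(cintZ _ (coef_summable u f)); apply: eq_cint => k.
rewrite mulrA mulrC -[conjc (inner f (e k))]innerJ -Hm.
rewrite -[LHS]cintZ; first by apply: eq_cint => z; rewrite /G [_.1]/= [_.2]/= -(innerJ (tfshift z w)); ring.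
split; first by apply: cmeasM; [|apply: cmeasJ]; apply: cmeas_inner_tfshift; exact: schwartz_cmeas.
have [F1 F10 HF1] := inner_tfshift_rapid 0 f w.
have [m1 j1] := inner_tfshift_integrable (e k) w.
suff [] : cintegrable (leb R (d + d)) (fun z => inner (e k) (tfshift z w) * conjc (inner f (tfshift z w))) by [].
apply: (@cintegrable_le _ _ _ _ _ (fun z => F1 * cabs (inner (e k) (tfshift z w)))).
- by apply: cmeasM; [|apply: cmeasJ]; apply: cmeas_inner_tfshift; exact: schwartz_cmeas.
- exact: (integrableZl _ _ j1).
- move=> z; rewrite cabsM cabsJ mulrC ler_wpM2r ?cabs_ge0//.
  by have := HF1 z; rewrite oppr0 powRr0 mulr1.
Qed.

Lemma rapid_integral : exists2 J : R, 0 <= J & forall v : 'rV[R]_(d + d),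
  (\int[leb R (d + d)]_z (rapid (z - v))%:E = J%:E)%E.
Proof.
exists (\int[leb R (d + d)]_z rapid z) => [|v].
  by apply: Rintegral_ge0 => z _; exact: rapid_ge0.
rewrite (integral_jap_shift (d + d).+1%:R v) /Rintegral fineK//.
have := @integrable_rapid R (d + d) 1.
move=> /(integrable_fin_num measurableT); congr (_ \is a fin_num).
by apply: eq_integral => z _; rewrite /= mul1r.
Qed.

Lemma measurable_rapid_sub d0 (T : measurableType d0) (f : T -> 'rV[R]_(d + d)) (C : R) v :
  measurable_fun setT f -> measurable_fun setT (fun x => C * rapid (f x - v)).
Proof.
move=> mf; apply: measurable_funM => //; apply: measurable_japN.
by apply: measurable_subrV.
Qed.

(** The hypotheses of Schur's test in both variables, for the kernel between phase space and lattice
    that dominates both analysis and synthesis. *)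
Lemma rapid_schur (C : R) : 0 < C -> exists2 D : R, 0 < D &
  (forall v, (\int[leb R (d + d)]_z (C * rapid (z - v))%:E <= D%:E)%E) /\
  (forall z, (\int[cnt]_k (C * rapid (z - lam k))%:E <= D%:E)%E).
Proof.
move=> C0; have [J J0 HJ] := rapid_integral; have [L L0 HL] := lattice_rapid_gt0.
exists (C * (J + L)); first by rewrite mulr_gt0// ltr_wpDl.
split=> [v|z].
  under eq_integral do rewrite EFinM.
  rewrite ge0_integralZl//; last 3 first.
  - apply/measurable_EFinP; have := @measurable_rapid_sub _ _ id 1 v (@measurable_id _ _ setT).
    by under eq_fun do rewrite mul1r.
  - by move=> z _; rewrite lee_fin rapid_ge0.
  - by rewrite lee_fin ltW.
  by rewrite HJ -EFinM lee_fin ler_wpM2l ?(ltW C0)// lerDl ltW.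
apply: counting_integral_le => [k|n]; first by rewrite mulr_ge0 ?rapid_ge0// ltW.
rewrite -mulr_sumr ler_wpM2l ?(ltW C0)//; apply: le_trans (HL z n) _.
by rewrite lerDr.
Qed.

(** The reproducing formula at [f = e k] bounds [|u (e k)|] by the integral of [|stft w u|] against
    a rapidly decaying kernel, to which Schur's test applies. *)
Lemma coef_Lnorm w : w <> 0 -> exists2 D : R, 0 < D & forall u (p : \bar R), (1 <= p)%E ->
  (Lnorm cnt p (EFin \o (fun k => cabs (u (e k)))) <= D%:E * modnorm w p u)%E.
Proof.
move=> w0; have [kap kap0 Hk] := reproducing w0; have [C C0 HC] := inner_atom_rapid w.
have ck : 0 < cabs kap.
  by rewrite lt_neqAle cabs_ge0 andbT eq_sym; apply: contra_neq kap0; exact: cabs_eq0.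
have CC : 0 < C / cabs kap by rewrite divr_gt0.
have [D D0 [H1 H2]] := rapid_schur CC; exists D => // u p p1.
pose H (q : nat * 'rV[R]_(d + d)) := C / cabs kap * rapid (q.2 - lam q.1).
apply: (@schur_test _ _ _ _ R cnt (leb R (d + d)) H) => //.
- have mk k := @measurable_rapid_sub _ _ id (C / cabs kap) (lam k) (@measurable_id _ _ setT).
  by apply: measurable_nat_prod => k; exact: (mk k).
- by move=> q; rewrite mulr_ge0 ?rapid_ge0// ltW.
- by move=> k; exact: (H1 (lam k)).
- exact: cmeas_cabs (cmeas_stft u w).
- by move=> k; exact: cabs_ge0.
- by move=> z; exact: cabs_ge0.
move=> k; have [jk E] := Hk u (e k).
have uE : u (e k) = kap^-1 * cint (leb R (d + d)) (fun z => conjc (inner (e k) (tfshift z w)) * stft w u z).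
  by rewrite -E mulKf.
have cV : cabs kap^-1 = (cabs kap)^-1.
  apply: (mulIf (lt0r_neq0 ck)); rewrite -cabsM !mulVf//; last exact: lt0r_neq0.
  by rewrite (_ : 1 = Complex 1 0) // cabs_real normr1.
rewrite uE -cintZ// ; have jk2 := cintegrableZ kap^-1 jk.
apply: le_trans (cabs_cintE jk2) _; apply: ge0_le_integral => //.
- by move=> z _; rewrite lee_fin cabs_ge0.
- by have [_ /integrableP[]] := jk2.
- apply/measurable_EFinP; apply: measurable_funM.
    exact: (@measurable_rapid_sub _ _ id (C / cabs kap) (lam k) (@measurable_id _ _ setT)).
  exact: cmeas_cabs (cmeas_stft u w).
move=> z _; rewrite lee_fin !cabsM cabsJ cV mulrA ler_wpM2r ?cabs_ge0//.
rewrite /H [_.1]/= [_.2]/= mulrAC mulrC ler_wpM2r ?invr_ge0 ?cabs_ge0//.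
by rewrite innerJ cabsJ; exact: HC.
Qed.

(** Every l^p consists of bounded sequences, so these are a common domain on which synthesis and the
    matrix act for all [p] at once. *)
Definition bounded_seq (c : nat -> R[i]) := exists B : R, forall k, cabs (c k) <= B.

(** The weak sum of the [c l *: e l]: the conjugate of [inner phi (e l)] is the bracket of [e l]
    with [phi], and its rapid decay in [l] gives convergence for bounded [c]. *)
Definition resynth_fun (c : nat -> R[i]) phi : R[i] :=
  cint cnt (fun l => c l * conjc (inner phi (e l))).

Lemma bounded_rapid_integrable (c : nat -> R[i]) f : bounded_seq c ->
  cintegrable cnt (fun l => c l * conjc (inner f (e l))).
Proof.
move=> [B cB]; have B0 : 0 <= B by apply: le_trans (cB 0%N); exact: cabs_ge0.
have [F F0 HF] := inner_tfshift_decay (d + d).+1 g.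
have [W W0 hW] := schwartz_sdec ((d + d).+1 + d.+1) f.
apply: (cintegrable_le (cmeas_nat _) (rapid_integrable_cnt (B * (F * W)))) => l.
rewrite cabsM cabsJ -mulrA; apply: ler_pM; rewrite ?cabs_ge0//.
by rewrite (rapidE 0) ler_pdivlMr ?exprn_gt0 ?jap_gt0//; exact: HF.
Qed.

Lemma inner_linearl (c : R[i]) f h phi : inner (c *: f + h) phi = c * inner f phi + inner h phi.
Proof.
transitivity (cint (leb R d) (fun t => c * (f t * conjc (phi t)) + h t * conjc (phi t))).
  apply: eq_cint => t; rewrite mulrA -mulrDl; congr (_ * _).
rewrite cintD; [|by apply: cintegrableZ; exact: schwartz_innerI|exact: schwartz_innerI].
by rewrite cintZ//; exact: schwartz_innerI.
Qed.

Lemma resynth_tempered c : bounded_seq c -> resynth_fun c \in @tempered_pred R d.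
Proof.
move=> cb; have [B cB] := cb; have B0 : 0 <= B by apply: le_trans (cB 0%N); exact: cabs_ge0.
have [F F0 HF] := inner_tfshift_decay (d + d).+1 g.
have [L L0 HL] := rapid_node_sum.
apply: (@sdec_tempered R d _ ((d + d).+1 + d.+1) (B * F * L)).
- by rewrite !mulr_ge0// ltW.
- move=> a f h; rewrite /resynth_fun.
  rewrite -(cintZ _ (bounded_rapid_integrable f cb)) -cintD; last 2 first.
  + by apply: cintegrableZ; exact: bounded_rapid_integrable.
  + exact: bounded_rapid_integrable.
  by apply: eq_cint => l; rewrite inner_linearl conjD conjM; ring.
move=> f W hW; have W0 := sdec_ge0 hW.
have jc := bounded_rapid_integrable f cb.
rewrite -lee_fin; apply: le_trans (cabs_cintE jc) _.
apply: (@le_trans _ _ (\int[cnt]_l (B * (F * W) * rapid (lam l))%:E)%E).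
  apply: ge0_le_integral => //; try exact: measurable_nat.
  - by move=> l _; rewrite lee_fin cabs_ge0.
  move=> l _; rewrite lee_fin cabsM cabsJ -mulrA; apply: ler_pM; rewrite ?cabs_ge0//.
  by rewrite (rapidE 0) ler_pdivlMr ?exprn_gt0 ?jap_gt0//; exact: HF.
apply: counting_integral_le => [l|n]; first by rewrite !mulr_ge0 ?rapid_ge0.
rewrite -mulr_sumr [leRHS](_ : _ = B * (F * W) * L); last by ring.
by rewrite ler_wpM2l// !mulr_ge0.
Qed.

(** Made total because [extends_boundedly] asks for a total map; the value 0 at unbounded sequences
    is a placeholder that is never met on the modulation spaces. *)
Definition resynth (c : nat -> R[i]) : tempered R d :=
  if pselect (bounded_seq c) is left h then Tempered (resynth_tempered h) else 0.

Lemma resynthE c phi : bounded_seq c -> resynth c phi = resynth_fun c phi.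
Proof. by move=> cb; rewrite /resynth; case: pselect. Qed.

Lemma tempered_ext (u v : tempered R d) : (forall phi, u phi = v phi) -> u = v.
Proof. by move=> uv; apply: val_inj; apply/funext => phi; exact: uv. Qed.

Lemma resynth_coef u : bounded_seq (fun k => u (e k)) -> resynth (fun k => u (e k)) = u.
Proof.
move=> ub; apply: tempered_ext => phi; rewrite resynthE// frame_expansion.
by apply: eq_cint => k; rewrite mulrC.
Qed.

(** Schur's test in the direction opposite to [coef_Lnorm], from sequences to functions on phase
    space. *)
Lemma resynth_Lnorm w : exists2 D : R, 0 < D & forall c (p : \bar R), (1 <= p)%E ->
  bounded_seq c -> (modnorm w p (resynth c) <= D%:E * Lnorm cnt p (EFin \o (fun k => cabs (c k))))%E.
Proof.
have [C C0 HC] := inner_atom_rapid w; have [D D0 [H1 H2]] := rapid_schur C0.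
exists D => // c p p1 cb.
pose H (q : 'rV[R]_(d + d) * nat) := C * rapid (q.1 - lam q.2).
have := @schur_test _ _ _ _ R (leb R (d + d)) cnt H D; apply => //.
- have mk k := @measurable_rapid_sub _ _ id C (lam k) (@measurable_id _ _ setT).
  by apply: measurable_prod_nat => k; exact: (mk k).
- by move=> q; rewrite mulr_ge0 ?rapid_ge0// ltW.
- by move=> l; exact: (H1 (lam l)).
- exact: cmeas_cabs (cmeas_stft _ w).
- by move=> z; exact: cabs_ge0.
- by move=> k; exact: cabs_ge0.
move=> z; rewrite /stft resynthE//; have jc := bounded_rapid_integrable (tfshift z w) cb.
apply: le_trans (cabs_cintE jc) _; apply: ge0_le_integral => //; try exact: measurable_nat.
- by move=> l _; rewrite lee_fin cabs_ge0.
move=> l _; rewrite lee_fin cabsM cabsJ mulrC ler_wpM2r ?cabs_ge0//; exact: HC.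
Qed.

End FrameCoefficients.

(** * The extended operator *)

Section MatrixOperator.
Context {R : realType} {d : nat}.
Variables (g : schwartz R d) (A : 'M[R]_(d + d)) (b : nat -> 'cV[int]_(d + d)).
Hypotheses (injb : injective b) (surjb : forall k, exists n, b n = k).
Hypotheses (Au : A \in unitmx) (pf : parseval_frame g A).
Variables (T : schwartz R d -> tempered R d) (K : nat -> nat -> R) (C : R).
Hypotheses (Tl : linear T) (Tc : continuous_op T) (C0 : 0 < C).
Local Notation cnt := (@counting nat R).
Local Notation lam := (node A b).
Local Notation e := (atom g A b).
Hypothesis TK : forall k l, cabs (T (e k) (e l)) <= K l k.
Hypothesis K1 : forall l n, \sum_(0 <= k < n) K l k <= C.
Hypothesis K2 : forall k n, \sum_(0 <= l < n) K l k <= C.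
Implicit Types (u : tempered R d) (w f phi : schwartz R d) (c : nat -> R[i]).

Let K0 l k : 0 <= K l k.
Proof. by apply: le_trans (TK k l); exact: cabs_ge0. Qed.

(** [l] is the target and [k] the source index, in the majorant [K l k] as well; the entry is the
    bracket of [T (e k)] with [e l]. *)
Definition matrix_op c (l : nat) : R[i] := cint cnt (fun k => T (e k) (e l) * c k).

Lemma matrix_op_integrable c l : bounded_seq c -> cintegrable cnt (fun k => T (e k) (e l) * c k).
Proof.
move=> [B cB]; have B0 : 0 <= B by apply: le_trans (cB 0%N); exact: cabs_ge0.
apply: (@summable_cintegrable _ _ (fun k => B * K l k) (B * C)) => [k|n].
  by rewrite cabsM mulrC; apply: ler_pM; rewrite ?cabs_ge0.
by rewrite -mulr_sumr ler_wpM2l.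
Qed.

Lemma matrix_op_le c l : bounded_seq c ->
  ((cabs (matrix_op c l))%:E <= \int[cnt]_k (K l k * cabs (c k))%:E)%E.
Proof.
move=> cb; apply: le_trans (cabs_cintE (matrix_op_integrable l cb)) _.
apply: ge0_le_integral => //; try exact: measurable_nat.
- by move=> k _; rewrite lee_fin cabs_ge0.
- by move=> k _; rewrite lee_fin cabsM ler_wpM2r ?cabs_ge0.
Qed.

Lemma matrix_op_bounded c : bounded_seq c -> bounded_seq (matrix_op c).
Proof.
move=> cb; have [B cB] := cb; have B0 : 0 <= B by apply: le_trans (cB 0%N); exact: cabs_ge0.
exists (B * C) => l; rewrite -lee_fin; apply: le_trans (matrix_op_le l cb) _.
apply: counting_integral_le => [k|n]; first by rewrite mulr_ge0 ?cabs_ge0.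
apply: (@le_trans _ _ (\sum_(0 <= k < n) B * K l k)).
  by apply: ler_sum => k _; rewrite mulrC ler_wpM2r.
by rewrite -mulr_sumr ler_wpM2l.
Qed.

Lemma matrix_op_Lnorm c (p : \bar R) : (1 <= p)%E -> bounded_seq c ->
  (Lnorm cnt p (EFin \o (fun l => cabs (matrix_op c l))) <=
   C%:E * Lnorm cnt p (EFin \o (fun k => cabs (c k))))%E.
Proof.
move=> p1 cb; pose H (q : nat * nat) := K q.1 q.2.
have := @schur_test _ _ _ _ R cnt cnt H C; apply => //; try exact: measurable_nat.
- by apply: measurable_nat_prod => k; exact: measurable_nat.
- by move=> q; exact: K0.
- by move=> l; apply: counting_integral_le => [k|n]; [exact: K0|exact: K1].
- by move=> k; apply: counting_integral_le => [l|n]; [exact: K0|exact: K2].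
- by move=> l; exact: cabs_ge0.
- by move=> k; exact: cabs_ge0.
- by move=> l; exact: matrix_op_le.
Qed.

Lemma matrix_op_linear (a : R[i]) c c' l : bounded_seq c -> bounded_seq c' ->
  matrix_op (fun k => a * c k + c' k) l = a * matrix_op c l + matrix_op c' l.
Proof.
move=> cb c'b; have j := matrix_op_integrable l cb; have j' := matrix_op_integrable l c'b.
rewrite /matrix_op -(cintZ _ j) -cintD//; last exact: cintegrableZ.
by apply: eq_cint => k; ring.
Qed.

Lemma T_synth r a phi : T (synth g A b r a) phi = \sum_(k <- r) a k * T (e k) phi.
Proof.
have T0 : T 0 = 0.
  have := Tl 1 0 0; rewrite scaler0 addr0 scale1r => /(congr1 (fun x => x - T 0)).
  by rewrite subrr addrK.
rewrite /synth; elim: r => [|k r IH]; first by rewrite !big_nil T0.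
by rewrite !big_cons Tl -IH.
Qed.

Lemma inner_bounded f : bounded_seq (fun k => inner f (e k)).
Proof.
have [B B0 HB] := inner_tfshift_rapid 0 f g; exists B => k.
by have := HB (lam k); rewrite oppr0 powRr0 mulr1.
Qed.

(** [T] may be applied term by term, because the frame expansion of [f] converges in the seminorm
    that controls [T] tested against [e l]. *)
Lemma matrix_op_inner f l : matrix_op (fun k => inner f (e k)) l = T f (e l).
Proof.
have cb := inner_bounded f; apply/esym.
apply: cint_counting_unique; first exact: matrix_op_integrable.
move=> eps eps0; have [N [D HD]] := Tc (e l).
(* The 2 is the factor of [seminorm_le_sdec]; the modulus of [D] is taken because [continuous_op]
   prescribes no sign for its constant. *)
have ee : 0 < eps / (2 * (`|D| + 1)) by rewrite divr_gt0// mulr_gt0// ltr_wpDl.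
apply: filterS (schwartz_expansion injb surjb Au pf N f ee) => n hn.
have -> : T f (e l) - \sum_(0 <= k < n) T (e k) (e l) * inner f (e k) =
    T (f - synth g A b (index_iota 0 n) (fun k => inner f (e k))) (e l).
  have -> : f - synth g A b (index_iota 0 n) (fun k => inner f (e k)) =
     -1 *: synth g A b (index_iota 0 n) (fun k => inner f (e k)) + f by rewrite scaleN1r addrC.
  rewrite Tl.
  have -> : (-1 *: T (synth g A b (index_iota 0 n) (fun k => inner f (e k))) + T f : tempered R d) (e l) =
     -1 * T (synth g A b (index_iota 0 n) (fun k => inner f (e k))) (e l) + T f (e l) by [].
  rewrite T_synth mulN1r addrC; congr (- _ + _).
  by apply: eq_bigr => k _; exact: mulrC.
have := HD (f - synth g A b (index_iota 0 n) (fun k => inner f (e k))).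
have := seminorm_le_sdec hn; have := seminorm_ge0 N (f - synth g A b (index_iota 0 n) (fun k => inner f (e k))).
rewrite -(fineK (seminorm_fin N _)) -EFinM !lee_fin.
set s := fine _ => s0 s1 h; apply: le_trans h _.
apply: le_trans (ler_wpM2r s0 (ler_norm D)) _.
apply: le_trans (ler_wpM2l (normr_ge0 D) s1) _.
have D1 : 0 < `|D| + 1 by rewrite ltr_wpDl.
rewrite [leLHS](_ : _ = eps * (`|D| / (`|D| + 1))); last by field; exact: lt0r_neq0.
by rewrite ler_piMr ?(ltW eps0)// ler_pdivrMr// mul1r lerDl.
Qed.

(** Analysis, matrix, synthesis. Neither [p] nor a window enters, so the extensions to all the
    modulation spaces are restrictions of one map. *)
Definition op_ext u : tempered R d := resynth g injb Au (matrix_op (fun k => u (e k))).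

Lemma op_ext_represents f u : represents f u -> op_ext u = T f.
Proof.
move=> fu; have uE : (fun k => u (e k)) = (fun k => inner f (e k)).
  by apply/funext => k; exact: fu.
have TE : matrix_op (fun k => u (e k)) = (fun l => T f (e l)).
  by apply/funext => l; rewrite uE matrix_op_inner.
rewrite /op_ext TE resynth_coef// -TE uE.
by apply: matrix_op_bounded; exact: inner_bounded.
Qed.

Lemma modspace_bounded w (p : \bar R) u : w <> 0 -> (1 <= p)%E -> modspace w p u ->
  bounded_seq (fun k => u (e k)).
Proof.
move=> w0 p1 Mu; have [D D0 HD] := coef_Lnorm injb surjb Au pf w0.
have [B HB] : exists B, forall k, cabs (u (e k)) <= B.
  apply: (Lnorm_counting_bounded p1) => [k|]; first exact: cabs_ge0.
  apply: le_lt_trans (HD u p p1) _; apply: lte_mul_pinfty => //.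
  by rewrite lee_fin ltW.
by exists B.
Qed.

Lemma op_ext_linear (a : R[i]) (u v : tempered R d) :
  bounded_seq (fun k => u (e k)) -> bounded_seq (fun k => v (e k)) ->
  op_ext (a *: u + v) = a *: op_ext u + op_ext v.
Proof.
move=> ub vb; have Mu := matrix_op_bounded ub; have Mv := matrix_op_bounded vb.
have E : matrix_op (fun k => (a *: u + v) (e k)) =
    (fun l => a * matrix_op (fun k => u (e k)) l + matrix_op (fun k => v (e k)) l).
  by apply/funext => l; rewrite -(matrix_op_linear _ _ ub vb).
have Mb : bounded_seq (matrix_op (fun k => (a *: u + v) (e k))).
  apply: matrix_op_bounded; have [B uB] := ub; have [B' vB] := vb.
  exists (cabs a * B + B') => k; apply: (@le_trans _ _ (cabs (a * u (e k)) + cabs (v (e k)))); first exact: cabsD.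
  by apply: lerD => //; rewrite cabsM ler_wpM2l ?cabs_ge0.
apply: tempered_ext => phi; rewrite /op_ext resynthE// /resynth_fun.
transitivity (a * resynth g injb Au (matrix_op (fun k => u (e k))) phi +
  resynth g injb Au (matrix_op (fun k => v (e k))) phi); last by [].
rewrite !resynthE// /resynth_fun E.
have ju := bounded_rapid_integrable g injb Au phi Mu; have jv := bounded_rapid_integrable g injb Au phi Mv.
rewrite -(cintZ _ ju) -cintD//; last exact: cintegrableZ.
by apply: eq_cint => l; ring.
Qed.

Lemma op_ext_extends w (p : \bar R) : w <> 0 -> (1 <= p)%E ->
  extends_boundedly T (modspace w p) (modnorm w p).
Proof.
move=> w0 p1.
have [D D0 HD] := coef_Lnorm injb surjb Au pf w0.
have [E E0 HE] := resynth_Lnorm injb surjb Au pf w.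
have bnd u : modspace w p u -> (modnorm w p (op_ext u) <= (E * (C * D))%:E * modnorm w p u)%E.
  move=> Mu; have ub := modspace_bounded w0 p1 Mu.
  apply: le_trans (HE _ _ p1 (matrix_op_bounded ub)) _.
  rewrite EFinM -muleA lee_wpmul2l ?lee_fin ?(ltW E0)//.
  apply: le_trans (matrix_op_Lnorm p1 ub) _.
  by rewrite EFinM -muleA lee_wpmul2l ?lee_fin ?(ltW C0)//; exact: HD.
exists op_ext; split.
- move=> u Mu; apply: le_lt_trans (bnd u Mu) _.
  by apply: lte_mul_pinfty; rewrite ?lee_fin// !mulr_ge0// ltW.
- by move=> a u v Mu Mv; apply: op_ext_linear; apply: modspace_bounded; eassumption.
- by exists (E * (C * D)).
- by move=> f u; exact: op_ext_represents.
Qed.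

End MatrixOperator.

(** * The inverse of the canonical transformation *)

HB.instance Definition _ (R : realType) (m n : nat) := Complete.on 'M[R]_(m, n).

Section CanonicalTransformation.
Context {R : realType} {d : nat}.
Local Notation n := (d + d)%N.
Variable chi : 'rV[R]_n -> 'rV[R]_n.
Hypotheses (B1 : condB1 chi) (B2 : condB2 chi).
Implicit Types (x y z u v : 'rV[R]_n).

Lemma coord_le_norm m (x : 'rV[R]_m) i : `|x 0 i| <= `|x|.
Proof.
rewrite [leRHS]/Num.norm /= mx_normrE.
exact: (le_bigmax _ (fun ij : 'I_1 * 'I_m => `|x ij.1 ij.2|) (0, i)).
Qed.

Lemma norm_le_coord m (x : 'rV[R]_m) a : 0 <= a -> (forall i, `|x 0 i| <= a) -> `|x| <= a.
Proof.
move=> a0 xa; rewrite [leLHS]/Num.norm /= mx_normrE.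
by apply: bigmax_le => // -[i j] _ /=; rewrite (ord1 i).
Qed.

Lemma coord_le_enorm m (x : 'rV[R]_m) i : `|x 0 i| <= enorm x.
Proof.
rewrite -ler_sqr ?nnegrE ?sqrtr_ge0// sqr_enorm dotpE real_normK ?num_real//.
rewrite (bigD1 i)//= expr2 lerDl; apply: sumr_ge0 => j _; by rewrite -expr2 sqr_ge0.
Qed.

Lemma mulmx_entry_le m p q (X : 'M[R]_(m, p)) (Y : 'M[R]_(p, q)) a c :
  (forall i j, `|X i j| <= a) -> (forall i j, `|Y i j| <= c) ->
  forall i j, `|(X *m Y) i j| <= p%:R * (a * c).
Proof.
move=> Xa Yc i j; rewrite mxE; apply: le_trans (ler_norm_sum _ _ _) _.
rewrite -[X in X%:R]card_ord mulr_natl -sumr_const; apply: ler_sum => k _.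
by rewrite normrM; apply: ler_pM.
Qed.

Lemma derive_entry (F : 'rV[R]_n -> 'rV[R]_n) z v i : differentiable F z ->
  differentiable (fun x => F x 0 i) z /\ 'D_v (fun x => F x 0 i) z = ('D_v F z) 0 i.
Proof.
move=> dF; split.
  apply: (@differentiable_comp _ _ _ _ F (fun x : 'rV[R]_n => x 0 i)) => //.
  exact: differentiable_coord.
by rewrite derive_mx ?mxE//; exact: diff_derivable.
Qed.

Definition jac i j z : R := ('D_'e_j chi z) 0 i.

(** Orders 1 and 2 of B2: the first bounds the Jacobian, the second its variation, which fixes the
    scale of the local inversion. *)
Lemma jac_bounds : exists2 B : R, 0 < B & forall i j,
  [/\ forall z, `|jac i j z| <= B, forall z, differentiable (jac i j) z &
      forall k z, `|'D_'e_k (jac i j) z| <= B].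
Proof.
have [sm _ _] := B1.
have /fin_all_exists[C1 HC1] : forall j : 'I_n, exists C, forall z, enorm (partial [:: j] chi z) <= C.
  by move=> j; exact: B2.
have /fin_all_exists[C2 HC2] : forall kj : 'I_n * 'I_n, exists C, forall z, enorm (partial [:: kj.1; kj.2] chi z) <= C.
  by move=> kj; exact: B2.
have C10 j : 0 <= C1 j by apply: le_trans (HC1 j 0); exact: sqrtr_ge0.
have C20 kj : 0 <= C2 kj by apply: le_trans (HC2 kj 0); exact: sqrtr_ge0.
have S1 : 0 <= \sum_j C1 j by apply: sumr_ge0.
have S2 : 0 <= \sum_kj C2 kj by apply: sumr_ge0.
exists (1 + \sum_j C1 j + \sum_kj C2 kj) => [|i j]; first by lra.
have dj z : differentiable (partial [:: j] chi) z by exact: sm.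
split=> [z|z|k z].
- apply: le_trans (coord_le_enorm _ _) _; apply: le_trans (HC1 j z) _.
  have : C1 j <= \sum_j C1 j by rewrite (bigD1 j)//= lerDl sumr_ge0.
  lra.
- exact: (derive_entry 0 i (dj z)).1.
- rewrite (derive_entry 'e_k i (dj z)).2.
  apply: le_trans (coord_le_enorm _ _) _; apply: le_trans (HC2 (k, j) z) _.
  have : C2 (k, j) <= \sum_kj C2 kj by rewrite (bigD1 (k, j))//= lerDl sumr_ge0.
  lra.
Qed.

Lemma chi_entry_diff i z : differentiable (fun x => chi x 0 i) z.
Proof. by have [sm _ _] := B1; exact: (derive_entry 0 i (sm [::] z)).1. Qed.

Lemma chi_entry_derive i z v : 'D_v (fun x => chi x 0 i) z = \sum_j v 0 j * jac i j z.
Proof.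
have [sm _ _] := B1; rewrite derive_coord; last exact: chi_entry_diff.
by apply: eq_bigr => j _; rewrite (derive_entry _ i (sm [::] z)).2.
Qed.

(** The transposed Jacobian: vectors are rows, and the differential acts by multiplication on the
    right. *)
Definition jacmx z : 'M[R]_n := \matrix_(j, i) jac i j z.

Lemma diff_jacmx z v : 'd chi z v = v *m jacmx z.
Proof.
have [sm _ _] := B1; apply/rowP => i; rewrite mxE -deriveE; last exact: (sm [::] z).
rewrite -(derive_entry v i (sm [::] z)).2 chi_entry_derive.
by apply: eq_bigr => j _; rewrite mxE.
Qed.

Definition symplJ : 'M[R]_n := block_mx 0 1%:M (- 1%:M) 0.

Lemma symplE u v : sympl u v = (u *m symplJ *m v^T) 0 0.
Proof.
rewrite -[in RHS](hsubmxK u) -[in RHS](hsubmxK v) /symplJ mul_row_block tr_row_mx mul_row_col.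
rewrite !mulmx0 add0r addr0 mulmxN !mulmx1 mulNmx /sympl /dotp.
by rewrite [RHS]mxE [X in _ = X + _]mxE addrC.
Qed.

Lemma symplJJ : symplJ *m symplJ^T = 1%:M.
Proof.
rewrite /symplJ tr_block_mx !trmx0 !linearN /= trmx1 mulmx_block !mul0mx !mulmx0 !mulmx1 !add0r !addr0.
by rewrite mulNmx mulmxN opprK mul1mx -scalar_mx_block.
Qed.

(* For [J] the symplectic matrix, [D J D^T = J] inverts [D] without dividing by
   its determinant, so the inverse inherits the bounds on [D]. *)
Definition jacinv z : 'M[R]_n := symplJ *m (jacmx z)^T *m symplJ^T.

Lemma jacinvP z : jacmx z *m jacinv z = 1%:M.
Proof.
have [_ _ sy] := B1.
suff E : jacmx z *m symplJ *m (jacmx z)^T = symplJ by rewrite /jacinv !mulmxA E symplJJ.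
apply/matrixP => i j.
have := sy z 'e_i 'e_j; rewrite !diff_jacmx !symplE trmx_mul !mulmxA.
have D (M : 'M[R]_n) : (('e_i : 'rV[R]_n) *m M *m ('e_j : 'rV[R]_n)^T) 0 0 = M i j.
  by rewrite -rowE trmx_delta -colE !mxE.
by rewrite D => <-; rewrite -D !mulmxA.
Qed.

Lemma symplJ_entry i j : `|symplJ i j| <= 1.
Proof.
rewrite /symplJ; case: (split_ordP i) => i' ->; case: (split_ordP j) => j' ->.
- by rewrite block_mxEul mxE normr0.
- by rewrite block_mxEur mxE; case: eqP => _; rewrite ?normr1 ?normr0.
- by rewrite block_mxEdl !mxE normrN; case: eqP => _; rewrite ?normr1 ?normr0.
- by rewrite block_mxEdr mxE normr0.
Qed.

(* Contraction for the chord iteration [z + (y - chi z) D^-1], on a ball of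
   radius independent of [z0]. *)
Lemma local_inverse : exists r delta : R, [/\ 0 < r, 0 < delta &
  forall z0 y, `|y - chi z0| <= delta -> exists2 z, `|z - z0| <= r & chi z = y].
Proof.
have [B B0 HB] := jac_bounds.
pose N : R := n%:R.
have N0 : 0 <= N by exact: ler0n.
pose P : R := N * (N * (1 * B) * 1).
have P0 : 0 <= P by rewrite !mulr_ge0// ltW.
have HP z i j : `|jacinv z i j| <= P.
  apply: mulmx_entry_le => i' j'; last by rewrite mxE symplJ_entry.
  apply: mulmx_entry_le => i2 j2; first exact: symplJ_entry.
  by rewrite !mxE; have [] := HB i2 j2.
(* [c * r] bounds the contraction factor of [Phi] on the ball of radius [r]: the Jacobian entries
   vary there by at most [N * B * r], and each of the two products with a matrix costs a factor
   [N]. *)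
pose c : R := N * (N * (N * B) * P).
have c0 : 0 <= c by rewrite !mulr_ge0// ltW.
pose r : R := (2 * (c + 1))^-1.
have r0 : 0 < r by rewrite invr_gt0 mulr_gt0// ltr_wpDl.
have cr : c * r <= 2^-1.
  rewrite /r invfM mulrCA ler_piMr ?invr_ge0// ler_pdivrMr ?ltr_wpDl// mul1r lerDl//.
(* Makes the first step from [z0] at most [r / 2], which together with the contraction factor 1/2
   keeps the ball of radius [r] invariant. *)
pose delta : R := r / (2 * (N * P + 1)).
have NP : 0 <= N * P by rewrite mulr_ge0.
have delta0 : 0 < delta by rewrite divr_gt0// mulr_gt0// ltr_wpDl.
have NPd : N * P * delta <= r / 2.
  rewrite /delta; move: (N * P) NP => q q0.
  have q1 : 0 < q + 1 by rewrite ltr_wpDl.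
  rewrite [leLHS](_ : _ = r / 2 * (q / (q + 1))); last by field; exact: lt0r_neq0.
  by rewrite ler_piMr ?divr_ge0 ?(ltW r0)// ler_pdivrMr// mul1r lerDl.
have mulP z x : `|x *m jacinv z| <= N * P * `|x|.
  apply: norm_le_coord => [|i]; first by rewrite mulr_ge0.
  have := @mulmx_entry_le _ _ _ x (jacinv z) `|x| P _ (HP z) 0 i.
  by move=> H; rewrite -mulrA [P * _]mulrC; apply: H => i' j'; rewrite (ord1 i') coord_le_norm.
exists r, delta; split=> // z0 y yz.
pose Phi z := z - (chi z - y) *m jacinv z0.
have lip z z' : `|z - z0| <= r -> `|z' - z0| <= r -> `|Phi z - Phi z'| <= 2^-1 * `|z - z'|.
  move=> zr z'r.
  (* [z - z'] is written as its image under [jacmx z0] followed by [jacinv z0], so that the linear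
     part of [chi] at [z0] cancels and only the variation of the Jacobian remains. *)
  have -> : Phi z - Phi z' = ((z - z') *m jacmx z0 - (chi z - chi z')) *m jacinv z0.
    rewrite mulmxBl -mulmxA jacinvP mulmx1 /Phi !mulmxBl.
    move: (chi z *m _) (chi z' *m _) (y *m _) => a a' a''.
    by apply/rowP => i; rewrite !mxE; ring.
  apply: le_trans (mulP _ _) _.
  have br : `|(z - z') *m jacmx z0 - (chi z - chi z')| <= N * (N * B * r * `|z - z'|).
    apply: norm_le_coord => [|i]; first by rewrite !mulr_ge0// ltW.
    pose q x := chi x 0 i.
    have dq x : differentiable q x by exact: chi_entry_diff.
    have [t /andP[t0 t1] E] := mvt_dir z' (z - z') dq.
    rewrite (addrC z') subrK /q chi_entry_derive in E.
    have -> : ((z - z') *m jacmx z0 - (chi z - chi z')) 0 i =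
       \sum_j (z - z') 0 j * (jac i j z0 - jac i j (z' + t *: (z - z'))).
      under [RHS]eq_bigr do rewrite mulrBr.
      rewrite sumrB -E !mxE; congr (_ - _); apply: eq_bigr => j _; by rewrite !mxE.
    apply: le_trans (ler_norm_sum _ _ _) _.
    rewrite /N -[X in X%:R * _]card_ord mulr_natl -sumr_const; apply: ler_sum => j _.
    rewrite normrM mulrC; apply: ler_pM => //; last exact: coord_le_norm.
    have [_ dj bj] := HB i j.
    have := @mvt_bound _ _ (jac i j) (z' + t *: (z - z')) (z0 - (z' + t *: (z - z'))) (fun=> B) dj bj.
    rewrite (addrC _ (z0 - _)) subrK => H; apply: le_trans H _.
    set x := z' + _; have xr : `|z0 - x| <= r.
      rewrite distrC (_ : x - z0 = (1 - t) *: (z' - z0) + t *: (z - z0)); last first.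
        by rewrite /x; apply/rowP => k; rewrite !mxE; ring.
      apply: le_trans (ler_normD _ _) _; rewrite !normrZ ger0_norm ?subr_ge0// (ger0_norm t0).
      have := ler_wpM2l t0 zr; have h : 0 <= 1 - t by rewrite subr_ge0.
      have := ler_wpM2l h z'r; lra.
    rewrite -mulr_suml mulrAC ler_wpM2r ?(ltW B0)//.
    apply: (@le_trans _ _ (\sum_(k < n) r)).
      by apply: ler_sum => k _; apply: le_trans (coord_le_norm _ _) xr.
    by rewrite sumr_const card_ord /N -[leLHS]mulr_natl.
  apply: le_trans (ler_wpM2l NP br) _.
  rewrite [leLHS](_ : _ = (c * r) * `|z - z'|); last by rewrite /c; ring.
  by rewrite ler_wpM2r.
pose U := [set z | `|z - z0| <= r].
have U0 : U z0 by rewrite /U /= subrr normr0 ltW.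
have PhiU : set_fun U U Phi.
  move=> z zU; rewrite /U /=.
  have -> : Phi z - z0 = (Phi z - Phi z0) + (Phi z0 - z0) by rewrite addrA subrK.
  apply: le_trans (ler_normD _ _) _.
  have h1 := lip z z0 zU U0.
  have h2 : `|Phi z0 - z0| <= r / 2.
    rewrite /Phi addrAC subrr add0r normrN; apply: le_trans (mulP _ _) _.
    apply: le_trans NPd; rewrite ler_wpM2l//. by rewrite distrC.
  have := zU; rewrite /U /= => zr; lra.
have cU : closed U.
  rewrite (_ : U = closed_ball z0 r).
    exact: closed_ball_closed.
  rewrite closed_ballE//; apply/seteqP; split=> z /=; rewrite /closed_ball_ /= distrC//.
have [f fE] : exists f : {fun U >-> U}, (f : _ -> _) = Phi.
  by have [f] := Pfun PhiU; exists f.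
have cf : is_contraction f.
  exists (2^-1 : R)%:nng; split; first by rewrite /= invf_lt1// ltr1n.
  by move=> -[a c'] [/= aU cU']; rewrite fE; exact: lip.
have [p pU] := banach_fixed_point cf cU (ex_intro _ z0 U0).
(* At a fixed point [(chi p - y) *m jacinv z0 = 0]; [jacinv z0] is invertible, a one-sided inverse
   of a square matrix being two-sided, whence [chi p = y]. *)
rewrite fE /Phi => /eqP; rewrite -subr_eq0 opprB addrC subrK => /eqP E.
exists p; first exact: pU.
apply/eqP; rewrite -subr_eq0; apply/eqP.
by rewrite -[LHS]mulmx1 -(mulmx1C (jacinvP z0)) mulmxA E mul0mx.
Qed.

(** The point near [z'] that [local_inverse] finds over [chi z] is [z] itself, as [chi] is
    injective. Local solvability thus becomes an estimate for the inverse. *)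
Lemma inverse_step : exists r delta : R, [/\ 0 < r, 0 < delta &
  forall z z', `|chi z - chi z'| <= delta -> `|z - z'| <= r].
Proof.
have [_ /bij_inj ci _] := B1; have [r [delta [r0 d0 H]]] := local_inverse.
exists r, delta; split=> // z z' /H[x xr /ci <-] //.
Qed.

(* The segment from [chi z'] to [chi z] is cut into steps short enough for
   [inverse_step]. *)
Lemma inverse_lipschitz : exists2 L : R, 0 < L & forall z z',
  jap (z - z') <= L * jap (chi z - chi z').
Proof.
have [_ [psi psiK chiK] _] := B1; have [r [delta [r0 d0 H]]] := inverse_step.
have coarse N z z' : `|chi z - chi z'| <= N%:R * delta -> `|z - z'| <= N%:R * r.
  elim: N z => [|N IH] z; first by rewrite !mul0r normr_le0 => /eqP/subr0_eq/(can_inj psiK) ->; rewrite subrr normr0.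
  move=> h; pose x := psi (chi z' + (N%:R / N.+1%:R) *: (chi z - chi z')).
  have xE : chi x = chi z' + (N%:R / N.+1%:R) *: (chi z - chi z') by rewrite /x chiK.
  have N1 : 0 < N.+1%:R :> R by rewrite ltr0n.
  have hx : `|chi x - chi z'| <= N%:R * delta.
    rewrite xE addrC addKr normrZ ger0_norm ?divr_ge0// mulrAC ler_pdivrMr//.
    rewrite -mulrA; apply: ler_wpM2l => //; by rewrite mulrC.
  have hz : `|chi z - chi x| <= delta.
    have -> : chi z - chi x = N.+1%:R^-1 *: (chi z - chi z').
      rewrite xE -natr1; apply/rowP => i; rewrite !mxE; field.
      by rewrite natr1 lt0r_neq0.
    by rewrite normrZ ger0_norm ?invr_ge0// mulrC ler_pdivrMr// mulrC.
  rewrite -(subrK x z) -addrA; apply: le_trans (ler_normD _ _) _.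
  have := H _ _ hz; have := IH _ hx; rewrite -natr1; lra.
pose n' : R := n%:R.
(* The 1 comes from [jap_le_sum], the rest from [n * N * r] with at most [D / delta + 1] steps; the
   terms without [D] are absorbed since the bracket of [chi z - chi z'] is at least 1. *)
pose L := 1 + n' * r + n' * (r / delta).
have rd : 0 < r / delta by rewrite divr_gt0.
have n0 : 0 <= n' by exact: ler0n.
have nr : 0 <= n' * r by rewrite mulr_ge0// ltW.
have nrd : 0 <= n' * (r / delta) by rewrite mulr_ge0// ltW.
exists L => [|z z']; first by rewrite /L; lra.
set D := `|chi z - chi z'|.
have D0 : 0 <= D by exact: normr_ge0.
pose N := `|Num.ceil (D / delta)|%N.
have NE : N%:R = (Num.ceil (D / delta))%:~R :> R.
  have q0 : 0 <= D / delta by rewrite divr_ge0// ltW.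
  by rewrite /N natr_absz ger0_norm// -(@ler_int R); exact: le_trans q0 (ceil_ge _).
have DN : D <= N%:R * delta by rewrite -ler_pdivrMr// NE ceil_ge.
have ND : N%:R <= D / delta + 1.
  by rewrite NE; have := ltW (ceilB1_lt (D / delta)); rewrite intrB; lra.
have zz := coarse N z z' DN.
have DJ : D <= jap (chi z - chi z').
  by apply: norm_le_coord => [|i]; [exact: jap_ge0|exact: coord_le_jap].
apply: le_trans (jap_le_sum _) _.
have S : \sum_i `|(z - z') 0 i| <= n' * (N%:R * r).
  rewrite /n' -[X in X%:R * _]card_ord mulr_natl -sumr_const; apply: ler_sum => i _.
  exact: le_trans (coord_le_norm _ _) zz.
have J1 := @jap_ge1 R _ (chi z - chi z').
have : n' * (N%:R * r) <= n' * r + n' * (r / delta) * D.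
  rewrite -mulrA -mulrDr ler_wpM2l// [leRHS](_ : _ = (D / delta + 1) * r); last by ring.
  by rewrite ler_wpM2r// ltW.
have : n' * (r / delta) * D <= n' * (r / delta) * jap (chi z - chi z') by rewrite ler_wpM2l.
have : n' * r * 1 <= n' * r * jap (chi z - chi z') by rewrite ler_wpM2l.
rewrite /L; move: S J1; lra.
Qed.

End CanonicalTransformation.

(** * The identity of M^2 and L^2 *)

Section RieszFischer.
Context {R : realType} {d : nat}.
Variables (g : schwartz R d) (A : 'M[R]_(d + d)) (b : nat -> 'cV[int]_(d + d)).
Hypotheses (injb : injective b) (surjb : forall k, exists n, b n = k).
Hypotheses (Au : A \in unitmx) (pf : parseval_frame g A).
Local Notation cnt := (@counting nat R).
Local Notation mu := (leb R d).
Local Notation e := (atom g A b).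
Implicit Types (phi : schwartz R d).

Lemma eq_cint_ae d0 (T : measurableType d0) (m : {measure set T -> \bar R}) (f h : T -> R[i]) :
  cmeas f -> cmeas h -> {ae m, forall x, f x = h x} -> cint m f = cint m h.
Proof.
move=> [fr fi] [hr hi] fh; apply: complex_ext; rewrite ?cRe_cint ?cIm_cint /Rintegral; congr fine.
  apply: ae_eq_integral => //; try exact/measurable_EFinP.
  by apply: filterS fh => x -> _.
apply: ae_eq_integral => //; try exact/measurable_EFinP.
by apply: filterS fh => x -> _.
Qed.

(** When the modulus is not integrable the right-hand side is infinite. *)
Lemma cabs_cint_always d0 (T : measurableType d0) (m : {measure set T -> \bar R}) (f : T -> R[i]) :
  cmeas f -> ((cabs (cint m f))%:E <= \int[m]_x (cabs (f x))%:E)%E.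
Proof.
move=> mf; have [jf|jf] := ltP (\int[m]_x (cabs (f x))%:E)%E +oo%E.
  by apply: cabs_cintE; apply/cintegrableP.
by move: jf; rewrite leye_eq => /eqP ->; exact: leey.
Qed.

Variable c : nat -> R[i].
Variable S : R.
Hypothesis cS : forall n, \sum_(0 <= k < n) cabs (c k) ^+ 2 <= S.

(** Otherwise a block of mass above [eps * S] begins beyond every index, and finitely many such
    blocks push the partial sums over [S]. For [S = 0] all the terms vanish. *)
Lemma block_tail (eps : R) : 0 < eps -> exists N, forall m n, (N <= n)%N ->
  \sum_(n <= k < m) cabs (c k) ^+ 2 <= eps * S.
Proof.
move=> eps0; pose s n := \sum_(0 <= k < n) cabs (c k) ^+ 2.
have S0 : 0 <= S by apply: le_trans (cS 0%N); rewrite big_geq.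
have smon m n : (m <= n)%N -> s m <= s n.
  by move=> mn; rewrite /s (big_cat_nat (leq0n m) mn) /= lerDl sumr_ge0// => i _; exact: sqr_ge0.
have split m n : (n <= m)%N -> \sum_(n <= k < m) cabs (c k) ^+ 2 = s m - s n.
  by move=> nm; rewrite /s (big_cat_nat (leq0n n) nm) /= [X in _ = X - _]addrC addrK.
move: S0; rewrite le_eqVlt => /predU1P[S0|S0].
  exists 0%N => m n _; rewrite -S0 mulr0.
  have [mn|nm] := leqP m n; first by rewrite big_geq.
  rewrite split ?(ltnW nm)//; have := cS m; have := smon 0%N n (leq0n n).
  by rewrite -S0 /s [X in X <= _ -> _]big_geq//; lra.
apply: contrapT => /forallNP H.
have step n : exists m, s n + eps * S <= s m.
  have /existsNP[m /existsNP[n' /not_implyP[nn' /negP]]] := H n.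
  rewrite -ltNge => h; exists m.
  have [mn'|n'm] := leqP m n'.
    by have := mulr_gt0 eps0 S0; move: h; rewrite big_geq//; lra.
  by move: h; rewrite split ?(ltnW n'm)//; have := smon n n' nn'; lra.
have grow q : exists m, q%:R * (eps * S) <= s m.
  elim: q => [|q [m IH]]; first by exists 0%N; rewrite mul0r /s big_geq.
  have [m' Hm'] := step m; exists m'; rewrite -natr1 mulrDl mul1r.
  by apply: le_trans Hm'; rewrite lerD2r.
have [q Hq] : exists q : nat, S < q%:R * (eps * S).
  exists (Num.bound (S / (eps * S))).
  rewrite -ltr_pdivrMr ?mulr_gt0//; apply: archi_boundP.
  by rewrite divr_ge0// ltW// mulr_gt0.
have [m Hm] := grow q; have := cS m; rewrite -/(s m); lra.
Qed.

Lemma block_ends : exists n : nat -> nat, [/\ n 0%N = 0%N, forall j, (n j <= n j.+1)%N,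
  forall j, (j <= n j)%N & forall j, \sum_(n j <= k < n j.+1) cabs (c k) ^+ 2 <= 8^-1 ^+ j * S].
Proof.
have P j : exists N, forall m n, (N <= n)%N -> \sum_(n <= k < m) cabs (c k) ^+ 2 <= 8^-1 ^+ j * S.
  by apply: block_tail; rewrite exprn_gt0.
pose N j := projT1 (cid (P j)).
have HN j m n : (N j <= n)%N -> \sum_(n <= k < m) cabs (c k) ^+ 2 <= 8^-1 ^+ j * S.
  by rewrite /N; case: cid => x Hx; exact: Hx.
(* These sums are increasing, dominate each threshold [N j] and tend to infinity. Starting at
   [i = 1] gives the value 0 at [j = 0], where the required bound is [S] itself, that is [cS]. *)
exists (fun j => \sum_(1 <= i < j.+1) (N i).+1)%N; split.
- by rewrite big_geq.
- by move=> j; rewrite [X in (_ <= X)%N]big_nat_recr//= leq_addr.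
- elim=> [//|j IH]; rewrite big_nat_recr//= addnS ltnS; exact: leq_trans IH (leq_addr _ _).
- case=> [|j].
    rewrite [X in \sum_(X <= _ < _) _](_ : _ = 0%N) ?expr0 ?mul1r//.
    by rewrite big_geq.
  by apply: HN; rewrite big_nat_recr//= (leq_trans (leqnSn _))// leq_addl.
Qed.

(* The series is summed in blocks whose [l^2] norms decay geometrically, so that
   it converges absolutely at almost every point. *)
Lemma riesz_fischer : exists f : 'rV[R]_d -> R[i],
  [/\ cmeas f, (sqint mu f <= (4 * S)%:E)%E &
   forall phi (l : R[i]),
     (forall eps, 0 < eps -> \forall n \near \oo,
        cabs (l - \sum_(0 <= k < n) c k * inner (e k) phi) <= eps) ->
     inner f phi = l].
Proof.
have S0 : 0 <= S by apply: le_trans (cS 0%N); rewrite big_geq.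
have [n [n0 nS nj tail]] := block_ends.
pose a j := synth g A b (index_iota (n j) (n j.+1)) c.
have sqa j : (sqint mu (a j) <= (8^-1 ^+ j * S)%:E)%E.
  apply: le_trans (synth_sqint injb surjb pf _ (iota_uniq _ _)) _.
  by rewrite lee_fin; exact: tail.
pose F (p : 'rV[R]_d * nat) := a p.2 p.1.
have mF : cmeas F by apply: cmeas_prod_nat => j; exact: (schwartz_cmeas (a j)).
pose f t := cint cnt (fun j => a j t).
have mf : cmeas f by have H := cmeas_cint cnt mF; exact: H.
(* The weights [2 ^+ j] against the block masses [8^-1 ^+ j * S] leave a geometric series of ratio
   1/4, so the integral of [h] is at most [2 * S]. *)
pose h t := (\int[cnt]_j (2 ^+ j * cabs (a j t) ^+ 2)%:E)%E.
pose Hh (p : 'rV[R]_d * nat) := (2 ^+ p.2 * cabs (a p.2 p.1) ^+ 2 : R).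
have mHh : measurable_fun setT (fun p => (Hh p)%:E).
  apply/measurable_EFinP; apply: measurable_prod_nat => j; apply: measurable_funM => //.
  by apply: measurable_funX; exact: cmeas_cabs (schwartz_cmeas (a j)).
have Hh0 p : (0 <= (Hh p)%:E)%E by rewrite lee_fin mulr_ge0 ?exprn_ge0 ?cabs_ge0.
have mh : measurable_fun setT h by exact: (@measurable_fun_fubini_tonelli_F _ _ _ _ _ cnt (fun p => (Hh p)%:E)).
have h0 t : (0 <= h t)%E by apply: integral_ge0 => j _; exact: (Hh0 (t, j)).
have G4 m : \sum_(0 <= j < m) (4^-1 : R) ^+ j <= 2.
  have q4 : 0 <= (4^-1 : R) < 1 by apply/andP; split; lra.
  apply: le_trans (geometric_partial_le m q4) _.
  by rewrite (_ : 1 - 4^-1 = 3 / 4 :> R) ?invf_div; [lra|field].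
have G2 m : \sum_(0 <= j < m) (2^-1 : R) ^+ j <= 2.
  have q2 : 0 <= (2^-1 : R) < 1 by apply/andP; split; lra.
  apply: le_trans (geometric_partial_le m q2) _.
  by rewrite (_ : 1 - 2^-1 = 2^-1 :> R) ?invrK//; field.
have hS : (\int[mu]_t h t <= (2 * S)%:E)%E.
  rewrite /h (fubini_tonelli (fun p => (Hh p)%:E))//.
  apply: (@le_trans _ _ (\int[cnt]_j (4^-1 ^+ j * S)%:E)%E).
    apply: ge0_le_integral => //; try exact: measurable_nat.
    - by move=> j _; apply: integral_ge0 => t _; exact: (Hh0 (t, j)).
    move=> j _; under eq_integral do rewrite /Hh /= EFinM.
    rewrite ge0_integralZl ?lee_fin ?exprn_ge0//; last 2 first.
    - exact: (measurable_sq (schwartz_cmeas (a j))).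
    - by move=> t _; rewrite lee_fin sqr_ge0.
    apply: (@le_trans _ _ ((2 ^+ j)%:E * (8^-1 ^+ j * S)%:E)%E).
      by rewrite lee_wpmul2l ?lee_fin ?exprn_ge0//; exact: sqa.
    rewrite -EFinM lee_fin mulrA -exprMn (_ : 2 * 8^-1 = 4^-1 :> R)//; by field.
  apply: counting_integral_le => [j|m]; first by rewrite mulr_ge0 ?exprn_ge0.
  by rewrite -mulr_suml ler_wpM2r.
(* Jensen's inequality for the weights [2^-1 ^+ j], of total mass at most 2; with [hS] it produces
   the constant 4. *)
have fh t : ((cabs (f t) ^+ 2)%:E <= 2%:E * h t)%E.
  have := @jensen_weighted _ nat R cnt 2 (cabs (f t)) 2 (fun j => 2^-1 ^+ j) (fun j => 2 ^+ j * cabs (a j t)).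
  rewrite powR_mulrn ?cabs_ge0// (_ : 2 - 1 = 1) ?powRr1//; last by ring.
  have -> : (\int[cnt]_y (2^-1 ^+ y * (2 ^+ y * cabs (a y t)) `^ 2)%:E = h t)%E.
    apply: eq_integral => j _; rewrite powR_mulrn ?mulr_ge0 ?exprn_ge0 ?cabs_ge0//.
    congr EFin; rewrite exprMn mulrA; congr (_ * _).
    by rewrite expr2 mulrA -exprMn mulVf// expr1n mul1r.
  apply=> //.
  - by rewrite ler1n.
  - by move=> j; rewrite mulr_ge0 ?exprn_ge0 ?cabs_ge0.
  - by apply: counting_integral_le => // j; rewrite exprn_ge0.
  apply: le_trans (cabs_cint_always cnt (cmeas_nat _)) _.
  rewrite (eq_integral (fun j => (2^-1 ^+ j * (2 ^+ j * cabs (a j t)))%:E))// => j _.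
  by rewrite mulrA -exprMn mulVf// expr1n mul1r.
have sqf : (sqint mu f <= (4 * S)%:E)%E.
  apply: (@le_trans _ _ (\int[mu]_t (2%:E * h t))%E).
    apply: ge0_le_integral => //.
    - by move=> t _; rewrite lee_fin sqr_ge0.
    - exact: measurable_sq.
    - exact: emeasurable_funM.
  rewrite ge0_integralZl//.
  apply: (@le_trans _ _ (2%:E * (2 * S)%:E)%E); first by rewrite lee_wpmul2l.
  by rewrite -EFinM lee_fin; lra.
exists f; split=> // phi l hl.
have jphi := schwartz_sqint phi; have mphi := schwartz_cmeas phi.
pose G (p : 'rV[R]_d * nat) := a p.2 p.1 * conjc (phi p.1).
have mG : cmeas G.
  by apply: cmeas_prod_nat => j; exact: (cmeasM (schwartz_cmeas (a j)) (cmeasJ mphi)).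
(* Young's inequality with parameter [2 ^+ j]: one term is summed by a geometric series, the other
   is the integrand of [h]. *)
have GB t j : cabs (G (t, j)) <= 2^-1 ^+ j * cabs (phi t) ^+ 2 + Hh (t, j).
  rewrite /G /Hh [_.1]/= [_.2]/= cabsM cabsJ.
  move: (cabs (a j t)) (cabs (phi t)) (cabs_ge0 (a j t)) (cabs_ge0 (phi t)) => x y x0 y0.
  have p0 : 0 < 2 ^+ j :> R by rewrite exprn_gt0.
  rewrite exprVn; move: (2 ^+ j) p0 => p p0.
  have q0 : 0 <= p^-1 by rewrite invr_ge0 ltW.
  have := mulr_ge0 q0 (sqr_ge0 (p * x - y)).
  have -> : p^-1 * (p * x - y) ^+ 2 = p * x ^+ 2 + p^-1 * y ^+ 2 - 2 * (x * y).
    by field; exact: lt0r_neq0.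
  have := mulr_ge0 x0 y0; lra.
have intphi t : (\int[cnt]_j (2^-1 ^+ j * cabs (phi t) ^+ 2)%:E <= (2 * cabs (phi t) ^+ 2)%:E)%E.
  apply: counting_integral_le => [j|m]; first by rewrite mulr_ge0 ?exprn_ge0 ?cabs_ge0.
  by rewrite -mulr_suml ler_wpM2r ?sqr_ge0.
have GBh t : (\int[cnt]_j (cabs (G (t, j)))%:E <= (2 * cabs (phi t) ^+ 2)%:E + h t)%E.
  apply: (@le_trans _ _ (\int[cnt]_j ((2^-1 ^+ j * cabs (phi t) ^+ 2)%:E + (Hh (t, j))%:E))%E).
    apply: ge0_le_integral => //; try exact: measurable_nat.
    - by move=> j _; rewrite lee_fin cabs_ge0.
    - by move=> j _; rewrite -EFinD lee_fin.
  rewrite ge0_integralD//; try exact: measurable_nat.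
  - exact: leeD.
  - by move=> j _; rewrite lee_fin mulr_ge0 ?exprn_ge0 ?cabs_ge0.
have mq : measurable_fun setT (fun t => (2 * cabs (phi t) ^+ 2)%:E).
  by apply/measurable_EFinP; apply: measurable_funM => //; apply: measurable_funX; exact: cmeas_cabs.
have jG : (\int[mu]_t \int[cnt]_j (cabs (G (t, j)))%:E < +oo)%E.
  apply: (@le_lt_trans _ _ (\int[mu]_t ((2 * cabs (phi t) ^+ 2)%:E + h t))%E).
    apply: ge0_le_integral => //.
    - by move=> t _; apply: integral_ge0 => j _; rewrite lee_fin cabs_ge0.
    - apply: (@measurable_fun_fubini_tonelli_F _ _ _ _ _ cnt (fun p => (cabs (G p))%:E)).
        by apply/measurable_EFinP; exact: cmeas_cabs.
      by move=> p; rewrite lee_fin cabs_ge0.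
    - exact: emeasurable_funD.
  rewrite ge0_integralD//; last by move=> t _; rewrite lee_fin mulr_ge0 ?sqr_ge0.
  apply: lte_add_pinfty; last exact: le_lt_trans hS (ltry _).
  under eq_integral do rewrite EFinM.
  rewrite ge0_integralZl//; last 2 first.
  - exact: measurable_sq.
  - by move=> t _; rewrite lee_fin sqr_ge0.
  exact: lte_mul_pinfty.
have jh : mu.-integrable setT h.
  apply/integrableP; split=> //.
  under eq_integral do rewrite gee0_abs//.
  exact: le_lt_trans hS (ltry _).
(* Where [h t] is finite, hence almost everywhere, the blocks sum absolutely and the factor
   [conjc (phi t)] may be moved under the sum. *)
transitivity (cint mu (fun t => cint cnt (fun j => G (t, j)))).
  apply: eq_cint_ae.
  - exact: (cmeasM mf (cmeasJ mphi)).
  - by have H := cmeas_cint cnt mG; exact: H.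
  apply: filterS (integrable_ae measurableT jh) => t /(_ I) ht.
  have ja : cintegrable cnt (fun j => a j t).
    apply/cintegrableP; split; first exact: cmeas_nat.
    apply: (@le_lt_trans _ _ (\int[cnt]_j ((2^-1 ^+ j)%:E + (Hh (t, j))%:E))%E).
      apply: ge0_le_integral => //; try exact: measurable_nat.
      - by move=> j _; rewrite lee_fin cabs_ge0.
      move=> j _; rewrite -EFinD lee_fin /Hh [_.1]/= [_.2]/=.
      move: (cabs (a j t)) (cabs_ge0 (a j t)) => x x0.
      have p0 : 0 < 2 ^+ j :> R by rewrite exprn_gt0.
      rewrite exprVn; move: (2 ^+ j) p0 => p p0.
      have q0 : 0 <= p^-1 by rewrite invr_ge0 ltW.
      have := mulr_ge0 q0 (sqr_ge0 (p * x - 1)).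
      have -> : p^-1 * (p * x - 1) ^+ 2 = p * x ^+ 2 + p^-1 - 2 * x by field; exact: lt0r_neq0.
      lra.
    rewrite ge0_integralD//; try exact: measurable_nat.
    apply: lte_add_pinfty; last by rewrite ltey_eq ht.
    apply: le_lt_trans (ltry 2); apply: counting_integral_le => // j; by rewrite exprn_ge0.
  rewrite /f mulrC -(cintZ _ ja); apply: eq_cint => j; exact: mulrC.
rewrite (@cint_fubini _ _ _ _ _ mu cnt G mG jG).
have Ga j : cint mu (fun t => G (t, j)) = \sum_(n j <= k < n j.+1) c k * inner (e k) phi.
  by rewrite -inner_synthl.
apply/esym; rewrite (eq_cint _ Ga); apply: cint_counting_unique.
  apply: (@summable_cintegrable _ _ (fun j => 4^-1 ^+ j * S + 2^-1 ^+ j * fine (sqint mu phi))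
     (2 * S + 2 * fine (sqint mu phi))) => [j|m].
    have p0 : 0 < 2 ^+ j :> R by rewrite exprn_gt0.
    have := cint_prod_le (schwartz_cmeas (a j)) mphi (schwartz_sqint (a j)) jphi p0.
    rewrite -[cint mu _]/(inner (a j) phi) inner_synthl => H.
    rewrite -lee_fin; apply: le_trans H _; rewrite EFinD; apply: leeD.
      apply: (@le_trans _ _ ((2 ^+ j / 2)%:E * (8^-1 ^+ j * S)%:E)%E).
        by rewrite lee_wpmul2l ?lee_fin ?divr_ge0 ?(ltW p0).
      rewrite -EFinM lee_fin mulrA ler_wpM2r//.
      rewrite mulrAC -exprMn (_ : 2 * 8^-1 = 4^-1 :> R); last by field.
      by rewrite ler_pdivrMr// ler_peMr ?exprn_ge0// ler1n.
    rewrite -[X in (_ * X)%E](@fineK _ (sqint mu phi)) ?ge0_fin_numE ?sqint_ge0//.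
    rewrite -EFinM lee_fin ler_wpM2r ?fine_ge0 ?sqint_ge0// -exprVn.
    by rewrite ler_pdivrMr// ler_peMr ?exprn_ge0// ler1n.
  rewrite big_split /= -!mulr_suml lerD ?ler_wpM2r ?fine_ge0 ?sqint_ge0//.
move=> eps eps0; have [N _ HN] := hl _ eps0.
exists N => // m /= Nm.
have -> : \sum_(0 <= j < m) \sum_(n j <= k < n j.+1) c k * inner (e k) phi =
    \sum_(0 <= k < n m) c k * inner (e k) phi.
  elim: m {Nm} => [|m IH]; first by rewrite n0 !big_geq.
  by rewrite big_nat_recr//= IH -big_cat_nat.
by apply: HN => /=; exact: leq_trans Nm (nj m).
Qed.

End RieszFischer.

(** * Equivalence of the norms of L^2 and M^2 *)

Section SquareIntegrable.
Context {R : realType} {d : nat}.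
Variables (g : schwartz R d) (A : 'M[R]_(d + d)) (b : nat -> 'cV[int]_(d + d)).
Hypotheses (injb : injective b) (surjb : forall k, exists n, b n = k).
Hypotheses (Au : A \in unitmx) (pf : parseval_frame g A).
Local Notation cnt := (@counting nat R).
Local Notation mu := (leb R d).
Local Notation e := (atom g A b).
Implicit Types (u : tempered R d) (w phi : schwartz R d) (f : 'rV[R]_d -> R[i]).

Lemma Lnorm2_sqint d0 (T : measurableType d0) (m : {measure set T -> \bar R}) (f : T -> R[i]) :
  Lnorm m 2%:E (EFin \o (fun x => cabs (f x))) = (sqint m f `^ (2^-1)%R)%E.
Proof.
rewrite unlock; congr (_ `^ _)%E; apply: eq_integral => x _.
by rewrite gee0_abs ?lee_fin ?cabs_ge0// poweR_EFin powR_mulrn ?cabs_ge0.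
Qed.

Lemma sqint_counting_le (c : nat -> R[i]) (B : R) :
  (forall n, \sum_(0 <= k < n) cabs (c k) ^+ 2 <= B) -> (sqint cnt c <= B%:E)%E.
Proof. by move=> cB; apply: counting_integral_le => // k; exact: sqr_ge0. Qed.

Lemma poweR_half_le (x y : \bar R) : (0 <= x)%E -> (x <= y)%E ->
  (x `^ (2^-1)%R <= y `^ (2^-1)%R)%E.
Proof.
move=> x0 xy; apply: gt0_ler_poweR => //; rewrite ?invr_ge0 ?in_itv/= ?leey ?andbT//.
exact: le_trans xy.
Qed.

(** The coefficients of [u] are the [inner f (e k)], square summable by Bessel's inequality, and [u]
    is their resynthesis. *)
Lemma modnorm_le_Lpnorm2 w : exists2 D : R, 0 < D & forall u f, L2 f -> represents f u ->
  (modnorm w 2%:E u <= D%:E * Lpnorm 2%:E f)%E.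
Proof.
have [D D0 HD] := resynth_Lnorm injb surjb Au pf w; exists D => // u f Lf fu.
have /L2P[mf jf] := Lf; pose c k := u (e k).
have cS n : \sum_(0 <= k < n) cabs (c k) ^+ 2 <= fine (sqint mu f).
  rewrite -lee_fin fineK ?ge0_fin_numE ?sqint_ge0//.
  apply: le_trans (bessel injb surjb pf n Lf).
  by rewrite lee_fin; apply: ler_sum => k _; rewrite /c fu.
have cb : bounded_seq c.
  exists (1 + fine (sqint mu f)) => k; have := cS k.+1; rewrite big_nat_recr//=.
  have : 0 <= \sum_(0 <= i < k) cabs (c i) ^+ 2 by apply: sumr_ge0 => i _; exact: sqr_ge0.
  move: (cabs (c k)) (cabs_ge0 (c k)) (\sum_(_ <= i < _) _) => x x0 y; nra.
rewrite -(resynth_coef injb surjb Au pf cb).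
apply: le_trans (HD c _ _ cb) _; first by rewrite lee_fin ler1n.
rewrite lee_wpmul2l ?lee_fin ?(ltW D0)// Lnorm2_sqint Lpnorm2E.
apply: poweR_half_le; first exact: sqint_ge0.
rewrite -[leRHS]fineK ?ge0_fin_numE ?sqint_ge0//; exact: sqint_counting_le.
Qed.

(** The coefficients are square summable by [coef_Lnorm]. The function built from them by
    [riesz_fischer] pairs with every Schwartz function through the same series as [u], hence
    represents it. The factor 2 is the root of the 4 there. *)
Lemma Lpnorm2_le_modnorm w : w <> 0 -> exists2 D : R, 0 < D & forall u, modspace w 2%:E u ->
  exists f, [/\ L2 f, represents f u & (Lpnorm 2%:E f <= D%:E * modnorm w 2%:E u)%E].
Proof.
move=> w0; have [D D0 HD] := coef_Lnorm injb surjb Au pf w0.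
have p1 : (1 <= 2%:E :> \bar R)%E by rewrite lee_fin ler1n.
exists (2 * D) => [|u uM]; first by rewrite mulr_gt0.
pose c k := u (e k); have cD := HD u _ p1; rewrite Lnorm2_sqint -/c in cD.
have q0 := sqint_ge0 cnt c.
have cfin : (sqint cnt c < +oo)%E.
  apply: (@lty_poweRy _ _ (2^-1)%R); first by rewrite invr_eq0.
  by apply: le_lt_trans cD _; apply: lte_mul_pinfty; rewrite ?lee_fin ?ltW.
have cS n : \sum_(0 <= k < n) cabs (c k) ^+ 2 <= fine (sqint cnt c).
  rewrite -lee_fin fineK ?ge0_fin_numE//.
  by apply: counting_partial_le => k; exact: sqr_ge0.
have [f [mf fS frep]] := riesz_fischer injb surjb pf cS.
exists f; split.
- by apply/L2P; split=> //; exact: le_lt_trans fS (ltry _).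
- move=> phi; apply/esym/frep => eps eps0.
  apply: filterS (@tempered_expansion _ _ g A b injb surjb Au pf u phi eps eps0) => n.
  congr (cabs (_ - _) <= _); apply: eq_bigr => k _.
  by rewrite (innerJ phi) mulrC.
rewrite Lpnorm2E EFinM -muleA; apply: le_trans (lee_wpmul2l _ cD); last by rewrite lee_fin.
apply: le_trans (poweR_half_le (sqint_ge0 mu f) fS) _.
rewrite EFinM fineK ?ge0_fin_numE// poweRM//.
rewrite poweR_EFin (_ : 4 = 2 `^ 2 :> R); last by rewrite powR_mulrn//; ring.
by rewrite -powRrM mulfV// powRr1.
Qed.

Lemma L2_same_modspace2 w : w <> 0 ->
  same_normed_space (@L2space R d) (@L2norm R d) (modspace w 2%:E) (modnorm w 2%:E).
Proof.
move=> w0; have [D D0 HD] := modnorm_le_Lpnorm2 w; have [E E0 HE] := Lpnorm2_le_modnorm w0.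
split.
  apply/seteqP; split=> [u [f Lf fu]|u uM]; last by have [f [Lf fu _]] := HE u uM; exists f.
  apply: le_lt_trans (HD u f Lf fu) _; apply: lte_mul_pinfty; rewrite ?lee_fin ?(ltW D0)//.
  exact: Lf.2.
(* [L2norm] is an infimum over representatives: it is bounded from above through the representative
   supplied by [HE], and from below because [HD] holds for each of them. *)
exists E^-1, D; split; rewrite ?invr_gt0// => u [f0 Lf0 fu0]; split.
  rewrite lee_pdivrMl//.
  have [|f [Lf fu fE]] := HE u.
    apply: le_lt_trans (HD u f0 Lf0 fu0) _; apply: lte_mul_pinfty; rewrite ?lee_fin ?(ltW D0)//.
    exact: Lf0.2.
  by apply: le_trans fE; apply: ereal_inf_lbound; exists f.
rewrite -lee_pdivrMl//; apply: le_ereal_inf_tmp => _ [f [Lf fu] <-].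
by rewrite lee_pdivrMl//; exact: HD.
Qed.

End SquareIntegrable.

(** The extension is unchanged and only its bound is converted; [|B|] replaces [B], whose sign is
    not prescribed. *)
Lemma same_normed_space_extends (R : realType) d (T : schwartz R d -> tempered R d)
    (X Y : set (tempered R d)) (N M : tempered R d -> \bar R) :
  same_normed_space X N Y M -> (forall u, (0 <= M u)%E) ->
  extends_boundedly T Y M -> extends_boundedly T X N.
Proof.
move=> [-> [a [C [a0 C0 H]]]] M0 [Tx [TY Tl [B HB] Text]].
exists Tx; split=> //; exists (a^-1 * (`|B| * C)) => u Yu.
rewrite EFinM -muleA lee_pdivlMl//.
apply: le_trans (H _ (TY _ Yu)).1 _; apply: le_trans (HB _ Yu) _.
rewrite EFinM -muleA; apply: (@le_trans _ _ (`|B|%:E * M u)%E).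
  by rewrite lee_wpmul2r// lee_fin ler_norm.
by rewrite lee_wpmul2l ?lee_fin//; exact: (H _ Yu).2.
Qed.

Theorem theorem3p4 (R : realType) (d : nat)
    (g : schwartz R d) (A : 'M[R]_(d + d))
    (chi : 'rV[R]_(d + d) -> 'rV[R]_(d + d)) (s : R)
    (T : schwartz R d -> tempered R d) :
  (0 < d)%N ->
  g <> 0 -> A \in unitmx -> parseval_frame g A ->
  condB1 chi -> condB2 chi ->
  2 * d%:R < s ->
  FIO g A chi s T ->
  (forall w : schwartz R d, w <> 0 ->
     forall p : \bar R, (1 <= p)%E ->
     extends_boundedly T (modspace w p) (modnorm w p)) /\
  extends_boundedly T (@L2space R d) (@L2norm R d) /\
  (forall w : schwartz R d, w <> 0 ->
     same_normed_space (@L2space R d) (@L2norm R d)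
       (modspace w 2%:E) (modnorm w 2%:E)).
Proof.
move=> d0 g0 Au pf B1 B2 ds [Tl Tc [C C0 HC]].
have [b [injb surjb]] : exists b : nat -> 'cV[int]_(d + d), injective b /\ forall k, exists n, b n = k.
  by apply: lattice_enumeration; rewrite addn_gt0 d0.
have ds' : (d + d)%:R < s by move: ds; rewrite natrD; lra.
have s0 : 0 < s by exact: le_lt_trans ds'.
have [S S0 HS] := lattice_sum injb Au ds'.
have [L L0 HL] := inverse_lipschitz B1 B2.
have [_ [psi psiK chiK] _] := B1.
pose K l k := C * jap (node A b l - chi (node A b k)) `^ (- s).
have TK k l : cabs (T (atom g A b k) (atom g A b l)) <= K l k by exact: HC.
have L's : 0 < L `^ s by rewrite powR_gt0.
have Kcol k n : \sum_(0 <= l < n) K l k <= C * S.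
  by rewrite -mulr_sumr ler_wpM2l ?(ltW C0)//; exact: HS.
(* Summing over the source index: chi^-1 is coarsely Lipschitz. *)
have Krow l n : \sum_(0 <= k < n) K l k <= C * (L `^ s * S).
  rewrite -mulr_sumr ler_wpM2l ?(ltW C0)//.
  apply: (@le_trans _ _ (\sum_(0 <= k < n) L `^ s * jap (node A b k - psi (node A b l)) `^ (- s))).
    apply: ler_sum => k _; rewrite powRN_scale ?(ltW (jap_gt0 _))//.
    apply: powRN_le; [exact: ltW|by rewrite mulr_gt0 ?invr_gt0 ?jap_gt0|].
    rewrite ler_pdivrMl//; apply: le_trans (HL _ _) _.
    by rewrite chiK ler_wpM2l ?(ltW L0)// japBC.
  by rewrite -mulr_sumr ler_wpM2l ?(ltW L's)//; exact: HS.
have Kb : 0 < C * (S + L `^ s * S) by rewrite mulr_gt0// addr_gt0// mulr_gt0.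
have ext w p : w <> 0 -> (1 <= p)%E -> extends_boundedly T (modspace w p) (modnorm w p).
  move=> w0 p1; apply: (op_ext_extends injb surjb Au pf Tl Tc Kb TK) => // k n.
  - by apply: le_trans (Krow k n) _; rewrite ler_wpM2l ?(ltW C0)// lerDr ltW.
  - by apply: le_trans (Kcol k n) _; rewrite ler_wpM2l ?(ltW C0)// lerDl (ltW (mulr_gt0 L's S0)).
have same w : w <> 0 -> same_normed_space (@L2space R d) (@L2norm R d)
    (modspace w 2%:E) (modnorm w 2%:E) by exact: (L2_same_modspace2 injb surjb Au pf).
split; [by move=> w w0 p; exact: ext|split=> //].
(* The statement on L^2 involves no window, so the generator [g] of the frame serves as the window
   of M^2. *)
apply: (same_normed_space_extends (same g g0)) => [u|]; first exact: Lnorm_ge0.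
by apply: ext => //; rewrite lee_fin ler1n.
Qed.
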